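(* Let $Y=\lbrace{-1,1 \rbrace}$ and let $L: Y\times\mathbb{R}\to [0,\infty)$ be the hinge loss. Let $P$ be a distribution on $X \times Y$ with margin-noise exponent $\beta \in (0,\infty)$ and noise exponent $q \in [0, \infty ]$. Moreover, let assumption (A) be satisfied. Then, for all $p \in (0,1)$, $n \geq 1$, $\tau \geq 1$ with $\tau \leq n$, $\boldsymbol\lambda=(\lambda_1,\ldots,\lambda_m)\in (0,\infty)^m$, $\boldsymbol\gamma=(\gamma_1,\ldots,\gamma_m)\in (0,r]^m$ the local SVM $f_{D,\boldsymbol\lambda,\boldsymbol\gamma}=\sum_{j=1}^m f_{D_j,\lambda_j,\gamma_j}$ satisfies \begin{align*} \mathcal{R}_{L,P}(\operatorname{clip}\circ f_{D,\boldsymbol\lambda,\boldsymbol\gamma})-\mathcal{R}_{L,P}^* &\,\leq \, C_{\beta,d,p,q} \Biggl( \sum_{j=1}^m \lambda_j \gamma_j^{-d}+ \gamma_{\text{max}}^{\beta} + \left(\frac{\tau}{n}\right)^{\frac{q+1}{q+2}} \nonumber\\ &\quad +\left( r^{2p} \left(\sum_{j=1}^m \lambda_j^{-1} \gamma_j^{-\frac{d+2p}{p}} P_X(A_{j}) \right)^p n^{-1} \right)^{\frac{q+1}{q+2-p}} \Biggr) \end{align*} with probability $P^n$ not less than $1-3e^{-\tau}$, where the constant $C_{\beta,d,p,q}>0$ depends only on $d,\beta,p$ and $q$.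
   Context: Setting: $X\subset[-1,1]^d$, $Y=\{-1,1\}$, $D=((x_1,y_1),\ldots,(x_n,y_n))$ sampled i.i.d. from $P$ on $X\times Y$, $P_X$ the marginal of $P$. Hinge loss $L(y,t)=\max\{0,1-yt\}$; $\mathcal{R}_{L,P}(f)=\int L(y,f(x))\,dP(x,y)$, $\mathcal{R}^*_{L,P}$ the infimum over measurable $f$. Clipping: $\operatorname{clip}(t)=\max\{-1,\min\{t,1\}\}$. With $\eta(x)=P(y=1|x)$, $X_{1}=\{\eta>1/2\}$, $X_{-1}=\{\eta<1/2\}$, $\Delta_\eta(x)=\mathrm{dist}(x,X_1)$ for $x\in X_{-1}$, $\mathrm{dist}(x,X_{-1})$ for $x\in X_1$, $0$ otherwise. $P$ has margin-noise exponent $\beta$ if $\int_{\{\Delta_\eta(x)<t\}}|2\eta(x)-1|\,dP_X(x)\le(c_{\text{MNE}}t)^\beta$ for all $t>0$ (some $c_{\text{MNE}}\ge1$), and noise exponent $q$ if $P_X(\{|2\eta-1|<\varepsilon\})\le(c_{\text{NE}}\varepsilon)^q$ for all $\varepsilon>0$. Assumption (A): $(A_j)_{j=1,\ldots,m}$ is a partition of $X$ with nonempty interiors and radii $r_{A_j}<r\le 16m^{-1/d}$, where $r_T=\inf\{\varepsilon>0:\exists s\in T,\ T\subset B_2(s,\varepsilon)\}$; $H_{\gamma_j}(A_j)$ is the RKHS over $A_j$ of the Gaussian kernel $k_{\gamma_j}(x,x')=\exp(-\gamma_j^{-2}\|x-x'\|_2^2)$, $\gamma_{\max}=\max_j\gamma_j$.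 $\hat H_{\gamma_j}$ consists of the zero-extensions to $X$ of functions in $H_{\gamma_j}(A_j)$ with the same norm. With $D_j=\{(x,y)\in D: x\in A_j\}$, $f_{D_j,\lambda_j,\gamma_j}=\arg\min_{\hat f\in\hat H_{\gamma_j}}\lambda_j\|\hat f\|^2_{\hat H_{\gamma_j}}+\frac1n\sum_{(x_i,y_i)\in D_j}L(y_i,f(x_i))$, and $f_{D,\boldsymbol\lambda,\boldsymbol\gamma}=\sum_{j=1}^m f_{D_j,\lambda_j,\gamma_j}$.
   Formalization: The constant C may depend, besides d, β, p and q, also on the constants c_MNE and c_NE of the margin-noise and noise exponent conditions; a constant uniform in these cannot exist. *)

(* Defs.v *)
From HB Require Import structures.
From mathcomp Require Import all_boot all_order all_algebra.
From mathcomp Require Import all_classical all_reals all_analysis.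
Import Order.TTheory GRing.Theory Num.Theory.
Import numFieldNormedType.Exports.

Set Implicit Arguments.
Unset Strict Implicit.
Unset Printing Implicit Defensive.

Local Open Scope classical_set_scope.
Local Open Scope ring_scope.

Section LocalSVM.
Context {R : realType} {d : nat}.

(* points of R^d are d-tuples (measurable structure generated by coordinates) *)
Notation pt := (d.-tuple R).

Definition dist2 (x y : pt) : R :=
  Num.sqrt (\sum_(i < d) (tnth x i - tnth y i) ^+ 2).

Definition ball2 (s : pt) (e : R) : set pt := [set x | dist2 x s < e].

Definition cube : set pt := [set x | forall i, -1 <= tnth x i <= 1].

(* dist(x, S) = inf_{s in S} ||x - s||_2  (= +oo if S is empty) *)
Definition setdist (x : pt) (S : set pt) : \bar R :=
  ereal_inf [set (dist2 x s)%:E | s in S].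

Definition radius (T : set pt) : \bar R :=
  ereal_inf [set e%:E | e in [set e : R | 0 < e /\ exists2 s, T s & T `<=` ball2 s e]].

Definition nonempty_interior (A : set pt) : Prop :=
  exists s e, 0 < e /\ ball2 s e `<=` A.

Definition kgauss (gam : R) (x x' : pt) : R :=
  expR (- (gam ^-2 * (dist2 x x') ^+ 2)).

(* ---- RKHS H_gamma(A) via the Moore-Aronszajn construction ---- *)
(* a pre-RKHS element  sum_k a_k k(z_k, .)  is a finite list of (a_k, z_k) *)
Definition pre_eval (gam : R) (s : seq (R * pt)) (x : pt) : R :=
  \sum_(c <- s) c.1 * kgauss gam c.2 x.

Definition pre_norm2 (gam : R) (s : seq (R * pt)) : R :=
  \sum_(c <- s) \sum_(c' <- s) c.1 * c'.1 * kgauss gam c.2 c'.2.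

Definition pre_sub (s t : seq (R * pt)) : seq (R * pt) :=
  s ++ [seq (- c.1, c.2) | c <- t].

(* rkhs_elem A gam f c : the restriction of f to A belongs to H_gam(A), the
   completion of span{k_gam(z,.) | z in A}, and ||f|_A||^2_{H_gam(A)} = c. *)
Definition rkhs_elem (A : set pt) (gam : R) (f : pt -> R) (c : R) : Prop :=
  exists h : nat -> seq (R * pt),
    [/\ (forall k, {in h k, forall a, A a.2}),
        (forall e, 0 < e -> exists N : nat, forall k l, (N <= k)%N -> (N <= l)%N ->
            pre_norm2 gam (pre_sub (h k) (h l)) <= e),
        (forall x, A x -> pre_eval gam (h k) x @[k --> \oo] --> f x) &
        pre_norm2 gam (h k) @[k --> \oo] --> c].

Definition hat_rkhs_elem (A : set pt) (gam : R) (f : pt -> R) (c : R) : Prop :=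
  rkhs_elem A gam f c /\ (forall x, ~ A x -> f x = 0).

Definition ysgn (y : bool) : R := if y then 1 else -1.

Definition hinge (y : bool) (t : R) : R := Num.max 0 (1 - ysgn y * t).

Definition clip (t : R) : R := Num.max (-1) (Num.min t 1).

(* regularized empirical objective on the sub-sample D_j = {(x_i,y_i) : x_i in A}
   (note the normalization 1/n with n the full sample size) *)
Definition svm_obj (n : nat) (D : 'I_n -> pt * bool) (A : set pt) (lam : R)
    (f : pt -> R) (c : R) : R :=
  lam * c + n%:R^-1 * \sum_(i < n | `[< A (D i).1 >]) hinge (D i).2 (f (D i).1).

Definition is_svm_sol (n : nat) (D : 'I_n -> pt * bool) (A : set pt) (lam gam : R)
    (f : pt -> R) : Prop :=
  exists c, hat_rkhs_elem A gam f c /\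
    forall g c', hat_rkhs_elem A gam g c' -> svm_obj D A lam f c <= svm_obj D A lam g c'.

Definition risk (P : probability (pt * bool)%type R) (f : pt -> R) : \bar R :=
  (\int[P]_z (hinge z.2 (f z.1))%:E)%E.

Definition bayes_risk (P : probability (pt * bool)%type R) : \bar R :=
  ereal_inf [set risk P f | f in [set f : pt -> R | measurable_fun setT f]].

(* eta is a version of x |-> P(y = 1 | x) *)
Definition is_eta (P : probability (pt * bool)%type R) (eta : pt -> R) : Prop :=
  [/\ measurable_fun setT eta, (forall x, 0 <= eta x <= 1) &
      forall B : set pt, measurable B ->
        P (B `*` [set true]) = (\int[P]_(z in B `*` setT) (eta z.1)%:E)%E].

Definition Xpos (X : set pt) (eta : pt -> R) : set pt := [set x | X x /\ 1/2 < eta x].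
Definition Xneg (X : set pt) (eta : pt -> R) : set pt := [set x | X x /\ eta x < 1/2].

Definition Delta (X : set pt) (eta : pt -> R) (x : pt) : \bar R :=
  if `[< Xneg X eta x >] then setdist x (Xpos X eta)
  else if `[< Xpos X eta x >] then setdist x (Xneg X eta)
  else 0%E.

Definition has_MNE (X : set pt) (P : probability (pt * bool)%type R) (eta : pt -> R)
    (beta cMNE : R) : Prop :=
  forall t : R, 0 < t ->
    (\int[P]_(z in [set z : pt * bool | (Delta X eta z.1 < t%:E)%E])
        (`|2 * eta z.1 - 1|)%:E <= ((cMNE * t) `^ beta)%:E)%E.

(* noise exponent q in [0, +oo] with constant cNE; for q = +oo the bound
   (cNE eps)^q is read as its limit, i.e. P_X(|2eta-1| < eps) = 0 when cNE eps < 1 *)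
Definition has_NE (P : probability (pt * bool)%type R) (eta : pt -> R)
    (q : \bar R) (cNE : R) : Prop :=
  match q with
  | EFin q' => forall eps : R, 0 < eps ->
      (P [set z : pt * bool | (`|2 * eta z.1 - 1| < eps)%R] <= ((cNE * eps) `^ q')%:E)%E
  | +oo%E => forall eps : R, 0 < eps -> cNE * eps < 1 ->
      P [set z : pt * bool | (`|2 * eta z.1 - 1| < eps)%R] = 0%E
  | -oo%E => False
  end.

Definition qexp1 (q : \bar R) : R :=
  match q with EFin q' => (q' + 1) / (q' + 2) | _ => 1 end.
Definition qexp2 (q : \bar R) (p : R) : R :=
  match q with EFin q' => (q' + 1) / (q' + 2 - p) | _ => 1 end.

Definition assumptionA (X : set pt) (m : nat) (A : 'I_m -> set pt) (r : R) : Prop :=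
  [/\ (forall j, measurable (A j)),
      (forall i j, i != j -> A i `&` A j = set0),
      (\bigcup_(j in [set: 'I_m]) A j = X),
      (forall j, nonempty_interior (A j) /\ (radius (A j) < r%:E)%E) &
      r <= 16 * (m%:R `^ (- (d%:R)^-1))].

(* Z_0, ..., Z_{n-1} : Om -> X x Y are i.i.d. with law P (this models D ~ P^n) *)
Definition iid_sample {dO} {Om : measurableType dO} (Q : probability Om R) (n : nat)
    (P : probability (pt * bool)%type R) (Z : 'I_n -> Om -> pt * bool) : Prop :=
  [/\ (forall i, measurable_fun setT (Z i)),
      (forall i (B : set (pt * bool)), measurable B -> Q (Z i @^-1` B) = P B) &
      forall B : 'I_n -> set (pt * bool), (forall i, measurable (B i)) ->
        Q (\bigcap_(i in [set: 'I_n]) (Z i @^-1` B i)) =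
        (\prod_(i < n) Q (Z i @^-1` B i))%E].

End LocalSVM.

(* Main.v *)
(* Let h_g(x, y) = y (f*(x) - clip (g x)) with f* the Bayes classifier.  As the hinge loss is affine
   on [-1, 1], E h_g is the excess risk of clip g, and the noise exponent gives
   E h_g^2 <= V s^theta, theta = q / (q + 1), as soon as E h_g <= s.  Let rho be the bracket of the
   theorem and s = B rho with B a large constant; only s <= 1 matters.

   On the class of g with sum_j lambda_j ||g_j||^2 <= s and E h_g <= s, all deviations
   E h_g - E_n h_g are at most s / 8 with high probability.  This is a chaining argument at the levels
   D_k = V s^theta 4^-k with Bernstein's inequality on the links; the L2 nets at level D have log
   cardinality at most N (s / D)^p.  They are products over the pieces of uniform nets, built from
   Taylor truncations of the kernel on cells of size proportional to gamma_j with quantized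
   coefficients; at level D the radius on A_j is (D / (m P(A_j)))^(1/2), and concavity of x^p turns
   the sum over j of the entropies into the last term of rho.

   An oracle a is obtained by summing Gaussians over a grid, signed according to the closer of the two
   classes; its error at distance t from the other class is gamma^beta + exp(-t^2 / (8 gamma^2)), so
   that the margin-noise exponent bounds E h_a by C gamma_max^beta.

   Finally move along the segment from a to the SVM solution.  Convexity of the regularized empirical
   risk and the deviation bound keep sum_j lambda_j ||.||^2 + E h below s / 2 all the way. *)
Require Import Defs.
From HB Require Import structures.
From mathcomp Require Import all_boot all_order all_algebra.
From mathcomp Require Import all_classical all_reals all_analysis.
From mathcomp Require Import ring lra zify measurable_realfun.
Import Order.TTheory GRing.Theory Num.Theory.
Import numFieldNormedType.Exports.
Set Implicit Arguments.
Unset Strict Implicit.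
Unset Printing Implicit Defensive.
Local Open Scope classical_set_scope.
Local Open Scope ring_scope.

(** * Positive semidefinite kernels *)

(** The deviation bound holds only on a class of small norm and small excess, and nothing places the
    SVM solution there beforehand; one fixed level [s] and a path that starts inside the class
    replace peeling over shells. Convexity belongs to the unclipped hinge loss: clipping comes
    afterwards and only lowers the loss, and the oracle, bounded by 1, is not affected by it. Every
    function on the path is a finite kernel sum; the SVM solution, a limit of such sums, is replaced
    by one within a tolerance. Chaining compares net points with net points, so its events are
    finite intersections and no supremum over the class has to be measurable. The last net is
    uniform on each piece, since an L2 net says nothing about the empirical mean of the error. The
    grid of the oracle is not contained in the pieces; restricting to [A j] costs a factor 4 in the
    squared norm. One [expR (- tau)] goes to the chain, one to the error of the last net, one to the
    oracle. The bound on [r] caps the bandwidths by 16 and gives [r ^+ d * m%:R <= 16 ^+ d], which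
    keeps [m] out of the constant. *)

Ltac pos := first [assumption | apply: ltW; assumption | lazymatch goal with
  | |- is_true (0 <= _ ^+ 2) => exact: sqr_ge0
  | |- is_true (0 <= _ * _) => apply: mulr_ge0; pos
  | |- is_true (0 < _ * _) => apply: mulr_gt0; pos
  | |- is_true (0 <= _ + _) => apply: addr_ge0; pos
  | |- is_true (0 < _ + _) =>
      first [apply: addr_gt0; pos | apply: ltr_wpDl; pos | apply: ltr_wpDr; pos]
  | |- is_true (0 <= _^-1) => rewrite invr_ge0; pos
  | |- is_true (0 < _^-1) => rewrite invr_gt0; pos
  | |- is_true (0 <= _ ^+ _) => apply: exprn_ge0; pos
  | |- is_true (0 < _ ^+ _) => apply: exprn_gt0; pos
  | |- is_true (0 <= _ `^ _) => exact: powR_ge0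
  | |- is_true (0 < _ `^ _) => apply: powR_gt0; pos
  | |- is_true (0 <= expR _) => exact: expR_ge0
  | |- is_true (0 < expR _) => exact: expR_gt0
  | |- is_true (0 <= Num.sqrt _) => exact: sqrtr_ge0
  | |- is_true (0 <= `| _ |) => exact: normr_ge0
  | |- is_true (0 <= _) => first [done | apply: ltW; done]
  | |- is_true (0 < _) => first [done | by rewrite ltr0n]
  | |- _ => done
  end].

Section Kernels.
Context {R : realType} {T : Type}.
Implicit Types (k : T -> T -> R) (s t : seq (R * T)).

(** The inner product of two finite combinations in the pre-Hilbert space of [k]. Keeping
    coefficient lists avoids the quotient by null vectors; [pre_norm2 g s] is by definition
    [kform (kgauss g) s s]. *)
Definition kform k s t : R :=
  \sum_(c <- s) \sum_(c' <- t) c.1 * c'.1 * k c.2 c'.2.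

Definition kscale (a : R) s : seq (R * T) := [seq (a * c.1, c.2) | c <- s].

Definition psd k :=
  (forall x y, k x y = k y x) /\ (forall s, 0 <= kform k s s).

Lemma kform_catl k s1 s2 t : kform k (s1 ++ s2) t = kform k s1 t + kform k s2 t.
Proof. by rewrite /kform big_cat. Qed.

Lemma kform_catr k s t1 t2 : kform k s (t1 ++ t2) = kform k s t1 + kform k s t2.
Proof.
by rewrite /kform -big_split; apply: eq_bigr => c _; rewrite big_cat.
Qed.

Lemma kform_scalel k a s t : kform k (kscale a s) t = a * kform k s t.
Proof.
rewrite /kform big_map big_distrr; apply: eq_bigr => c _ /=.
by rewrite big_distrr; apply: eq_bigr => c' _ /=; rewrite !mulrA.
Qed.

Lemma kform_scaler k a s t : kform k s (kscale a t) = a * kform k s t.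
Proof.
rewrite /kform big_distrr; apply: eq_bigr => c _ /=.
rewrite big_map big_distrr; apply: eq_bigr => c' _ /=; ring.
Qed.

Lemma kform_sym k s t : (forall x y, k x y = k y x) -> kform k s t = kform k t s.
Proof.
move=> ks; rewrite /kform exchange_big; apply: eq_bigr => c _ /=.
by apply: eq_bigr => c' _ /=; rewrite ks [c'.1 * _]mulrC.
Qed.

Lemma kform1r k s x : kform k s [:: (1, x)] = \sum_(c <- s) c.1 * k c.2 x.
Proof. by rewrite /kform; apply: eq_bigr => c _; rewrite big_seq1 /= mulr1. Qed.

Lemma kform11 k x : kform k [:: (1, x)] [:: (1, x)] = k x x.
Proof. by rewrite kform1r big_seq1 /= mul1r. Qed.

(** The form of [s + l t] is a nonnegative quadratic in [l]. The form may be degenerate: if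
    [kform k t t] vanishes, the quadratic is affine in [l], which forces the mixed term to
    vanish. *)
Lemma psd_CauchySchwarz k s t : psd k ->
  (kform k s t) ^+ 2 <= kform k s s * kform k t t.
Proof.
move=> [ks kp]; set a := kform k s s; set b := kform k s t; set c := kform k t t.
have Q l : 0 <= a + 2 * l * b + l ^+ 2 * c.
  have := kp (s ++ kscale l t).
  rewrite !(kform_catl, kform_catr, kform_scalel, kform_scaler).
  rewrite (kform_sym t s ks) -/a -/b -/c => H; apply: le_trans H _.
  by rewrite le_eqVlt; apply/orP; left; apply/eqP; ring.
have a0 : 0 <= a by exact: kp.
have [c0|c0] := ltP 0 c; last first.
  have {c0}c0 : c = 0 by apply/eqP; rewrite eq_le c0 kp.
  have [->|b0] := eqVneq b 0; first by rewrite expr0n c0 mulr0.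
  have := Q (- (a + 1) / (2 * b)).
  rewrite c0 mulr0 addr0.
  have -> : a + 2 * (- (a + 1) / (2 * b)) * b = -1 by field.
  by rewrite oppr_ge0 ler10.
have := Q (- b / c).
have -> : a + 2 * (- b / c) * b + (- b / c) ^+ 2 * c = a - b ^+ 2 / c.
  by field; rewrite gt_eqF.
by rewrite subr_ge0 ler_pdivrMr.
Qed.

Lemma psd_sqr k x y : psd k -> (k x y) ^+ 2 <= k x x * k y y.
Proof.
move=> kp; have := psd_CauchySchwarz [:: (1, x)] [:: (1, y)] kp.
by rewrite !kform1r !big_seq1 /= !mul1r.
Qed.

Lemma psd_diag_ge0 k x : psd k -> 0 <= k x x.
Proof. by move=> [_ /(_ [:: (1, x)])]; rewrite kform11. Qed.

(** The defect is [l * (1 - l)] times the form of [s - t]. *)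
Lemma kform_convex k s t (l : R) : psd k -> 0 <= l <= 1 ->
  kform k (kscale (1 - l) s ++ kscale l t) (kscale (1 - l) s ++ kscale l t) <=
  (1 - l) * kform k s s + l * kform k t t.
Proof.
move=> [ks kp] /andP[l0 l1].
rewrite !(kform_catl, kform_catr, kform_scalel, kform_scaler) (kform_sym t s ks).
have := kp (s ++ kscale (-1) t).
rewrite !(kform_catl, kform_catr, kform_scalel, kform_scaler) (kform_sym t s ks).
move: (kform k s s) (kform k s t) (kform k t t) => a b c H.
have ll : 0 <= l * (1 - l) by rewrite mulr_ge0// subr_ge0.
have := mulr_ge0 ll H; rewrite -subr_ge0 => H'; rewrite -subr_ge0.
by apply: le_trans H' _; rewrite le_eqVlt; apply/orP; left; apply/eqP; ring.
Qed.

(** A finite feature expansion turns the form into a sum of squares; bounding one square by the sum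
    later controls each Taylor coefficient. *)
Lemma psd_features (I : finType) (phi : I -> T -> R) :
  psd (fun x y => \sum_i phi i x * phi i y) /\
  forall s, kform (fun x y => \sum_i phi i x * phi i y) s s =
    \sum_i (\sum_(c <- s) c.1 * phi i c.2) ^+ 2.
Proof.
have E s : kform (fun x y => \sum_i phi i x * phi i y) s s =
    \sum_i (\sum_(c <- s) c.1 * phi i c.2) ^+ 2.
  rewrite /kform.
  under eq_bigr => c _ do under eq_bigr => c' _ do rewrite big_distrr /=.
  under eq_bigr => c _ do rewrite exchange_big /=.
  rewrite exchange_big; apply: eq_bigr => i _ /=.
  rewrite expr2 big_distrl; apply: eq_bigr => c _ /=.
  rewrite big_distrr; apply: eq_bigr => c' _ /=; ring.
split=> //; split; first by move=> x y; apply: eq_bigr => i _; rewrite mulrC.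
by move=> s; rewrite E; apply: sumr_ge0 => i _; rewrite sqr_ge0.
Qed.

Lemma psd_mul_fun k (w : T -> R) : psd k -> psd (fun x y => w x * w y * k x y).
Proof.
move=> [ks kp]; split; first by move=> x y; rewrite ks [w x * _]mulrC.
move=> s; have := kp [seq (c.1 * w c.2, c.2) | c <- s].
move=> /le_trans; apply; rewrite le_eqVlt; apply/orP; left; apply/eqP.
rewrite /kform big_map; apply: eq_bigr => c _; rewrite big_map.
by apply: eq_bigr => c' _ /=; ring.
Qed.

Lemma psd_scale k (a : R) : 0 <= a -> psd k -> psd (fun x y => a * k x y).
Proof.
move=> a0 [ks kp]; split; first by move=> x y; rewrite ks.
move=> s; rewrite (_ : kform _ _ _ = a * kform k s s) ?mulr_ge0//.
rewrite /kform big_distrr; apply: eq_bigr => c _ /=.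
by rewrite big_distrr; apply: eq_bigr => c' _ /=; ring.
Qed.

Lemma psd_sum (k : nat -> T -> T -> R) m n : (forall i, psd (k i)) ->
  psd (fun x y => \sum_(m <= i < n) k i x y).
Proof.
move=> kp; split.
  by move=> x y; apply: eq_bigr => i _; rewrite (kp i).1.
move=> s.
rewrite (_ : kform _ _ _ = \sum_(m <= i < n) kform (k i) s s).
  by apply: sumr_ge0 => i _; exact: (kp i).2.
rewrite /kform.
under eq_bigr => c _ do under eq_bigr => c' _ do rewrite big_distrr /=.
under eq_bigr => c _ do rewrite exchange_big /=.
by rewrite exchange_big.
Qed.

Lemma cvg_big_sum (I : Type) (r : seq I) (F : nat -> I -> R) (G : I -> R) :
  (forall i, F n i @[n --> \oo] --> G i) ->
  \sum_(i <- r) F n i @[n --> \oo] --> \sum_(i <- r) G i.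
Proof.
move=> H; elim: r => [|i r IH].
  by under eq_cvg do rewrite big_nil; rewrite big_nil; exact: cvg_cst.
by under eq_cvg do rewrite big_cons; rewrite big_cons; exact: cvgD.
Qed.

Lemma psd_lim (k : nat -> T -> T -> R) (l : T -> T -> R) :
  (forall n, psd (k n)) -> (forall x y, k n x y @[n --> \oo] --> l x y) -> psd l.
Proof.
move=> kp kl; split.
  move=> x y; have E : (fun n => k n x y) = (fun n => k n y x).
    by apply/funext => n; rewrite (kp n).1.
  by rewrite -(cvg_lim _ (kl x y))// E (cvg_lim _ (kl y x)).
move=> s; have : kform (k n) s s @[n --> \oo] --> kform l s s.
  apply: cvg_big_sum => c; apply: cvg_big_sum => c'.
  by apply: cvgM; [exact: cvg_cst|exact: kl].
move=> H; rewrite -(cvg_lim _ H)//; apply: limr_ge; first by apply/cvg_ex; eexists; exact: H.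
by near=> n; exact: (kp n).2.
Unshelve. all: end_near. Qed.

End Kernels.

(** * The Gaussian kernel and its Taylor truncations *)

Section Gauss.
Context {R : realType} {d : nat}.
Local Notation pt := (d.-tuple R).
Implicit Types (x y z : pt) (g : R) (s t : seq (R * pt)).

Definition dot_at z x y : R :=
  \sum_(i < d) (tnth x i - tnth z i) * (tnth y i - tnth z i).

Lemma dist2_ge0 x y : 0 <= dist2 x y.
Proof. exact: sqrtr_ge0. Qed.

Lemma sqr_dist2 x y : (dist2 x y) ^+ 2 = \sum_(i < d) (tnth x i - tnth y i) ^+ 2.
Proof. by rewrite sqr_sqrtr// sumr_ge0// => i _; rewrite sqr_ge0. Qed.

Lemma dist2C x y : dist2 x y = dist2 y x.
Proof.
by rewrite /dist2; congr Num.sqrt; apply: eq_bigr => i _; rewrite -sqrrN opprB.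
Qed.

Lemma dist2_xx x : dist2 x x = 0.
Proof. by rewrite /dist2 big1 ?sqrtr0// => i _; rewrite subrr expr0n. Qed.

Lemma sqr_dist2_dot x y z :
  (dist2 x y) ^+ 2 = (dist2 x z) ^+ 2 + (dist2 y z) ^+ 2 - 2 * dot_at z x y.
Proof.
rewrite !sqr_dist2 /dot_at big_distrr -big_split -sumrB; apply: eq_bigr => i _ /=.
ring.
Qed.

Lemma dot_at_psd z : psd (dot_at z).
Proof.
have [H _] := psd_features (fun (i : 'I_d) x => tnth x i - tnth z i).
exact: H.
Qed.

Lemma dist2_triangle x y z : dist2 x y <= dist2 x z + dist2 z y.
Proof.
rewrite -(@ler_pXn2r _ 2)// ?nnegrE ?addr_ge0 ?dist2_ge0//.
rewrite (sqr_dist2_dot x y z) [dist2 z y]dist2C sqrrD.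
have xx u : dot_at z u u = dist2 u z ^+ 2.
  by rewrite sqr_dist2; apply: eq_bigr => i _; rewrite expr2.
have := psd_sqr x y (dot_at_psd z); rewrite !xx -exprMn => H.
have : `|dot_at z x y| <= dist2 x z * dist2 y z.
  rewrite -(@ler_pXn2r _ 2)// ?nnegrE ?mulr_ge0 ?dist2_ge0//.
  by rewrite real_normK ?num_real.
rewrite ler_norml => /andP[H1 H2]; rewrite -mulr_natl; lra.
Qed.

Lemma coord_le_dist2 x y (i : 'I_d) : `|tnth x i - tnth y i| <= dist2 x y.
Proof.
rewrite -(@ler_pXn2r _ 2)// ?nnegrE ?dist2_ge0//.
rewrite real_normK ?num_real// sqr_dist2 (bigD1 i)//= lerDl.
by rewrite sumr_ge0// => j _; rewrite sqr_ge0.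
Qed.

(* Expanding the factor [expR (2 g^-2 <x - z, y - z>)] of the Gaussian kernel around [z] to order [M];
   both the truncation and the remainder are psd, so the truncation contracts RKHS norms. *)
Definition gtrunc g z M x y : R :=
  kgauss g x z * kgauss g y z *
  \sum_(0 <= n < M) (2 * g ^-2 * dot_at z x y) ^+ n / n`!%:R.

Lemma kgaussC g x y : kgauss g x y = kgauss g y x.
Proof. by rewrite /kgauss dist2C. Qed.

Lemma kgauss_gt0 g x y : 0 < kgauss g x y.
Proof. exact: expR_gt0. Qed.

Lemma kgauss_xx g x : kgauss g x x = 1.
Proof. by rewrite /kgauss dist2_xx expr0n mulr0 oppr0 expR0. Qed.

Lemma kgauss_exp g x y z :
  kgauss g x y = kgauss g x z * kgauss g y z * expR (2 * g ^-2 * dot_at z x y).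
Proof. by rewrite /kgauss -!expRD (sqr_dist2_dot x y z); congr expR; ring. Qed.

Lemma cvg_exp_series (v : R) :
  \sum_(0 <= i < n) v ^+ i / i`!%:R @[n --> \oo] --> expR v.
Proof. exact: is_cvg_series_exp_coeff. Qed.

Lemma cvg_gtrunc g z x y : gtrunc g z M x y @[M --> \oo] --> kgauss g x y.
Proof.
rewrite (kgauss_exp g x y z).
by apply: cvgM; [exact: cvg_cst|exact: cvg_exp_series].
Qed.

(** The power is expanded over words [nu] of coordinates rather than over multi-indices, so no
    multinomial coefficients appear. *)
Lemma dot_pow_features z n x y :
  dot_at z x y ^+ n = \sum_(nu : {ffun 'I_n -> 'I_d})
    (\prod_(l < n) (tnth x (nu l) - tnth z (nu l))) *
    (\prod_(l < n) (tnth y (nu l) - tnth z (nu l))).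
Proof.
rewrite -[n in LHS]card_ord -prodr_const /dot_at.
rewrite (bigA_distr_bigA (fun (_ : 'I_n) i =>
  (tnth x i - tnth z i) * (tnth y i - tnth z i))).
by apply: eq_bigr => nu _; rewrite big_split.
Qed.

Lemma dot_pow_psd z n : psd (fun x y => dot_at z x y ^+ n).
Proof.
have [H _] := psd_features (fun (nu : {ffun 'I_n -> 'I_d}) x =>
   \prod_(l < n) (tnth x (nu l) - tnth z (nu l))).
rewrite (_ : (fun x y => _) = (fun x y => \sum_(nu : {ffun 'I_n -> 'I_d})
    (\prod_(l < n) (tnth x (nu l) - tnth z (nu l))) *
    (\prod_(l < n) (tnth y (nu l) - tnth z (nu l)))))//.
by apply/funext => x; apply/funext => y; exact: dot_pow_features.
Qed.

Lemma gterm_psd g z n :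
  psd (fun x y => (2 * g ^-2 * dot_at z x y) ^+ n / n`!%:R).
Proof.
have a0 : 0 <= (2 * g ^-2) ^+ n / n`!%:R.
  by rewrite divr_ge0// exprn_ge0// mulr_ge0// invr_ge0 sqr_ge0.
have := psd_scale a0 (dot_pow_psd z n).
rewrite (_ : (fun x y => _ / _ * _) =
  (fun x y => (2 * g ^-2 * dot_at z x y) ^+ n / n`!%:R))//.
by apply/funext => x; apply/funext => y; rewrite [in RHS]exprMn mulrAC.
Qed.

Lemma gpart_psd g z m n : psd (fun x y => kgauss g x z * kgauss g y z *
  \sum_(m <= i < n) (2 * g ^-2 * dot_at z x y) ^+ i / i`!%:R).
Proof. by apply: psd_mul_fun; apply: psd_sum => i; exact: gterm_psd. Qed.

Lemma gtrunc_psd g z M : psd (gtrunc g z M).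
Proof. exact: gpart_psd. Qed.

Lemma kgauss_psd g : psd (@kgauss R d g).
Proof.
apply: (@psd_lim _ _ (gtrunc g [tuple 0 | i < d])) => [n|x y].
  exact: gtrunc_psd.
exact: cvg_gtrunc.
Qed.

(** The remainder is the limit of the blocks of terms from [M] to [M + N], each of them psd. *)
Lemma gres_psd g z M : psd (fun x y => kgauss g x y - gtrunc g z M x y).
Proof.
apply: (@psd_lim _ _ (fun N x y => kgauss g x z * kgauss g y z *
  \sum_(M <= i < M + N) (2 * g ^-2 * dot_at z x y) ^+ i / i`!%:R)) => [n|x y].
  exact: gpart_psd.
rewrite (_ : (fun _ => _) = fun N => gtrunc g z (N + M) x y - gtrunc g z M x y).
  apply: cvgB; last exact: cvg_cst.
  by rewrite (cvg_shiftn M (fun n => gtrunc g z n x y)); exact: cvg_gtrunc.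
apply/funext => N; rewrite /gtrunc -mulrBr addnC; congr (_ * _).
by rewrite (@big_cat_nat _ _ _ M 0 (N + M))//= ?leq_addl// addrC addrK.
Qed.

Lemma kform_sub k k' s t : kform (fun x y : pt => k x y - k' x y) s t =
  kform k s t - kform k' s t :> R.
Proof.
rewrite /kform -sumrB; apply: eq_bigr => c _; rewrite -sumrB.
by apply: eq_bigr => c' _; rewrite mulrBr.
Qed.

Lemma gtrunc_le g z M s : kform (gtrunc g z M) s s <= pre_norm2 g s.
Proof. by rewrite -subr_ge0 -kform_sub; exact: (gres_psd g z M).2. Qed.

(** Termwise [(i + M)! >= i!], so the tail is at most [y ^+ M] times the full series. *)
Lemma exp_tail_le (y : R) M : 0 <= y ->
  expR y - \sum_(0 <= n < M) y ^+ n / n`!%:R <= y ^+ M * expR y.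
Proof.
move=> y0.
have H : \sum_(0 <= i < N + M) y ^+ i / i`!%:R -
    \sum_(0 <= n < M) y ^+ n / n`!%:R @[N --> \oo] -->
    expR y - \sum_(0 <= n < M) y ^+ n / n`!%:R.
  apply: cvgB; last exact: cvg_cst.
  rewrite (cvg_shiftn M (fun n => \sum_(0 <= i < n) y ^+ i / i`!%:R)).
  exact: cvg_exp_series.
have H2 : y ^+ M * \sum_(0 <= i < N) y ^+ i / i`!%:R @[N --> \oo] -->
    y ^+ M * expR y.
  by apply: cvgM; [exact: cvg_cst|exact: cvg_exp_series].
rewrite -(cvg_lim _ H)// -(cvg_lim _ H2)//; apply: ler_lim.
- by apply/cvg_ex; eexists; exact: H.
- by apply/cvg_ex; eexists; exact: H2.
near=> N; rewrite (@big_cat_nat _ _ _ M 0 (N + M))//= ?leq_addl// addrAC subrr add0r.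
rewrite -{1}[M]add0n big_addn addnK big_distrr /=.
apply: ler_sum => i _; rewrite exprD [_ * y ^+ M]mulrC -mulrA.
apply: ler_wpM2l; first exact: exprn_ge0.
apply: ler_wpM2l; first exact: exprn_ge0.
rewrite lef_pV2 ?posrE ?ltr0n ?fact_gt0// ler_nat.
by elim: (M) => [|m IH]; rewrite ?addn0// addnS factS (leq_trans IH)// leq_pmull.
Unshelve. all: end_near. Qed.

(** The index is a degree below [M] with a word of that length. The number of features depends on
    [d] and [M] only, not on the bandwidth or the centre, which keeps the covering constant
    uniform. *)
Definition gfeat g z M (u : {n : 'I_M & {ffun 'I_n -> 'I_d}}) (x : pt) : R :=
  kgauss g x z * (Num.sqrt ((2 * g ^-2) ^+ tag u / (tag u)`!%:R) *
  \prod_(l < tag u) (tnth x (tagged u l) - tnth z (tagged u l))).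

Lemma gtrunc_feat g z M x y :
  gtrunc g z M x y = \sum_(u : {n : 'I_M & {ffun 'I_n -> 'I_d}})
    gfeat g z u x * gfeat g z u y.
Proof.
rewrite /gtrunc big_mkord big_distrr /=.
under eq_bigr => n _.
  rewrite exprMn dot_pow_features [_ / _]mulrAC !big_distrr /=.
  over.
rewrite (sig_big_dep xpredT (fun (n : 'I_M) (_ : {ffun 'I_n -> 'I_d}) => true)) /=.
apply: eq_bigr => u _; rewrite /gfeat.
have a0 : 0 <= (2 * g ^-2) ^+ tag u / (tag u)`!%:R.
  by rewrite divr_ge0// exprn_ge0// mulr_ge0// invr_ge0 sqr_ge0.
rewrite -[in LHS](sqr_sqrtr a0); ring.
Qed.

Lemma gtrunc_xx_le1 g z M x : gtrunc g z M x x <= 1.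
Proof. by have := gtrunc_le g z M [:: (1, x)]; rewrite /pre_norm2 !kform11 -/(kform (kgauss g) _ _) kform11 kgauss_xx. Qed.

Lemma gfeat_le1 g z M (u : {n : 'I_M & {ffun 'I_n -> 'I_d}}) x :
  `|gfeat g z u x| <= 1.
Proof.
rewrite -(@ler_pXn2r _ 2)// ?nnegrE// expr1n real_normK ?num_real//.
apply: le_trans (gtrunc_xx_le1 g z M x); rewrite gtrunc_feat (bigD1 u)//= expr2 lerDl.
by rewrite sumr_ge0// => v _; rewrite -expr2 sqr_ge0.
Qed.

Definition gcoef g z M s (u : {n : 'I_M & {ffun 'I_n -> 'I_d}}) : R :=
  \sum_(c <- s) c.1 * gfeat g z u c.2.

Lemma gcoef_le g z M s (u : {n : 'I_M & {ffun 'I_n -> 'I_d}}) :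
  (gcoef g z s u) ^+ 2 <= pre_norm2 g s.
Proof.
apply: le_trans (gtrunc_le g z M s).
have E : gtrunc g z M = (fun x y => \sum_(u : {n : 'I_M & {ffun 'I_n -> 'I_d}})
    gfeat g z u x * gfeat g z u y).
  by apply/funext => x; apply/funext => y; exact: gtrunc_feat.
rewrite E (psd_features _).2 (bigD1 u)//= lerDl.
by rewrite sumr_ge0// => v _; rewrite sqr_ge0.
Qed.

(** Cauchy-Schwarz for the remainder kernel, between [s] and the evaluation at [x]. On the diagonal
    the two Gaussian factors cancel the exponential of the tail bound, so only the power of order
    [M] is left. *)
Lemma gtrunc_approx g z M s x :
  (pre_eval g s x - \sum_(u : {n : 'I_M & {ffun 'I_n -> 'I_d}})
     gcoef g z s u * gfeat g z u x) ^+ 2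
  <= pre_norm2 g s * (2 * g ^-2 * (dist2 x z) ^+ 2) ^+ M.
Proof.
have -> : pre_eval g s x - \sum_(u : {n : 'I_M & {ffun 'I_n -> 'I_d}})
     gcoef g z s u * gfeat g z u x =
     kform (fun x y => kgauss g x y - gtrunc g z M x y) s [:: (1, x)].
  rewrite kform_sub !kform1r; congr (_ - _); rewrite /gcoef.
  under eq_bigr do rewrite big_distrl /=.
  rewrite exchange_big; apply: eq_bigr => c _ /=.
  by rewrite gtrunc_feat big_distrr; apply: eq_bigr => u _ /=; rewrite mulrA.
apply: le_trans (psd_CauchySchwarz _ _ (gres_psd g z M)) _.
rewrite kform11; apply: ler_pM.
- exact: (gres_psd g z M).2.
- exact: (psd_diag_ge0 x (gres_psd g z M)).
- rewrite kform_sub lerBlDr lerDl; exact: (gtrunc_psd g z M).2.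
rewrite (kgauss_exp g x x z) /gtrunc -mulrBr.
have -> : dot_at z x x = dist2 x z ^+ 2.
  by rewrite sqr_dist2; apply: eq_bigr => i _; rewrite expr2.
set y := 2 * g ^-2 * _.
have y0 : 0 <= y by rewrite /y mulr_ge0 ?sqr_ge0// mulr_ge0// invr_ge0 sqr_ge0.
apply: (@le_trans _ _ (kgauss g x z * kgauss g x z * (y ^+ M * expR y))).
  by apply: ler_wpM2l (exp_tail_le M y0); rewrite mulr_ge0// ltW// kgauss_gt0.
rewrite mulrCA /kgauss -!expRD /y.
have -> : - (g ^- 2 * dist2 x z ^+ 2) + - (g ^- 2 * dist2 x z ^+ 2) +
   2 * g ^- 2 * dist2 x z ^+ 2 = 0 by ring.
by rewrite expR0 mulr1.
Qed.

Lemma pre_eval_kform g s x : pre_eval g s x = kform (kgauss g) s [:: (1, x)].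
Proof. by rewrite kform1r. Qed.

Lemma pre_eval_le g s x : (pre_eval g s x) ^+ 2 <= pre_norm2 g s.
Proof.
rewrite pre_eval_kform; apply: le_trans (psd_CauchySchwarz _ _ (kgauss_psd g)) _.
by rewrite kform11 kgauss_xx mulr1.
Qed.

Lemma pre_norm2_ge0 g s : 0 <= pre_norm2 g s.
Proof. exact: (kgauss_psd g).2. Qed.

Lemma pre_sub_scale s t : pre_sub s t = s ++ kscale (-1) t.
Proof. by congr (_ ++ _); apply: eq_map => c; rewrite mulN1r. Qed.

End Gauss.

Section Measurability.
Context {R : realType} {d : nat}.
Local Notation pt := (d.-tuple R).
Implicit Types (x y z : pt) (g : R).

Lemma measurable_coordB (c : R) i : measurable_fun [set: pt] (fun x => tnth x i - c).
Proof. by apply: measurable_funB => //; exact: measurable_tnth. Qed.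

Lemma measurable_sqr_dist2 z : measurable_fun [set: pt] (fun x => (dist2 x z) ^+ 2).
Proof.
rewrite (_ : (fun _ => _) = (fun x => \sum_(i < d) (tnth x i - tnth z i) ^+ 2)).
  apply: measurable_sum => i.
  exact: (@measurable_funX _ _ _ _ _ 2%N (measurable_coordB _ i)).
by apply/funext => x; rewrite sqr_dist2.
Qed.

Lemma measurable_kgauss g z : measurable_fun [set: pt] (fun x => kgauss g x z).
Proof.
apply: measurableT_comp => //; apply: measurableT_comp => //.
by apply: measurable_funM => //; exact: measurable_sqr_dist2.
Qed.

Lemma measurable_pre_eval g s : measurable_fun [set: pt] (pre_eval g s).
Proof.
apply: measurable_sum => c; apply: measurable_funM => //.
rewrite (_ : kgauss g c.2 = (fun x => kgauss g x c.2)); first exact: measurable_kgauss.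
by apply/funext => x; rewrite kgaussC.
Qed.

Lemma measurable_gfeat g z M u : measurable_fun [set: pt] (@gfeat R d g z M u).
Proof.
apply: measurable_funM; first exact: measurable_kgauss.
apply: measurable_funM => //; apply: measurable_prod => l _.
exact: measurable_coordB.
Qed.

End Measurability.

(** * Covering numbers of Gaussian RKHS balls *)

Section Covering.
Context {R : realType} {d : nat}.
Local Notation pt := (d.-tuple R).
Context (g h r Rad zeta : R) (s0 : pt) (n L M : nat).
Local Notation U := ({k : 'I_M & {ffun 'I_k -> 'I_d}}).
Local Notation cells := ({ffun 'I_d -> 'I_n.+1}).
Local Notation codes := ({ffun cells * U -> 'I_L.+1}).

Definition cell_corner (k : cells) : pt := [tuple tnth s0 i - r + h * g * (k i)%:R | i < d].
Definition cell_pos (x : pt) i : R := (tnth x i - tnth s0 i + r) / (h * g).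
(** Boxes are half-open, so that [x] lies in at most one cell and the sum in [code_eval] has at most
    one active term. *)
Definition in_cell (k : cells) (x : pt) : R :=
  \prod_(i < d) \1_[set x : pt | (k i)%:R <= cell_pos x i < (k i).+1%:R] x.
Definition code_eval (c : codes) (x : pt) : R :=
  \sum_(k : cells) in_cell k x *
    \sum_(u : U) (zeta * (c (k, u))%:R - Rad) * gfeat g (cell_corner k) u x.

Lemma measurable_code_eval c : measurable_fun [set: pt] (code_eval c).
Proof.
apply: measurable_sum => k; apply: measurable_funM.
  apply: measurable_prod => i _; apply: measurable_indic.
  have mp : measurable_fun [set: pt] (fun x => cell_pos x i).
    apply: measurable_funM => //; apply: measurable_funD => //.
    exact: measurable_coordB.
  rewrite (_ : [set x | _] =
    (fun x => cell_pos x i) @^-1` (`[(k i)%:R, (k i).+1%:R[%classic)).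
    by rewrite -[X in measurable X]setTI; exact: mp.
  by apply/seteqP; split=> x /=; rewrite in_itv.
apply: measurable_sum => u; apply: measurable_funM => //.
exact: measurable_gfeat.
Qed.

Context (g0 : 0 < g) (h0 : 0 < h) (z0 : 0 < zeta) (R0 : 0 < Rad).

Lemma code_eval_cell (c : codes) (k : cells) x : (forall i, (k i)%:R <= cell_pos x i < (k i).+1%:R) ->
  code_eval c x =
    \sum_(u : U) (zeta * (c (k, u))%:R - Rad) * gfeat g (cell_corner k) u x.
Proof.
move=> Hk; have kx : in_cell k x = 1.
  by rewrite /in_cell big1// => i _; rewrite indicE mem_set//; exact: Hk.
rewrite /code_eval (bigD1 k)//= kx mul1r [X in _ + X = _]big1 ?addr0// => k' kk'.
rewrite (_ : in_cell k' x = 0) ?mul0r//.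
have /existsP[i ki] : [exists i, k' i != k i].
  apply: contraNT kk'; rewrite negb_exists => /forallP H.
  by apply/eqP/ffunP => i; apply/eqP; have := H i; rewrite negbK.
rewrite /in_cell (bigD1 i)//= indicE memNset ?mul0r// => /= H.
move/negP: ki; apply; apply/eqP/val_inj => /=.
by rewrite -(truncn_def H) -(truncn_def (Hk i)).
Qed.

Lemma cell_exists x : dist2 x s0 < r -> 2 * r / (h * g) < n.+1%:R ->
  exists k : cells, forall i, (k i)%:R <= cell_pos x i < (k i).+1%:R.
Proof.
move=> xr rn.
have hg : 0 < h * g by rewrite mulr_gt0.
have B i : 0 <= cell_pos x i < n.+1%:R.
  have := coord_le_dist2 x s0 i => /le_lt_trans/(_ xr); rewrite ltr_norml => /andP[a b].
  rewrite divr_ge0 ?(ltW hg)//=; last by lra.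
  apply: lt_trans rn; rewrite /cell_pos ltr_pM2r ?invr_gt0//; lra.
have P i : (Num.truncn (cell_pos x i) < n.+1)%N.
  by have /andP[a b] := B i; rewrite truncn_lt_nat.
exists [ffun i => Ordinal (P i)] => i; rewrite ffunE /=.
by apply: truncn_itv; have /andP[] := B i.
Qed.

Lemma cell_dist x (k : cells) : (forall i, (k i)%:R <= cell_pos x i < (k i).+1%:R) ->
  dist2 x (cell_corner k) ^+ 2 <= d%:R * (h * g) ^+ 2.
Proof.
move=> H; have hg : 0 < h * g by rewrite mulr_gt0.
rewrite sqr_dist2 mulr_natl -[X in _ *+ X]card_ord -sumr_const; apply: ler_sum => i _.
rewrite tnth_mktuple; have := H i; rewrite /cell_pos.
rewrite ler_pdivlMr// ltr_pdivrMr// -natr1 mulrDl mul1r => /andP[a b].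
rewrite -[leLHS]real_normK ?num_real// lerXn2r ?nnegrE ?(ltW hg)//.
by rewrite ler_norml; apply/andP; split; lra.
Qed.

(** Two errors add up: the Taylor remainder on a cell, where the squared distance to the corner is
    at most [d%:R * (h * g) ^+ 2], and the rounding of each coefficient by at most [zeta], against
    features bounded by 1. *)
Lemma code_approx (s : seq (R * pt)) : pre_norm2 g s <= Rad ^+ 2 ->
  2 * r / (h * g) < n.+1%:R -> 2 * Rad / zeta < L.+1%:R ->
  exists c : codes, forall x, dist2 x s0 < r ->
    `|pre_eval g s x - code_eval c x| <=
      Rad * Num.sqrt (2 * d%:R * h ^+ 2) ^+ M + #|{: U}|%:R * zeta.
Proof.
move=> sR rn RL.
have co (k : cells) (u : U) : `|gcoef g (cell_corner k) s u| <= Rad.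
  rewrite -(@ler_pXn2r _ 2)// ?nnegrE ?(ltW R0)// real_normK ?num_real//.
  exact: le_trans (gcoef_le _ _ _ _) sR.
have P (ku : cells * U) :
    (Num.truncn ((gcoef g (cell_corner ku.1) s ku.2 + Rad) / zeta) < L.+1)%N.
  have := co ku.1 ku.2; rewrite ler_norml => /andP[a b].
  rewrite truncn_lt_nat; last by rewrite divr_ge0 ?(ltW z0)// -lerBlDr sub0r.
  by apply: le_lt_trans RL; rewrite ler_pM2r ?invr_gt0// mulr2n mulrDl mul1r lerD2r.
exists [ffun ku => Ordinal (P ku)] => x xr.
have [k kx] := cell_exists xr rn.
rewrite (code_eval_cell _ kx).
set z := cell_corner k.
rewrite -[X in `|X|](subrKA (\sum_(u : U) gcoef g z s u * gfeat g z u x)).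
apply: le_trans (ler_normD _ _) _; apply: lerD.
  rewrite -(@ler_pXn2r _ 2)// ?nnegrE ?mulr_ge0 ?exprn_ge0 ?sqrtr_ge0 ?(ltW R0)//.
  rewrite real_normK ?num_real//; apply: le_trans (gtrunc_approx _ _ _ _ _) _.
  have t0 : 0 <= 2 * d%:R * h ^+ 2 by rewrite mulr_ge0 ?sqr_ge0.
  rewrite [leRHS]exprMn -[_ ^+ M ^+ 2]exprM mulnC [_ ^+ (2 * M)]exprM (sqr_sqrtr t0).
  have g2 : 0 <= 2 * g ^- 2 by rewrite mulr_ge0// invr_ge0 sqr_ge0.
  apply: ler_pM => //; first exact: pre_norm2_ge0.
    by rewrite exprn_ge0// mulr_ge0// sqr_ge0.
  apply: lerXn2r; rewrite ?nnegrE//; first by rewrite mulr_ge0// sqr_ge0.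
  have := cell_dist kx; rewrite -/z => H.
  apply: le_trans (_ : 2 * g ^- 2 * (d%:R * (h * g) ^+ 2) <= _).
    by rewrite ler_wpM2l.
  by rewrite le_eqVlt; apply/orP; left; apply/eqP; field; rewrite gt_eqF.
rewrite -sumrB; apply: le_trans (ler_norm_sum _ _ _) _.
rewrite mulr_natl -sumr_const; apply: ler_sum => u _.
rewrite -mulrBl normrM -[leRHS]mulr1; apply: ler_pM => //; last exact: gfeat_le1.
rewrite ffunE /= -/z.
set y := (_ + Rad) / zeta.
have y0 : 0 <= y.
  rewrite divr_ge0 ?(ltW z0)// -lerBlDr sub0r.
  by have := co k u; rewrite ler_norml => /andP[].
have -> : gcoef g z s u = zeta * y - Rad by rewrite /y; field; rewrite gt_eqF.
have /andP[a b] := truncn_itv y0.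
have a' := ler_wpM2l (ltW z0) a; have b' := ler_wpM2l (ltW z0) (ltW b).
by rewrite -natr1 mulrDr mulr1 in b'; rewrite ler_norml; apply/andP; split; lra.
Qed.

Lemma card_codes : #|{: codes}| = (L.+1 ^ (n.+1 ^ d * #|{: U}|))%N.
Proof. by rewrite card_ffun card_ord card_prod card_ffun !card_ord. Qed.

End Covering.

Lemma powRVN (R : realType) (x a : R) : 0 <= x -> x^-1 `^ a = x `^ (- a).
Proof. by move=> x0; rewrite -(powR_inv1 x0) -powRrM mulN1r. Qed.

(** With [t = eps / (2 * Rad)], cells of side proportional to [g * t^(1/M)] make the remainder of
    order [eps], and there are about [(r / g)^d * t^(-d/M)] of them. As [M > 2d/a], the factor
    [t^(-d/M)] is at most [t^(-a/2)], and so is, up to a constant, the logarithm of the number of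
    coefficient values; the product is of order [(Rad / eps)^a], for an exponent [a] as small as
    desired. *)
Lemma gauss_cover (R : realType) (d : nat) (a : R) : 0 < a ->
  exists2 K : R, 0 < K &
  forall (g r Rad eps : R) (s0 : d.-tuple R), 0 < g <= r -> 0 < eps <= Rad ->
  exists (I : finType) (F : I -> d.-tuple R -> R),
    [/\ (forall i, measurable_fun setT (F i)),
      #|I|%:R <= expR (K * (r / g) ^+ d * (Rad / eps) `^ a) &
      forall s, pre_norm2 g s <= Rad ^+ 2 ->
        exists i, forall x, dist2 x s0 < r -> `|pre_eval g s x - F i x| <= eps].
Proof.
move=> a0; set M := (Num.truncn (2 * d%:R / a)).+1.
set N := #|{: {k : 'I_M & {ffun 'I_k -> 'I_d}}}|.
pose C1 : R := 3 * (N%:R + 1) + 2 / a.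
have N0 : 0 <= N%:R :> R by [].
have C10 : 0 < C1 by rewrite addr_gt0// ?divr_gt0// mulr_gt0// ltr_wpDl.
exists (C1 * N%:R * (3 * (2 * d%:R + 1)) ^+ d * 2 `^ a + 1).
  rewrite ltr_wpDl// !mulr_ge0 ?exprn_ge0 ?powR_ge0 ?(ltW C10)//.
move=> g r Rad eps s0 /andP[g0 gr] /andP[e0 eR].
have r0 : 0 < r by exact: lt_le_trans gr.
have R0 : 0 < Rad by exact: lt_le_trans eR.
pose t : R := eps / (2 * Rad).
have t0 : 0 < t by rewrite divr_gt0// mulr_gt0.
have t1 : t <= 1 by rewrite ler_pdivrMr ?mulr_gt0// mul1r; lra.
pose ta : R := t `^ (M%:R^-1).
have ta0 : 0 < ta by rewrite powR_gt0.
have taM : ta ^+ M = t.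
  by rewrite -powR_mulrn ?(ltW ta0)// -powRrM mulVf ?pnatr_eq0// powRr1// ltW.
have ta1 : ta <= 1.
  by rewrite -(@powRr0 _ t); apply: ger_powR; rewrite ?t0// invr_ge0.
pose D : R := 2 * d%:R + 1.
have D1 : 1 <= D by rewrite lerDr mulr_ge0.
have D0 : 0 < D by exact: lt_le_trans D1.
pose h : R := ta / D.
have h0 : 0 < h by rewrite divr_gt0.
have h1 : h <= 1 by rewrite ler_pdivrMr// mul1r (le_trans ta1).
have hg : 0 < h * g by rewrite mulr_gt0.
pose n := Num.truncn (2 * r / (h * g)).
pose zeta : R := eps / (2 * (N%:R + 1)).
have N1 : 0 < N%:R + 1 :> R by rewrite ltr_wpDl.
have z0 : 0 < zeta by rewrite divr_gt0// mulr_gt0.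
pose L := Num.truncn (2 * Rad / zeta).
exists {ffun {ffun 'I_d -> 'I_n.+1} * {k : 'I_M & {ffun 'I_k -> 'I_d}} -> 'I_L.+1}.
exists (fun c => code_eval g h r Rad zeta s0 c); split.
- by move=> c; exact: measurable_code_eval.
- rewrite card_codes -/N.
  pose y : R := t `^ (- (a / 2)).
  have y1 : 1 <= y.
    rewrite /y -[leLHS](@powRr0 _ t); apply: ger_powR; rewrite ?t0//.
    by rewrite oppr_le0 divr_ge0// ltW.
  have y0 : 0 < y by exact: lt_le_trans y1.
  have ty : t^-1 = y `^ (2 / a).
    rewrite /y -powRrM -powR_inv1 ?(ltW t0)//; congr (_ `^ _); field.
    by rewrite gt_eqF.
  have LE : L.+1%:R <= expR (C1 * y).
    have L1 : L.+1%:R <= 3 * (N%:R + 1) * t^-1.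
      have : L%:R <= 2 * Rad / zeta by rewrite truncn_le; pos.
      have -> : 2 * Rad / zeta = 2 * (N%:R + 1) * t^-1.
        by rewrite /zeta /t; field; rewrite !gt_eqF.
      have : 1 <= (N%:R + 1) * t^-1.
        by rewrite mulr_ege1// ?lerDr// invf_ge1.
      by rewrite -natr1 -!mulrA; move: ((N%:R + 1) * t^-1) => X; lra.
    (* Each factor is at most an exponential: [t^-1] is [y] to the power [2 / a], hence at most
       [expR y] to that power. *)
    apply: le_trans L1 _.
    apply: le_trans (_ : expR (3 * (N%:R + 1)) * expR (y * (2 / a)) <= _).
      apply: ler_pM; first by rewrite mulr_ge0// ltW.
      - by rewrite invr_ge0 ltW.
      - by apply: le_trans (expR_ge1Dx _); rewrite lerDr.
      rewrite ty expRM; apply: ge0_ler_powR; rewrite ?nnegrE ?(ltW y0) ?expR_ge0//.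
        by rewrite divr_ge0// ltW.
      by apply: le_trans (expR_ge1Dx _); rewrite lerDr.
    rewrite -expRD ler_expR /C1 [_ * y]mulrDl [y * _]mulrC lerD2r.
    by rewrite ler_peMr// mulr_ge0 ?ltW.
  have n1 : (n.+1)%:R ^+ d <= (3 * D) ^+ d * (r / g) ^+ d * y.
    have : n.+1%:R <= 3 * D * (r / g) * ta^-1.
      have : n%:R <= 2 * r / (h * g) by rewrite truncn_le; pos.
      have -> : 2 * r / (h * g) = 2 * (D * (r / g) * ta^-1).
        by rewrite /h; field; rewrite !gt_eqF.
      have : 1 <= D * (r / g) * ta^-1.
        by rewrite mulr_ege1 ?invf_ge1// mulr_ege1// ler_pdivlMr// mul1r.
      by rewrite -natr1 -!mulrA; move: (D * _) => X; lra.
    move=> H; have := @lerXn2r _ d _ _ _ _ H.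
    rewrite !nnegrE => /(_ (ler0n _ _)) => /(_ _)/le_trans; apply.
      pos.
    rewrite !exprMn; apply: ler_wpM2l.
      pos.
    rewrite exprVn -powR_mulrn ?(ltW ta0)// -powRrM -powRN.
    apply: ger_powR; rewrite ?t0// lerN2.
    have : 2 * d%:R / a < M%:R by exact: truncnS_gt.
    rewrite ltr_pdivrMr// => H'.
    by rewrite mulrC ler_pdivrMr ?ltr0n// mulrAC ler_pdivlMr// mulrC; lra.
  rewrite natrX.
  have LX (k : nat) : (L.+1%:R : R) ^+ k <= expR (C1 * y) ^+ k.
    by rewrite lerXn2r ?nnegrE ?expR_ge0.
  apply: le_trans (LX _) _.
  rewrite -expRM_natr ler_expR natrM natrX.
  apply: (@le_trans _ _ (C1 * y * ((3 * D) ^+ d * (r / g) ^+ d * y * N%:R))).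
    by apply: ler_wpM2l; [pos|exact: ler_wpM2r].
  have -> : C1 * y * ((3 * D) ^+ d * (r / g) ^+ d * y * N%:R) =
     C1 * N%:R * (3 * D) ^+ d * 2 `^ a * (r / g) ^+ d * (Rad / eps) `^ a.
    have -> : (Rad / eps) `^ a = y * y / 2 `^ a.
      rewrite /y -powRD; last by rewrite [t == 0]gt_eqF// implybT.
      have -> : - (a / 2) + - (a / 2) = - a by field.
      have -> : Rad / eps = (t * 2) ^-1 by rewrite /t; field; rewrite !gt_eqF.
      have t2 : 0 <= t * 2 by pos.
      rewrite (powRVN _ t2).
      by rewrite powRM ?(ltW t0)// [2 `^ (- a)]powRN.
    by field; rewrite gt_eqF// powR_gt0.
  rewrite -/D; apply: ler_wpM2r; first exact: powR_ge0.
  apply: ler_wpM2r; first pos.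
  by rewrite lerDl.
move=> s sR.
have [c Hc] := @code_approx R d g h r Rad zeta s0 n L M g0 h0 z0 R0 s sR
  (truncnS_gt _) (truncnS_gt _).
exists c => x /Hc /le_trans; apply.
have q1 : Num.sqrt (2 * d%:R * h ^+ 2) <= ta.
  rewrite -[leRHS](ger0_norm (ltW ta0)) -sqrtr_sqr; apply: ler_wsqrtr.
  rewrite /h exprMn mulrCA; apply: ler_piMr; first exact: sqr_ge0.
  rewrite exprVn ler_pdivrMr ?exprn_gt0// mul1r expr2.
  by apply: (@le_trans _ _ D); [rewrite /D lerDl|rewrite ler_peMr// ltW].
have q2 : Num.sqrt (2 * d%:R * h ^+ 2) ^+ M <= t.
  by rewrite -[leRHS]taM; apply: lerXn2r q1; rewrite nnegrE; pos.
have q3 : Rad * Num.sqrt (2 * d%:R * h ^+ 2) ^+ M <= eps / 2.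
  apply: le_trans (ler_wpM2l (ltW R0) q2) _.
  by rewrite le_eqVlt /t; apply/orP; left; apply/eqP; field; rewrite gt_eqF.
have q4 : N%:R * zeta <= eps / 2.
  have -> : N%:R * zeta = eps / 2 * (N%:R / (N%:R + 1)).
    by rewrite /zeta; field; rewrite gt_eqF.
  by apply: ler_piMr; [pos|rewrite ler_pdivrMr// mul1r lerDl].
by rewrite [leRHS](splitr eps); exact: lerD.
Qed.

(** * Finite kernel sums and elements of the RKHS *)

Section Rkhs.
Context {R : realType} {d : nat}.
Local Notation pt := (d.-tuple R).
Implicit Types (x y z : pt) (g : R) (s t : seq (R * pt)) (A : set pt).

Lemma cauchy_cvg (u : nat -> R) :
  (forall e, 0 < e -> exists N : nat, forall k l, (N <= k)%N -> (N <= l)%N ->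
     `|u k - u l| <= e) -> cvgn u.
Proof.
move=> H; apply/cauchy_cvgP/cauchy_ballP => e e0.
have e2 : 0 < e / 2 by rewrite divr_gt0.
have [N HN] := H _ e2.
exists ([set x | exists2 k, (N <= k)%N & u k = x], [set x | exists2 k, (N <= k)%N & u k = x]).
  by split; exists N => // k /= Nk; exists k.
move=> [x y] /= [[k Nk <-] [l Nl <-]]; rewrite /ball /=.
by apply: le_lt_trans (HN _ _ Nk Nl) _; rewrite ltr_pdivrMr// ltr_pMr// ltr1n.
Qed.

Definition centered A s := {in s, forall a, A a.2}.

Lemma centered_cat A s t : centered A s -> centered A t -> centered A (s ++ t).
Proof. by move=> As At a; rewrite mem_cat => /orP[/As|/At]. Qed.

Lemma centered_scale A (a : R) s : centered A s -> centered A (kscale a s).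
Proof. by move=> As b /mapP[c cs ->] /=; exact: As. Qed.

Lemma pre_evalD g s t x : pre_eval g (s ++ t) x = pre_eval g s x + pre_eval g t x.
Proof. by rewrite /pre_eval big_cat. Qed.

Lemma pre_evalZ g (a : R) s x : pre_eval g (kscale a s) x = a * pre_eval g s x.
Proof. by rewrite !pre_eval_kform kform_scalel. Qed.

Lemma pre_eval_sub g s t x : pre_eval g (pre_sub s t) x = pre_eval g s x - pre_eval g t x.
Proof. by rewrite pre_sub_scale pre_evalD pre_evalZ mulN1r. Qed.

Lemma pre_norm2E g s : pre_norm2 g s = kform (kgauss g) s s.
Proof. by []. Qed.

Lemma pre_norm2_sub g s t : pre_norm2 g (pre_sub s t) =
  kform (kgauss g) s s - 2 * kform (kgauss g) s t + kform (kgauss g) t t.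
Proof.
rewrite /pre_norm2 -/(kform _ _ _) pre_sub_scale.
rewrite !(kform_catl, kform_catr, kform_scalel, kform_scaler).
rewrite (kform_sym t s (@kgaussC R d g)); ring.
Qed.

(* A minimizing sequence of [||h - s||] over [h] centered in [A] is Cauchy by the parallelogram
   identity, and its limit agrees with [s] on [A] by optimality against the kernels [k x], [x] in [A]. *)
Lemma rkhs_restrict A g s : exists2 c, c <= 4 * pre_norm2 g s &
  rkhs_elem A g (pre_eval g s) c.
Proof.
pose S := [set v : R | exists2 h, centered A h & v = pre_norm2 g (pre_sub h s)].
have S0 : has_inf S.
  split; first by exists (pre_norm2 g (pre_sub [::] s)); exists [::].
  by exists 0 => _ [h _ ->]; exact: pre_norm2_ge0.
have Sle h : centered A h -> inf S <= pre_norm2 g (pre_sub h s).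
  by move=> Ah; apply: ge_inf; [exact: S0.2|exists h].
have /choice[h Hh] : forall k : nat, exists h, centered A h /\
    pre_norm2 g (pre_sub h s) <= inf S + k.+1%:R^-1.
  move=> k; have k0 : 0 < k.+1%:R^-1 :> R by rewrite invr_gt0.
  by have [_ [h Ah ->] /ltW H] := inf_adherent k0 S0; exists h.
have sym := kform_sym _ _ (@kgaussC R d g).
have hC k l : pre_norm2 g (pre_sub (h k) (h l)) <= 2 * k.+1%:R^-1 + 2 * l.+1%:R^-1.
  have [Ak Hk] := Hh k; have [Al Hl] := Hh l.
  have := Sle (kscale (1 / 2) (h k ++ h l)).
  move=> /(_ (@centered_scale A _ _ (@centered_cat A _ _ Ak Al))).
  move: Hk Hl; rewrite !pre_norm2_sub.
  rewrite !(kform_catl, kform_catr, kform_scalel, kform_scaler).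
  rewrite (sym (h l) (h k)).
  move: (kform _ (h k) (h k)) (kform _ (h k) (h l)) (kform _ (h l) (h l)).
  move: (kform _ (h k) s) (kform _ (h l) s) (kform _ s s) (k.+1%:R^-1) (l.+1%:R^-1).
  by move=> a b c e f w x y; lra.
have hE k x : A x -> (pre_eval g (h k) x - pre_eval g s x) ^+ 2 <= k.+1%:R^-1.
  move=> Ax; have [Ak Hk] := Hh k.
  set dl := _ - _.
  (* Subtracting [dl] times the kernel at [x] lowers the squared distance to [s] by exactly
     [dl ^+ 2], because [kgauss g x x = 1]. *)
  have := Sle (h k ++ kscale (- dl) [:: (1, x)]).
  have Ax1 : centered A [:: (1, x)] by move=> a; rewrite inE => /eqP ->.
  move=> /(_ (@centered_cat A _ _ Ak (@centered_scale A _ _ Ax1))).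
  move: Hk; rewrite !pre_norm2_sub.
  rewrite !(kform_catl, kform_catr, kform_scalel, kform_scaler).
  rewrite kform11 kgauss_xx (sym [:: (1, x)] (h k)) (sym [:: (1, x)] s) -!pre_eval_kform.
  rewrite (_ : pre_eval g (h k) x = dl + pre_eval g s x); last by rewrite /dl subrK.
  move: (kform _ (h k) (h k)) (kform _ (h k) s) (kform _ s s) (pre_eval g s x).
  by move=> a b c e; move: dl k.+1%:R^-1 => D X H1 H2; rewrite expr2; nra.
have inv0 (e : R) : 0 < e -> exists N : nat, forall k, (N <= k)%N -> k.+1%:R^-1 <= e.
  move=> e0; exists (Num.truncn e^-1) => k Nk.
  rewrite -[leRHS]invrK lef_pV2 ?posrE ?invr_gt0//.
  by apply: ltW; apply: lt_le_trans (truncnS_gt _) _; rewrite ler_nat ltnS.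
have hCauchy (e : R) : 0 < e -> exists N : nat, forall k l, (N <= k)%N -> (N <= l)%N ->
    pre_norm2 g (pre_sub (h k) (h l)) <= e.
  move=> e0; have e4 : 0 < e / 4 by rewrite divr_gt0.
  have [N HN] := inv0 _ e4; exists N => k l Nk Nl; apply: le_trans (hC k l) _.
  have := HN _ Nk; have := HN _ Nl.
  by move: (k.+1%:R^-1) (l.+1%:R^-1) => a b; lra.
have invC : k.+1%:R^-1 @[k --> \oo] --> (0 : R) by exact: cvg_harmonic.
have evC x : A x -> pre_eval g (h k) x @[k --> \oo] --> pre_eval g s x.
  move=> Ax; apply/cvgrPdist_le => e e0.
  have e2 : 0 < e ^+ 2 by rewrite exprn_gt0.
  have [N HN] := inv0 _ e2; exists N => // k /= Nk.
  rewrite -(@ler_pXn2r _ 2)// ?nnegrE ?(ltW e0)// real_normK ?num_real//.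
  by rewrite -sqrrN opprB; apply: le_trans (hE _ _ Ax) (HN _ Nk).
have crossC : cvgn (fun k => kform (kgauss g) (h k) s).
  apply: cauchy_cvg => e e0.
  have w0 : 0 < pre_norm2 g s + 1 by rewrite ltr_wpDl// pre_norm2_ge0.
  have e2 : 0 < e ^+ 2 / (pre_norm2 g s + 1) by rewrite divr_gt0// exprn_gt0.
  have [N HN] := hCauchy _ e2; exists N => k l Nk Nl.
  rewrite -(@ler_pXn2r _ 2)// ?nnegrE ?(ltW e0)// real_normK ?num_real//.
  have -> : kform (kgauss g) (h k) s - kform (kgauss g) (h l) s =
      kform (kgauss g) (pre_sub (h k) (h l)) s.
    by rewrite pre_sub_scale kform_catl kform_scalel mulN1r.
  apply: le_trans (psd_CauchySchwarz _ _ (kgauss_psd g)) _.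
  apply: le_trans (_ : e ^+ 2 / (pre_norm2 g s + 1) * (pre_norm2 g s + 1) <= _).
    apply: ler_pM; [exact: pre_norm2_ge0|exact: pre_norm2_ge0|exact: HN|].
    by rewrite lerDl.
  by rewrite divfK// gt_eqF.
have resC : pre_norm2 g (pre_sub (h k) s) @[k --> \oo] --> inf S.
  apply/cvgrPdist_le => e e0; have [N HN] := inv0 _ e0; exists N => // k /= Nk.
  have [Ak] := Hh k; have := Sle _ Ak; have := HN _ Nk.
  move: (k.+1%:R^-1) (pre_norm2 _ _) (inf S) => x y z H1 H2 H3.
  by rewrite ler_norml; apply/andP; split; lra.
have normC : pre_norm2 g (h k) @[k --> \oo] -->
    inf S + 2 * limn (fun k => kform (kgauss g) (h k) s) - pre_norm2 g s.
  rewrite (_ : (fun k => pre_norm2 g (h k)) = fun k =>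
    pre_norm2 g (pre_sub (h k) s) + 2 * kform (kgauss g) (h k) s - pre_norm2 g s).
    apply: cvgB; last exact: cvg_cst.
    by apply: cvgD => //; apply: cvgM; [exact: cvg_cst|exact: crossC].
  by apply/funext => k; rewrite pre_norm2_sub !pre_norm2E; ring.
eexists; last first.
  by exists h; split; [move=> k; exact: (Hh k).1|exact: hCauchy|exact: evC|exact: normC].
rewrite -(cvg_lim _ normC)//.
have bC : 4 * pre_norm2 g s + 2 * k.+1%:R^-1 @[k --> \oo] --> 4 * pre_norm2 g s + 2 * 0.
  by apply: cvgD; [exact: cvg_cst|apply: cvgM; [exact: cvg_cst|exact: invC]].
have -> : 4 * pre_norm2 g s = limn (fun k => 4 * pre_norm2 g s + 2 * k.+1%:R^-1).
  by rewrite (cvg_lim _ bC)// mulr0 addr0.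
apply: ler_lim.
- by apply/cvg_ex; eexists; exact: normC.
- by apply/cvg_ex; eexists; exact: bC.
near=> k; have [Ak] := Hh k; rewrite pre_norm2_sub => Hk.
(* The empty list competes too, so the squared norm of [h k] is at most twice its product with [s]
   plus [1 / (k + 1)]; with the nonnegative squared norm of [h k - 2 s] this gives the factor 4. *)
have /Sle : centered A [::] by [].
rewrite pre_norm2_sub {1 2}/kform !big_nil => H0.
have := (kgauss_psd g).2 (h k ++ kscale (- 2) s).
rewrite !(kform_catl, kform_catr, kform_scalel, kform_scaler) (sym s (h k)).
rewrite !pre_norm2E; move: H0 Hk.
move: (kform _ (h k) (h k)) (kform _ (h k) s) (kform _ s s) (k.+1%:R^-1) (inf S).
by move=> a b c e i; lra.
Unshelve. all: end_near. Qed.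

(** Evaluation is bounded by the norm since [kgauss g x x = 1], so a norm-Cauchy sequence converges
    uniformly on [A]. This is how SVM solutions are replaced by finite sums. *)
Lemma rkhs_approx A g f c k : rkhs_elem A g f c -> 0 < k ->
  exists h, [/\ centered A h, `|pre_norm2 g h - c| <= k &
    forall x, A x -> `|f x - pre_eval g h x| <= k].
Proof.
move=> [h [Ah hC hf hc]] k0.
have k2 : 0 < k ^+ 2 by rewrite exprn_gt0.
have [N1 HN1] := hC _ k2.
have /cvgrPdist_le/(_ _ k0)[N2 _ HN2] := hc.
pose n := maxn N1 N2; exists (h n); split; first exact: Ah.
  by rewrite distrC; apply: HN2; rewrite /= leq_maxr.
move=> x Ax; have fx := hf _ Ax.
have fx' : `|pre_eval g (h l) x - pre_eval g (h n) x| @[l --> \oo] -->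
    `|f x - pre_eval g (h n) x|.
  by apply: cvg_norm; apply: cvgB; [exact: fx|exact: cvg_cst].
rewrite -(cvg_lim _ fx')//; apply: limr_le.
  by apply/cvg_ex; eexists; exact: fx'.
exists N1 => // l /= Nl.
rewrite -(@ler_pXn2r _ 2)// ?nnegrE ?(ltW k0)// real_normK ?num_real//.
rewrite -pre_eval_sub; apply: le_trans (pre_eval_le _ _ _) _.
by apply: HN1 => //; exact: leq_maxl.
Qed.

End Rkhs.

(** * Expectations and Bernstein's inequality *)

Section BoundedMeasurable.
Context {R : realType} {dT : measure_display} {T : measurableType dT}.
Implicit Types (f g h : T -> R).

(** On this class [Ex] is linear and monotone with no further integrability condition, and the class
    is stable under sums, products and exponentials. *)
Definition bmeas f := measurable_fun setT f /\ exists M : R, forall x, `|f x| <= M.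

Lemma bmeas_bound f (M : R) : measurable_fun setT f -> (forall x, `|f x| <= M) -> bmeas f.
Proof. by move=> mf fM; split => //; exists M. Qed.

Lemma bmeas_cst (a : R) : bmeas (fun=> a).
Proof. by split; [exact: measurable_cst|exists `|a|]. Qed.

Lemma bmeasD f g : bmeas f -> bmeas g -> bmeas (fun x => f x + g x).
Proof.
move=> [mf [M fM]] [mg [N gN]]; split; first exact: measurable_funD.
by exists (M + N) => x; rewrite (le_trans (ler_normD _ _))// lerD.
Qed.

Lemma bmeasM f g : bmeas f -> bmeas g -> bmeas (fun x => f x * g x).
Proof.
move=> [mf [M fM]] [mg [N gN]]; split; first exact: measurable_funM.
by exists (M * N) => x; rewrite normrM ler_pM.
Qed.

Lemma bmeasZ (a : R) f : bmeas f -> bmeas (fun x => a * f x).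
Proof. by apply: bmeasM; exact: bmeas_cst. Qed.

Lemma bmeasN f : bmeas f -> bmeas (fun x => - f x).
Proof.
by move=> /(bmeasZ (-1)); congr bmeas; apply/funext => x; rewrite mulN1r.
Qed.

Lemma bmeasB f g : bmeas f -> bmeas g -> bmeas (fun x => f x - g x).
Proof. by move=> bf /bmeasN; exact: bmeasD. Qed.

Lemma bmeas_norm f : bmeas f -> bmeas (fun x => `|f x|).
Proof.
move=> [mf [M fM]]; split; last by exists M => x; rewrite normr_id.
exact: measurableT_comp.
Qed.

Lemma bmeas_indic (A : set T) : measurable A -> bmeas (\1_A : T -> R).
Proof.
move=> mA; apply: (@bmeas_bound _ 1); first exact: measurable_indic.
by move=> x; rewrite indicE; case: (_ \in _); rewrite ?normr1 ?normr0.
Qed.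

Lemma bmeas_sum (I : Type) (r : seq I) (F : I -> T -> R) :
  (forall i, bmeas (F i)) -> bmeas (fun x => \sum_(i <- r) F i x).
Proof.
move=> bF; elim: r => [|i r IH].
  by under eq_fun do rewrite big_nil; exact: bmeas_cst.
by under eq_fun do rewrite big_cons; exact: bmeasD.
Qed.

Lemma bmeas_prod (I : Type) (r : seq I) (p : pred I) (F : I -> T -> R) :
  (forall i, bmeas (F i)) -> bmeas (fun x => \prod_(i <- r | p i) F i x).
Proof.
move=> bF; elim: r => [|i r IH].
  by under eq_fun do rewrite big_nil; exact: bmeas_cst.
by under eq_fun do rewrite big_cons; case: (p i) => //; exact: bmeasM.
Qed.

Lemma bmeas_expR f : bmeas f -> bmeas (fun x => expR (f x)).
Proof.
move=> [mf [M fM]]; split; first exact: measurableT_comp.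
exists (expR M) => x; rewrite ger0_norm ?expR_ge0// ler_expR.
exact: le_trans (ler_norm _) (fM x).
Qed.

Context (P : probability T R).

Definition Ex f : R := (\int[P]_x f x)%R.

Lemma bmeas_integrable f : bmeas f -> P.-integrable setT (EFin \o f).
Proof.
move=> [mf [M fM]]; apply: measurable_bounded_integrable => //.
  by apply: le_lt_trans (probability_le1 P measurableT) _; rewrite ltry.
by exists M; split; [rewrite num_real|move=> t Mt x _; exact: le_trans (fM x) (ltW Mt)].
Qed.

Lemma Ex_fin f : bmeas f -> (\int[P]_x (f x)%:E = (Ex f)%:E)%E.
Proof.
move=> /bmeas_integrable/integral_fune_fin_num H.
by rewrite /Ex /Rintegral fineK// H.
Qed.

Lemma ExD f g : bmeas f -> bmeas g -> Ex (fun x => f x + g x) = Ex f + Ex g.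
Proof. by move=> bf bg; apply: RintegralD => //; exact: bmeas_integrable. Qed.

Lemma ExZ (a : R) f : bmeas f -> Ex (fun x => a * f x) = a * Ex f.
Proof. by move=> bf; apply: RintegralZl => //; exact: bmeas_integrable. Qed.

Lemma ExB f g : bmeas f -> bmeas g -> Ex (fun x => f x - g x) = Ex f - Ex g.
Proof. by move=> bf bg; apply: RintegralB => //; exact: bmeas_integrable. Qed.

Lemma Ex_le f g : bmeas f -> bmeas g -> (forall x, f x <= g x) -> Ex f <= Ex g.
Proof. by move=> bf bg fg; apply: le_Rintegral => //; exact: bmeas_integrable. Qed.

Lemma Ex_cst (a : R) : Ex (fun=> a) = a.
Proof.
have E : fine (P [set: T]) = 1 :> R by rewrite probability_setT.
by rewrite /Ex Rintegral_cst// -[RHS]mulr1 -E.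
Qed.

Lemma Ex_ge0 f : (forall x, 0 <= f x) -> 0 <= Ex f.
Proof. by move=> f0; apply: Rintegral_ge0. Qed.

Lemma Ex_norm f : bmeas f -> `|Ex f| <= Ex (fun x => `|f x|).
Proof. by move=> bf; apply: le_normr_Rintegral => //; exact: bmeas_integrable. Qed.

Lemma Ex_indic (A : set T) : measurable A -> Ex (\1_A) = fine (P A).
Proof. by move=> mA; rewrite /Ex /Rintegral integral_indic// setIT. Qed.

Lemma Ex_sum (I : Type) (r : seq I) (F : I -> T -> R) :
  (forall i, bmeas (F i)) -> Ex (fun x => \sum_(i <- r) F i x) = \sum_(i <- r) Ex (F i).
Proof.
move=> bF; elim: r => [|i r IH].
  by rewrite big_nil; under eq_fun do rewrite big_nil; exact: Ex_cst.
rewrite big_cons; under eq_fun do rewrite big_cons.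
by rewrite ExD ?IH//; exact: bmeas_sum.
Qed.

Lemma Ex_bound f (M : R) : bmeas f -> (forall x, `|f x| <= M) -> `|Ex f| <= M.
Proof.
move=> bf fM; apply: le_trans (Ex_norm bf) _.
by rewrite -[leRHS]Ex_cst; apply: Ex_le => //; [exact: bmeas_norm|exact: bmeas_cst].
Qed.

End BoundedMeasurable.

Section Extension.
Context {R : realType} {dT : measure_display} {T : measurableType dT}.
Implicit Types (f g h : T -> R) (I : (T -> R) -> R).

(** Continuity is asked in the sup norm, the topology in which combinations of indicators are
    dense. *)
Definition bounded_linear I := [/\
  forall f g, bmeas f -> bmeas g -> I (fun x => f x + g x) = I f + I g,
  forall (a : R) f, bmeas f -> I (fun x => a * f x) = a * I f &
  exists C : R, forall f (M : R), bmeas f -> (forall x, `|f x| <= M) -> `|I f| <= C * M].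

Lemma sum_ltn_minn N m : (\sum_(k < N) (k < m) = minn N m)%N.
Proof.
elim: N => [|N IH]; first by rewrite big_ord0 min0n.
rewrite big_ord_recr /= IH; case: ltnP => H.
  by rewrite addn1; apply/esym/minn_idPl.
by rewrite addn0; apply/esym/minn_idPr/leqW.
Qed.

(** For [g] with values in [[0, 1]] this is the integer part of [N g] divided by [N], written as a
    combination of indicators of level sets. *)
Definition layer_fun N g x : R :=
  \sum_(k < N) N%:R^-1 * (\1_[set x | k.+1%:R <= N%:R * g x] : T -> R) x.

Lemma layer_fun_approx N g x : (0 < N)%N -> 0 <= g x <= 1 ->
  `|g x - layer_fun N g x| <= N%:R^-1.
Proof.
move=> N0 /andP[g0 g1]; rewrite /layer_fun -big_distrr /=.
have N0' : 0 < N%:R :> R by rewrite ltr0n.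
set w := N%:R * g x; have w0 : 0 <= w by rewrite mulr_ge0.
have -> : \sum_(k < N) (\1_[set x0 | k.+1%:R <= N%:R * g x0] : T -> R) x =
    (Num.truncn w)%:R.
  rewrite -[in RHS](@minn_idPr N (Num.truncn w) _).
    rewrite -sum_ltn_minn natr_sum; apply: eq_bigr => k _.
    rewrite indicE; congr ((nat_of_bool _)%:R); rewrite truncn_ge_nat//.
    by apply/idP/idP; rewrite inE.
  rewrite -(ler_nat R); apply: le_trans (_ : w <= _); first by rewrite truncn_le.
  by rewrite /w ler_piMr.
have -> : g x = N%:R^-1 * w by rewrite /w mulKf// gt_eqF.
rewrite -mulrBr normrM gtr0_norm ?invr_gt0// ler_piMr ?invr_ge0 ?ltW//.
have /andP[a b] := truncn_itv w0; rewrite -natr1 in b.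
by rewrite ltr_norml; apply/andP; split; lra.
Qed.

Lemma bmeas_layer N g : measurable_fun setT g -> bmeas (layer_fun N g).
Proof.
move=> mg; apply: bmeas_sum => k; apply: bmeasZ; apply: bmeas_indic.
have mNg : measurable_fun setT (fun x => N%:R * g x) by exact: measurable_funM.
rewrite (_ : [set x | _] = (fun x => N%:R * g x) @^-1` `[k.+1%:R, +oo[%classic).
  by rewrite -[X in measurable X]setTI; exact: mNg.
by apply/seteqP; split=> x /=; rewrite in_itv /= andbT.
Qed.

Lemma bounded_linear_sum I (J : Type) (r : seq J) (F : J -> T -> R) :
  bounded_linear I -> (forall i, bmeas (F i)) ->
  I (fun x => \sum_(i <- r) F i x) = \sum_(i <- r) I (F i).
Proof.
move=> [ID IZ _] bF; elim: r => [|i r IH].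
  rewrite big_nil; under eq_fun do rewrite big_nil.
  by have := IZ 0 _ (bmeas_cst 0); rewrite /= !mul0r.
rewrite big_cons; under eq_fun do rewrite big_cons.
by rewrite ID ?IH//; exact: bmeas_sum.
Qed.

(** An affine rescaling brings [f] into [[0, 1]], where layer functions approximate it uniformly
    within [1 / N]. This stands in for a monotone class argument, both for independence and for
    integrating out the label. *)
Lemma bounded_linear_ext I1 I2 : bounded_linear I1 -> bounded_linear I2 ->
  (forall A, measurable A -> I1 (\1_A) = I2 (\1_A)) ->
  forall f, bmeas f -> I1 f = I2 f.
Proof.
move=> L1 L2 E f bf; have [mf [M0 fM0]] := bf.
pose M := `|M0| + 1.
have M0' : 0 < M by rewrite ltr_wpDl.
have fM x : `|f x| <= M.
  by rewrite (le_trans (fM0 x))// (le_trans (ler_norm _))// lerDl.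
pose g x := (2 * M)^-1 * (f x + M).
have bg : bmeas g by apply: bmeasZ; apply: bmeasD => //; exact: bmeas_cst.
have g01 x : 0 <= g x <= 1.
  have := fM x; rewrite ler_norml => /andP[a b].
  rewrite /g mulr_ge0/= ?invr_ge0; [|lra|lra].
  by rewrite mulrC ler_pdivrMr ?mul1r; lra.
have gE : I1 g = I2 g.
  have [ID1 IZ1 [C1 HC1]] := L1; have [ID2 IZ2 [C2 HC2]] := L2.
  have El N : I1 (layer_fun N g) = I2 (layer_fun N g).
    have mA (k : 'I_N) : measurable [set x | k.+1%:R <= N%:R * g x].
      have mNg : measurable_fun setT (fun x => N%:R * g x) by apply: measurable_funM => //; exact: bg.1.
      rewrite (_ : [set x | _] = (fun x => N%:R * g x) @^-1` `[k.+1%:R, +oo[%classic).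
        by rewrite -[X in measurable X]setTI; exact: mNg.
      by apply/seteqP; split=> x /=; rewrite in_itv /= andbT.
    rewrite !bounded_linear_sum//; last 2 first.
      by move=> k; apply: bmeasZ; apply: bmeas_indic.
      by move=> k; apply: bmeasZ; apply: bmeas_indic.
    apply: eq_bigr => k _; rewrite IZ1 ?IZ2 ?E//; exact: bmeas_indic.
  have bd N : (0 < N)%N -> `|I1 g - I2 g| <= (`|C1| + `|C2|) * N%:R^-1.
    move=> N0.
    have bl := @bmeas_layer N g bg.1.
    have bgl := bmeasB bg bl.
    have e1 : I1 g = I1 (fun x => g x - layer_fun N g x) + I1 (layer_fun N g).
      by rewrite -ID1//; congr I1; apply/funext => x; rewrite subrK.
    have e2 : I2 g = I2 (fun x => g x - layer_fun N g x) + I2 (layer_fun N g).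
      by rewrite -ID2//; congr I2; apply/funext => x; rewrite subrK.
    rewrite e1 e2 El opprD addrACA subrr addr0.
    have Hl x : `|g x - layer_fun N g x| <= N%:R^-1 by exact: layer_fun_approx.
    apply: le_trans (ler_normB _ _) _; rewrite mulrDl; apply: lerD.
      apply: le_trans (HC1 _ _ bgl Hl) _.
      by apply: ler_wpM2r; rewrite ?invr_ge0// ler_norm.
    apply: le_trans (HC2 _ _ bgl Hl) _.
    by apply: ler_wpM2r; rewrite ?invr_ge0// ler_norm.
  apply/eqP; rewrite -subr_eq0 -normr_le0; apply/ler_addgt0Pr => e e0; rewrite add0r.
  pose N := (Num.truncn ((`|C1| + `|C2|) / e)).+1.
  apply: le_trans (bd N _) _ => //.
  rewrite ler_pdivrMr ?ltr0n// mulrC -ler_pdivrMr// ltW//; exact: truncnS_gt.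
have fE I : bounded_linear I -> I f = 2 * M * I g - M * I (\1_setT).
  move=> [ID IZ _]; rewrite -mulNr.
  have b1 : bmeas (\1_[set: T] : T -> R) by exact: bmeas_indic.
  rewrite -IZ// -IZ// -ID; [|exact: bmeasZ|exact: bmeasZ].
  congr I; apply/funext => x; rewrite /g indicE in_setT mulr1.
  by rewrite mulrA divff ?mul1r ?addrK// gt_eqF// mulr_gt0.
by rewrite !fE// gE E.
Qed.

End Extension.

(** Squaring [1 - u / 2 <= expR (- (u / 2))] bounds [expR u] by the inverse of [(1 - u / 2) ^+ 2];
    what remains is polynomial, with excess [u ^+ 2 * ((1 - u) * (5 / 4 - u / 2))]. *)
Lemma expR_quadratic (R : realType) (u : R) : u <= 1 -> expR u <= 1 + u + 2 * u ^+ 2.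
Proof.
move=> u1; have h0 : 0 < 1 - u / 2 by lra.
have E : expR (- (u / 2)) ^+ 2 * expR u = 1.
  by rewrite -expRM_natl -expRD -[RHS]expR0; congr expR; field.
have H : 1 - u / 2 <= expR (- (u / 2)) by apply: le_trans (expR_ge1Dx _); lra.
have H2 : (1 - u / 2) ^+ 2 <= expR (- (u / 2)) ^+ 2.
  by rewrite lerXn2r ?nnegrE ?expR_ge0// ltW.
have H3 : (1 - u / 2) ^+ 2 * expR u <= 1.
  by rewrite -[leRHS]E ler_wpM2r// expR_ge0.
have H4 : 1 <= (1 - u / 2) ^+ 2 * (1 + u + 2 * u ^+ 2).
  have -> : (1 - u / 2) ^+ 2 * (1 + u + 2 * u ^+ 2) =
     1 + u ^+ 2 * ((1 - u) * (5 / 4 - u / 2)) by field.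
  by rewrite lerDl mulr_ge0 ?sqr_ge0// mulr_ge0; lra.
have := le_trans H3 H4; rewrite ler_pM2l// exprn_gt0//.
Qed.

Lemma union_bound (R : realType) (dO : measure_display) (Om : measurableType dO)
    (Q : probability Om R) (I : finType) (F : I -> set Om) :
  (forall i, measurable (F i)) ->
  (Q (~` \bigcap_(i in [set: I]) F i) <= (\sum_i fine (Q (~` F i)))%:E)%E.
Proof.
move=> mF; have mC i : measurable (~` F i) by exact: measurableC.
have mI : measurable (~` \bigcap_(i in [set: I]) F i).
  by apply: measurableC; exact: fin_bigcap_measurable.
rewrite -[leLHS]fineK; last exact: fin_num_measure.
rewrite lee_fin -Ex_indic//.
have bI i : bmeas (\1_(~` F i) : Om -> R) by exact: bmeas_indic.
under eq_bigr do rewrite -Ex_indic//.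
rewrite -Ex_sum//; apply: Ex_le; [exact: bmeas_indic|exact: bmeas_sum|].
move=> w; rewrite indicE; case: (boolP (w \in _)) => [|_]; last first.
  by apply: sumr_ge0 => i _; rewrite indicE.
rewrite inE setC_bigcap => -[i _ Fi].
by rewrite (bigD1 i)//= indicE mem_set// lerDl sumr_ge0// => j _; rewrite indicE.
Qed.

Section Independence.
Context {R : realType} {dT dO : measure_display}.
Context {T : measurableType dT} {Om : measurableType dO}.
Context (P : probability T R) (Q : probability Om R) (n : nat) (Z : 'I_n -> Om -> T).
Context (mZ : forall i, measurable_fun setT (Z i)).
Context (ZP : forall i (B : set T), measurable B -> Q (Z i @^-1` B) = P B).
Context (Zind : forall B : 'I_n -> set T, (forall i, measurable (B i)) ->
  Q (\bigcap_(i in [set: 'I_n]) (Z i @^-1` B i)) =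
  (\prod_(i < n) Q (Z i @^-1` B i))%E).

Lemma bmeas_comp (f : T -> R) i : bmeas f -> bmeas (fun w => f (Z i w)).
Proof.
move=> [mf [M fM]]; split; last by exists M => w.
exact: measurableT_comp.
Qed.

Lemma fine_prod (I : Type) (r : seq I) (F : I -> \bar R) :
  (forall i, F i \is a fin_num) -> fine (\prod_(i <- r) F i)%E = \prod_(i <- r) fine (F i).
Proof.
move=> Ff; have [//] : fine (\prod_(i <- r) F i)%E = \prod_(i <- r) fine (F i) /\
   (\prod_(i <- r) F i)%E \is a fin_num.
elim: r => [|i r [IH1 IH2]]; first by rewrite !big_nil.
by rewrite !big_cons fineM// IH1; split => //; exact: fin_numM.
Qed.

Lemma prod_indep_indic (B : 'I_n -> set T) : (forall i, measurable (B i)) ->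
  Ex Q (fun w => \prod_i (\1_(B i) : T -> R) (Z i w)) = \prod_i Ex P (\1_(B i)).
Proof.
move=> mB; transitivity (Ex Q (\1_(\bigcap_(i in [set: 'I_n]) (Z i @^-1` B i)))).
  congr (Ex Q); apply/funext => w; rewrite indicE.
  have [/set_mem H|/negP H] := boolP (w \in _).
    by rewrite big1// => i _; rewrite indicE mem_set//; exact: H.
  have /existsNP[i Bi] : ~ forall i, B i (Z i w).
    by move=> H'; apply: H; rewrite inE => i _; exact: H'.
  by rewrite (bigD1 i)//= indicE memNset// mul0r.
rewrite Ex_indic; last first.
  by apply: fin_bigcap_measurable => // i _; rewrite -[X in measurable X]setTI; exact: mZ.
rewrite Zind// fine_prod.
  by apply: eq_bigr => i _; rewrite ZP// Ex_indic.
by move=> i; rewrite ZP//; exact: fin_num_measure.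
Qed.

(** Induction on [k], the factors of index at least [k] being indicators: with the other factors
    frozen, both sides are bounded linear functionals of a single factor and agree on indicators. *)
Lemma prod_indep (f : 'I_n -> T -> R) : (forall i, bmeas (f i)) ->
  Ex Q (fun w => \prod_i f i (Z i w)) = \prod_i Ex P (f i).
Proof.
move=> bf.
suff H (k : nat) : forall f : 'I_n -> T -> R, (forall i, bmeas (f i)) ->
    (forall i : 'I_n, (k <= i)%N -> exists2 B, measurable B & f i = \1_B) ->
    Ex Q (fun w => \prod_i f i (Z i w)) = \prod_i Ex P (f i).
  by apply: (H n) => // i; rewrite leqNgt ltn_ord.
elim: k => {f bf} [f bf fB|k IH f bf fB].
  have /choice[B HB] : forall i, exists B, measurable B /\ f i = \1_B.
    by move=> i; have [B mB fE] := fB i (leq0n _); exists B.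
  under eq_fun do under eq_bigr do rewrite (HB _).2.
  rewrite prod_indep_indic; last by move=> i; exact: (HB i).1.
  by apply: eq_bigr => i _; rewrite (HB i).2.
have [kn|nk] := ltnP k n; last first.
  by apply: IH => // i ki; have := leq_trans nk ki; rewrite leqNgt ltn_ord.
pose k0 := Ordinal kn.
pose up (h : T -> R) := fun i => if i == k0 then h else f i.
have upE h (F : ('I_n -> (T -> R) -> R)) : \prod_i F i (up h i) =
    F k0 h * \prod_(i | i != k0) F i (f i).
  rewrite (bigD1 k0)//= /up eqxx; congr (_ * _).
  by apply: eq_bigr => i /negbTE ->.
have bup h : bmeas h -> forall i, bmeas (up h i).
  by move=> bh i; rewrite /up; case: ifP.
have fE : f = up (f k0).
  by apply/funext => i; rewrite /up; case: eqP => [->|].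
have bG : bmeas (fun w => \prod_(i | i != k0) f i (Z i w)).
  by apply: bmeas_prod => i; exact: bmeas_comp.
rewrite fE.
apply: (@bounded_linear_ext _ _ _ (fun h => Ex Q (fun w => \prod_i up h i (Z i w)))
  (fun h => \prod_i Ex P (up h i))) => //.
- have E h : (fun w => \prod_i up h i (Z i w)) =
      (fun w => h (Z k0 w) * \prod_(i | i != k0) f i (Z i w)).
    by apply/funext => w; rewrite (upE h (fun i g => g (Z i w))).
  split.
  + move=> g h bg bh; rewrite !E -ExD; last 2 first.
      by apply: bmeasM => //; exact: bmeas_comp.
      by apply: bmeasM => //; exact: bmeas_comp.
    by congr (Ex Q); apply/funext => w; rewrite mulrDl.
  + move=> a g bg; rewrite !E -ExZ; last by apply: bmeasM => //; exact: bmeas_comp.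
    by congr (Ex Q); apply/funext => w; rewrite mulrA.
  + have [_ [M HM]] := bG; exists M => g N bg gN; rewrite E.
    apply: Ex_bound; first by apply: bmeasM => //; exact: bmeas_comp.
    by move=> w; rewrite normrM mulrC ler_pM.
- have E h : \prod_i Ex P (up h i) = Ex P h * \prod_(i | i != k0) Ex P (f i).
    exact: (upE h (fun i g => Ex P g)).
  split.
  + by move=> g h bg bh; rewrite !E ExD// mulrDl.
  + by move=> a g bg; rewrite !E ExZ// mulrA.
  + exists `|\prod_(i | i != k0) Ex P (f i)| => g N bg gN; rewrite E.
    by rewrite normrM mulrC ler_wpM2l//; exact: Ex_bound.
- move=> A mA; apply: IH.
    by apply: bup; exact: bmeas_indic.
  move=> i ki; rewrite /up; case: eqP => [_|/eqP ik]; first by exists A.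
  by apply: fB; rewrite ltn_neqAle ki andbT eq_sym; apply: contra ik => /eqP ik; apply/eqP/val_inj.
Qed.

(** By independence the left side is an [n]-th power. [expR_quadratic] at [- (s * f x)] and
    [1 + x <= expR x] bound each factor by [expR (2 * s ^+ 2 * v)], the means cancelling; the raw
    second moment takes the place of the variance. *)
Lemma mgf_bound (f : T -> R) (b v s : R) : bmeas f -> (forall x, `|f x| <= b) ->
  Ex P (fun x => f x ^+ 2) <= v -> 0 <= s -> s * b <= 1 ->
  Ex Q (fun w => expR (s * \sum_i (Ex P f - f (Z i w)))) <= expR (2 * n%:R * s ^+ 2 * v).
Proof.
move=> bf fb fv s0 sb.
have bg : bmeas (fun x => expR (s * (Ex P f - f x))).
  by apply: bmeas_expR; apply: bmeasZ; apply: bmeasB => //; exact: bmeas_cst.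
have -> : (fun w => expR (s * \sum_i (Ex P f - f (Z i w)))) =
    (fun w => \prod_i (fun x => expR (s * (Ex P f - f x))) (Z i w)).
  by apply/funext => w; rewrite big_distrr /= expR_sum.
rewrite (prod_indep (fun i => bg)) prodr_const card_ord.
have -> : 2 * n%:R * s ^+ 2 * v = n%:R * (2 * s ^+ 2 * v) by ring.
rewrite expRM_natl; apply: lerXn2r; rewrite ?nnegrE ?expR_ge0//.
  by apply: Ex_ge0 => x; exact: expR_ge0.
have b2 : bmeas (fun x => f x ^+ 2) by under eq_fun do rewrite expr2; exact: bmeasM.
have bs : bmeas (fun x => 1 + - s * f x) by apply: bmeasD; [exact: bmeas_cst|exact: bmeasZ].
apply: (@le_trans _ _ (Ex P (fun x => expR (s * Ex P f) *
   ((1 + - s * f x) + 2 * s ^+ 2 * f x ^+ 2)))).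
  apply: Ex_le => //.
    by apply: bmeasZ; apply: bmeasD => //; exact: bmeasZ.
  move=> x; rewrite mulrBr expRD ler_wpM2l ?expR_ge0//.
  have := @expR_quadratic R (- (s * f x)).
  rewrite sqrrN exprMn mulrA mulNr; apply.
  apply: le_trans (ler_norm _) _; rewrite normrN normrM ger0_norm//.
  by apply: le_trans sb; rewrite ler_wpM2l.
rewrite ExZ; last by apply: bmeasD => //; exact: bmeasZ.
rewrite ExD//; last exact: bmeasZ.
rewrite ExD; [|exact: bmeas_cst|exact: bmeasZ].
rewrite Ex_cst !ExZ//.
apply: (@le_trans _ _ (expR (s * Ex P f) * expR (- s * Ex P f + 2 * s ^+ 2 * v))).
  rewrite ler_wpM2l ?expR_ge0//; apply: le_trans (expR_ge1Dx _).
  by rewrite -addrA lerD2l lerD2l ler_wpM2l// mulr_ge0// sqr_ge0.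
by rewrite -expRD mulNr addNKr.
Qed.

Definition dev (b v t : R) : R := 3 * (Num.sqrt (v * t / n%:R) + b * t / n%:R).

Definition emp (f : T -> R) (w : Om) : R := n%:R^-1 * \sum_i f (Z i w).

Lemma bernstein (f : T -> R) (b v t : R) : (0 < n)%N -> 0 < b -> 0 <= v -> 0 <= t ->
  bmeas f -> (forall x, `|f x| <= b) -> Ex P (fun x => f x ^+ 2) <= v ->
  exists2 E, measurable E & (Q (~` E) <= (expR (- t))%:E)%E /\
    forall w, E w -> Ex P f - emp f w <= dev b v t.
Proof.
move=> n0 b0 v0 t0 bf fb fv.
have n0' : 0 < n%:R :> R by rewrite ltr0n.
have [s [s0 sb st]] : exists s : R, [/\ 0 <= s, s * b <= 1 &
    2 * n%:R * s ^+ 2 * v + t <= s * (n%:R * dev b v t)].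
  have devE : n%:R * dev b v t = 3 * (n%:R * Num.sqrt (v * t / n%:R) + b * t).
    by rewrite /dev; field; rewrite gt_eqF.
  (* The balancing choice is [s = sqrt (t / (n v))]; when it would violate [s * b <= 1], take
     [s = b^-1]. In both cases the left side is at most [3 * t], whence the 3 in [dev]. *)
  have [H|H] := leP (n%:R * v) (t * b ^+ 2).
    exists b^-1; split; [by rewrite invr_ge0 ltW|by rewrite mulVf// gt_eqF|].
    have H1 : n%:R * b^-1 ^+ 2 * v <= t.
      by rewrite exprVn mulrAC ler_pdivrMr// exprn_gt0.
    have H2 : 0 <= b^-1 * (n%:R * Num.sqrt (v * t / n%:R)) by pos.
    have -> : b^-1 * (n%:R * dev b v t) =
        3 * (b^-1 * (n%:R * Num.sqrt (v * t / n%:R))) + 3 * t.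
      by rewrite devE; field; rewrite gt_eqF.
    have -> : 2 * n%:R * b^-1 ^+ 2 * v = 2 * (n%:R * b^-1 ^+ 2 * v) by ring.
    by move: H1 H2; move: (_ * v) (b^-1 * _) => X Y; lra.
  have v0' : 0 < v.
    rewrite lt_neqAle v0 andbT eq_sym; apply/eqP => v00.
    by move: H; rewrite v00 mulr0 ltNge mulr_ge0// sqr_ge0.
  exists (Num.sqrt (t / (n%:R * v))); split; first exact: sqrtr_ge0.
    rewrite -[leRHS]sqrtr1 -[b in leLHS](ger0_norm (ltW b0)) -sqrtr_sqr -sqrtrM; last first.
      by rewrite divr_ge0// ltW// mulr_gt0.
    by apply: ler_wsqrtr; rewrite mulrAC ler_pdivrMr ?mulr_gt0// mul1r ltW.
  have E1 : Num.sqrt (t / (n%:R * v)) ^+ 2 = t / (n%:R * v).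
    by rewrite sqr_sqrtr// divr_ge0// ltW// mulr_gt0.
  have E2 : Num.sqrt (t / (n%:R * v)) * Num.sqrt (v * t / n%:R) = t / n%:R.
    rewrite -sqrtrM ?divr_ge0//; last by rewrite ltW// mulr_gt0.
    have -> : t / (n%:R * v) * (v * t / n%:R) = (t / n%:R) ^+ 2.
      by field; rewrite !gt_eqF.
    by rewrite sqrtr_sqr ger0_norm// divr_ge0// ltW.
  have E3 (X Y : R) : X * (3 * (n%:R * Y + b * t)) = 3 * (n%:R * (X * Y)) + 3 * (X * (b * t)).
    by ring.
  rewrite E1 devE E3 E2.
  have -> : 2 * n%:R * (t / (n%:R * v)) * v = 2 * t by field; rewrite !gt_eqF.
  have -> : n%:R * (t / n%:R) = t by field; rewrite gt_eqF.
  have : 0 <= Num.sqrt (t / (n%:R * v)) * (b * t) by pos.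
  by lra.
pose S w := \sum_i (Ex P f - f (Z i w)).
have SE w : S w = n%:R * (Ex P f - emp f w).
  rewrite /S /emp sumrB sumr_const card_ord mulrBr mulr_natl mulrA divff ?mul1r//.
  by rewrite gt_eqF.
have bS : bmeas S.
  by apply: bmeas_sum => i; apply: bmeasB; [exact: bmeas_cst|exact: bmeas_comp].
pose E := [set w | S w <= n%:R * dev b v t].
have mE : measurable E.
  rewrite (_ : E = S @^-1` `]-oo, n%:R * dev b v t]%classic).
    by rewrite -[X in measurable X]setTI; exact: bS.1.
  by apply/seteqP; split=> x /=; rewrite in_itv.
exists E => //; split; last by move=> w; rewrite /E /= SE ler_pM2l.
have mEc : measurable (~` E) by exact: measurableC.
have QE : (fine (Q (~` E)))%:E = Q (~` E) by rewrite fineK//; exact: fin_num_measure.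
rewrite -QE lee_fin -Ex_indic//.
have bI : bmeas (\1_(~` E) : Om -> R) by exact: bmeas_indic.
have bsS : bmeas (fun w => expR (s * S w)) by apply: bmeas_expR; exact: bmeasZ.
rewrite -(ler_pM2l (expR_gt0 (s * (n%:R * dev b v t)))).
rewrite -ExZ//; apply: (@le_trans _ _ (Ex Q (fun w => expR (s * S w)))).
  apply: Ex_le => //; first exact: bmeasZ.
  move=> w; rewrite indicE; case: (boolP (w \in ~` E)) => [|_].
    rewrite inE /E /= mulr1 ler_expR => /negP; rewrite -ltNge => /ltW H.
    exact: ler_wpM2l.
  by rewrite mulr0 expR_ge0.
apply: le_trans (mgf_bound bf fb fv s0 sb) _.
by rewrite -expRD ler_expR; lra.
Qed.

(** The second moment condition stands inside the conclusion: members that violate it get the sure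
    event. Chaining applies this to all pairs of net points, although only close pairs matter. *)
Lemma bernstein_family (I : finType) (f : I -> T -> R) (b v t : R) :
  (0 < n)%N -> 0 < b -> 0 <= v -> 0 <= t ->
  (forall i, bmeas (f i)) -> (forall i x, `|f i x| <= b) ->
  exists2 E, measurable E & (Q (~` E) <= (#|I|%:R * expR (- t))%:E)%E /\
    forall w, E w -> forall i, Ex P (fun x => f i x ^+ 2) <= v ->
      Ex P (f i) - emp (f i) w <= dev b v t.
Proof.
move=> n0 b0 v0 t0 bf fb.
have /choice[F HF] : forall i, exists E, [/\ measurable E,
    (Q (~` E) <= (expR (- t))%:E)%E & forall w, E w ->
     Ex P (fun x => f i x ^+ 2) <= v -> Ex P (f i) - emp (f i) w <= dev b v t].
  move=> i; have [H|H] := leP (Ex P (fun x => f i x ^+ 2)) v.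
    have [E mE [QE HE]] := bernstein n0 b0 v0 t0 (bf i) (fb i) H.
    by exists E; split => // w /HE.
  exists setT; split => //.
  by rewrite setCT measure0 lee_fin expR_ge0.
exists (\bigcap_(i in [set: I]) F i).
  by apply: fin_bigcap_measurable => // i _; have [] := HF i.
split; last by move=> w Fw i; have [_ _] := HF i; apply; exact: Fw.
apply: le_trans (union_bound Q _) _; first by move=> i; have [] := HF i.
rewrite lee_fin mulr_natl -sumr_const; apply: ler_sum => i _.
have [mF QF _] := HF i.
by rewrite -lee_fin fineK//; apply: fin_num_measure; exact: measurableC.
Qed.
End Independence.

(** * Approximation by Gaussian grid sums *)

(** This is [v / a <= expR (v / a)], raised to the power [a]. *)
Lemma expRN_le_powR (R : realType) (a v : R) : 0 < a -> 0 < v ->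
  expR (- v) <= a `^ a * v `^ (- a).
Proof.
move=> a0 v0.
have H : (v / a) `^ a <= expR v.
  have -> : expR v = (expR (v / a)) `^ a by rewrite -expRM divfK// gt_eqF.
  apply: ge0_ler_powR; rewrite ?nnegrE ?expR_ge0 ?(ltW a0)//; first by pos.
  by apply: le_trans (expR_ge1Dx _); rewrite lerDr.
rewrite powRM ?(ltW v0) ?invr_ge0 ?(ltW a0)// powRVN ?(ltW a0)// !powRN in H.
rewrite expRN powRN -[leRHS]invrK invfM invrK.
rewrite lef_pV2 ?posrE ?expR_gt0//; last by pos.
by rewrite mulrC.
Qed.

Lemma prod_ge_1B (R : realType) (I : Type) (r : seq I) (y : I -> R) (e : R) :
  0 <= e -> (forall i, 1 - e <= y i <= 1) -> (forall i, 0 <= y i) ->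
  1 - (size r)%:R * e <= \prod_(i <- r) y i <= 1.
Proof.
move=> e0 y1 y0; elim: r => [|i r /andP[IH1 IH2]].
  by rewrite big_nil mul0r subr0 lexx.
rewrite big_cons /= -natr1 mulrDl mul1r; have /andP[a b] := y1 i.
have p0 : 0 <= \prod_(j <- r) y j by rewrite prodr_ge0.
apply/andP; split; last by rewrite mulr_ile1.
have : y i * (1 - \prod_(j <- r) y j) <= 1 * (1 - \prod_(j <- r) y j).
  by apply: ler_wpM2r; rewrite ?subr_ge0.
by rewrite mul1r mulrBr mulr1; lra.
Qed.

Section GridSum.
Context {R : realType}.
Implicit Types (g x : R) (m : nat).

Definition gbump g (t : R) : R := expR (- (g ^-2 * t ^+ 2)).
(** For [k <= 4 * m] the nodes fill [[-2, 2]] with mesh [1 / m], so a point of [[-1, 1]] has nodes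
    up to distance 1 on both sides. *)
Definition gnode m k : R := -2 + k%:R / m%:R.
Definition gsum g m x : R := \sum_(0 <= k < (4 * m).+1) gbump g (x - gnode m k).
(** Two one-sided sums, each starting at distance 0, hence an upper bound of [gsum] on [[-2, 2]]; it
    is a normalizer independent of [x]. *)
Definition gtop g m : R := 2 * \sum_(0 <= i < (4 * m).+1) gbump g (i%:R / m%:R).

Lemma gbump_anti g (s t : R) : 0 <= s -> s <= `|t| -> gbump g t <= gbump g s.
Proof.
move=> s0 st; rewrite ler_expR lerN2 ler_wpM2l ?invr_ge0 ?sqr_ge0//.
by rewrite -[leRHS]real_normK ?num_real// lerXn2r ?nnegrE.
Qed.

Lemma gbump_anti_norm g (s t : R) : `|s| <= `|t| -> gbump g t <= gbump g s.
Proof.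
move=> st; rewrite ler_expR lerN2 ler_wpM2l ?invr_ge0 ?sqr_ge0//.
by rewrite -[leLHS]real_normK ?num_real// -[leRHS]real_normK ?num_real// lerXn2r ?nnegrE.
Qed.

Lemma gbump_gt0 g (t : R) : 0 < gbump g t. Proof. exact: expR_gt0. Qed.
Lemma gbump_ge0 g (t : R) : 0 <= gbump g t. Proof. exact: expR_ge0. Qed.

Lemma gsum_ge0 g m x : 0 <= gsum g m x.
Proof. by apply: sumr_ge0 => k _; exact: gbump_ge0. Qed.

Lemma gnode_pos m x : (0 < m)%N -> -2 <= x <= 2 ->
  exists2 k0 : nat, (k0 <= 4 * m)%N & k0%:R / m%:R <= x + 2 < k0.+1%:R / m%:R.
Proof.
move=> m0 /andP[x1 x2]; have m0' : 0 < m%:R :> R by rewrite ltr0n.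
have w0 : 0 <= (x + 2) * m%:R by rewrite mulr_ge0//; lra.
exists (Num.truncn ((x + 2) * m%:R)).
  rewrite -(ler_nat R); apply: le_trans (_ : (x + 2) * m%:R <= _); first by rewrite truncn_le.
  by rewrite natrM ler_pM2r//; lra.
by rewrite ler_pdivrMr// ltr_pdivlMr// truncn_itv.
Qed.

Lemma sum_nat_sub_le (F : nat -> R) a b c e : (forall i, 0 <= F i) -> (c <= a)%N -> (b <= e)%N ->
  \sum_(a <= i < b) F i <= \sum_(c <= i < e) F i.
Proof.
move=> F0 ca be; have [ab|ba] := leqP a b; last first.
  by rewrite big_geq ?(ltnW ba)// sumr_ge0.
rewrite [leRHS](@big_cat_nat _ _ _ b)//=; last exact: leq_trans ab.
rewrite [X in _ <= X + _](@big_cat_nat _ _ _ a)//=.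
by rewrite -addrA addrCA lerDl addr_ge0// sumr_ge0.
Qed.

Lemma gsum_le g m x : (0 < m)%N -> -2 <= x <= 2 -> gsum g m x <= gtop g m.
Proof.
move=> m0 hx; have m0' : 0 < m%:R :> R by rewrite ltr0n.
have [k0 k4 /andP[a b]] := gnode_pos m0 hx.
rewrite /gsum (@big_cat_nat _ _ _ k0.+1)//= /gtop mulr2n mulrDl mul1r.
apply: lerD.
  rewrite big_nat_rev /= add0n.
  apply: le_trans (_ : \sum_(0 <= i < k0.+1) gbump g (i%:R / m%:R) <= _); last first.
    by apply: sum_nat_sub_le => // i; exact: gbump_ge0.
  rewrite big_nat_cond [leRHS]big_nat_cond; apply: ler_sum => i; rewrite andbT => /andP[_ ik].
  apply: gbump_anti; first by pos.
  rewrite subSS /gnode natrB// mulrBl.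
  by apply: le_trans (ler_norm _); lra.
apply: le_trans (_ : \sum_(0 <= i < (4 * m).+1 - k0.+1) gbump g (i%:R / m%:R) <= _); last first.
  by apply: sum_nat_sub_le => //; [move=> i; exact: gbump_ge0|exact: leq_subr].
rewrite -{1}[k0.+1]add0n big_addn; apply: ler_sum => i _.
apply: gbump_anti; first by pos.
rewrite /gnode distrC natrD mulrDl.
by apply: le_trans (ler_norm _); lra.
Qed.

(** If [x] lies between two consecutive nodes, the [i]-th node on either side is within [i / m] of
    [x], and each side has at least [m] nodes. *)
Lemma gsum_ge g m x : (0 < m)%N -> -1 <= x <= 1 ->
  2 * \sum_(1 <= i < m.+1) gbump g (i%:R / m%:R) <= gsum g m x.
Proof.
move=> m0 /andP[x1 x2]; have m0' : 0 < m%:R :> R by rewrite ltr0n.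
have hx : -2 <= x <= 2 by apply/andP; split; lra.
have [k0 k4 /andP[a b]] := gnode_pos m0 hx.
have k0m : (m <= k0.+1)%N.
  rewrite -(ler_nat R); have : 1 < k0.+1%:R / m%:R :> R by lra.
  by rewrite ltr_pdivlMr// mul1r => /ltW.
have k0m3 : (k0 <= 3 * m)%N.
  rewrite -(ler_nat R) natrM; have : k0%:R / m%:R <= 3 :> R by lra.
  by rewrite ler_pdivrMr.
rewrite /gsum [leRHS](@big_cat_nat _ _ _ k0.+1)//= mulr_natl mulr2n.
apply: lerD.
  apply: le_trans (_ : \sum_(1 <= i < k0.+2) gbump g (i%:R / m%:R) <= _).
    by apply: sum_nat_sub_le => // i; exact: gbump_ge0.
  rewrite big_add1 /= [leRHS]big_nat_rev /= add0n.
  rewrite big_nat_cond [leRHS]big_nat_cond; apply: ler_sum => i; rewrite andbT => /andP[_ ik].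
  apply: gbump_anti_norm; rewrite subSS /gnode natrB// mulrBl.
  rewrite -[k0.+1%:R]natr1 mulrDl mul1r in b; rewrite -[i.+1%:R]natr1 [in leRHS]mulrDl mul1r.
  have i0 : 0 <= i%:R / m%:R :> R by pos.
  have m1 : 0 < m%:R^-1 :> R by rewrite invr_gt0.
  have ik' : i%:R / m%:R <= k0%:R / m%:R :> R by rewrite ler_pM2r ?invr_gt0// ler_nat.
  by rewrite !ger0_norm; lra.
apply: le_trans (_ : \sum_(1 <= i < ((4 * m).+1 - k0.+1).+1) gbump g (i%:R / m%:R) <= _).
  by apply: sum_nat_sub_le => //; [move=> i; exact: gbump_ge0|lia].
rewrite [leLHS]big_add1 /= -[X in _ <= \sum_(X <= _ < _) _]add0n [leRHS]big_addn; apply: ler_sum => i _.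
apply: gbump_anti_norm; rewrite /gnode distrC natrD mulrDl.
rewrite -[k0.+1%:R]natr1 mulrDl mul1r in b; rewrite -[k0.+1%:R]natr1 -[i.+1%:R]natr1 !mulrDl mul1r.
have i0 : 0 <= i%:R / m%:R :> R by pos.
have m1 : 0 < m%:R^-1 :> R by rewrite invr_gt0.
by rewrite !ger0_norm; lra.
Qed.

Lemma gtop_gt0 g m : 0 < gtop g m.
Proof.
rewrite mulr_gt0// big_nat_recl// ltr_pwDl ?gbump_gt0//.
by apply: sumr_ge0 => k _; exact: gbump_ge0.
Qed.

Lemma gtop_ge g m : (0 < m)%N -> 0 < g <= 16 -> g * m%:R <= 2 * expR 1 * gtop g m.
Proof.
move=> m0 /andP[g0 g16]; have m0' : 0 < m%:R :> R by rewrite ltr0n.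
have w0 : 0 <= g / 4 * m%:R by pos.
(* As [g <= 16], these [k + 1] nodes are among the [4 * m + 1] available, and each of their bumps is
   at least [expR (- 1)]. *)
pose k := Num.truncn (g / 4 * m%:R).
have /andP[ka kb] := truncn_itv w0; rewrite -/k in ka kb.
have k4 : (k <= 4 * m)%N.
  rewrite -(ler_nat R) (le_trans ka)// natrM ler_pM2r//; lra.
have : \sum_(0 <= i < k.+1) expR (- 1) <= \sum_(0 <= i < (4 * m).+1) gbump g (i%:R / m%:R).
  apply: le_trans (_ : \sum_(0 <= i < k.+1) gbump g (i%:R / m%:R) <= _); last first.
    by apply: sum_nat_sub_le => // i; exact: gbump_ge0.
  rewrite big_nat_cond [leRHS]big_nat_cond; apply: ler_sum => i; rewrite andbT => /andP[_ ik].
  rewrite ler_expR lerN2 mulrC ler_pdivrMr ?exprn_gt0// mul1r lerXn2r ?nnegrE ?(ltW g0)//.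
  rewrite ler_pdivrMr//; apply: (@le_trans _ _ k%:R); first by rewrite ler_nat.
  by apply: le_trans ka _; rewrite ler_pM2r//; lra.
rewrite sumr_const_nat subn0 -[_ *+ k.+1]mulr_natl expRN => H.
have e0 : 0 < expR 1 :> R by exact: expR_gt0.
rewrite ler_pdivrMr// in H.
rewrite /gtop; move: (\sum_(_ <= _ < _) _) H => X H.
by have := lt_le_trans kb H; nra.
Qed.

(** Beyond the lower bound of [gsum_ge] there remain only the two central bumps and, on each side,
    the [3 * m] bumps at distance above 1. *)
Lemma gtop_gap g m x : (0 < m)%N -> -1 <= x <= 1 ->
  gtop g m - gsum g m x <= 2 + 6 * m%:R * expR (- g ^-2).
Proof.
move=> m0 hx; have m0' : 0 < m%:R :> R by rewrite ltr0n.
have := gsum_ge g m0 hx => HS.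
rewrite /gtop big_ltn// [X in 2 * (_ + X) - _](@big_cat_nat _ _ _ m.+1)//=; last by lia.
have H0 : gbump g (0%:R / m%:R) <= 1.
  by rewrite -[leRHS]expR0 ler_expR oppr_le0 mulr_ge0 ?sqr_ge0// invr_ge0 sqr_ge0.
have H1 : \sum_(m.+1 <= i < (4 * m).+1) gbump g (i%:R / m%:R) <= 3 * m%:R * expR (- g ^-2).
  apply: le_trans (_ : \sum_(m.+1 <= i < (4 * m).+1) expR (- g ^-2) <= _).
    rewrite big_nat_cond [leRHS]big_nat_cond; apply: ler_sum => i; rewrite andbT => /andP[ik _].
    rewrite ler_expR lerN2 ler_peMr ?invr_ge0 ?sqr_ge0//.
    rewrite exprn_ege1// ler_pdivlMr// mul1r ler_nat; exact: ltnW.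
  rewrite sumr_const_nat -[_ *+ _]mulr_natl ler_wpM2r ?expR_ge0// -natrM ler_nat; lia.
move: (\sum_(1 <= i < m.+1) _) (\sum_(m.+1 <= i < (4 * m).+1) _) (gsum g m x) HS H0 H1.
rewrite -[3 * _ * _]mulrA -[6 * _ * _]mulrA.
by move: (m%:R * expR _) (gbump _ _) => a b c e f HS H1 H2; lra.
Qed.

(** The bumps [2 j] and [2 j + 1] of width [sqrt 2 * g] are at most the bump [j] of width [g]. This
    pays for the wider Gaussian left over when half of the exponent is spent on decay. *)
Lemma gtop_sqrt2 g m : (0 < m)%N -> gtop (Num.sqrt 2 * g) m <= 2 * gtop g m.
Proof.
move=> m0; rewrite /gtop mulrCA ler_pM2l//.
have H (N : nat) : \sum_(0 <= i < N.*2) gbump (Num.sqrt 2 * g) (i%:R / m%:R) <=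
    2 * \sum_(0 <= i < N) gbump g (i%:R / m%:R).
  have P (i j : nat) : (j.*2 <= i)%N -> gbump (Num.sqrt 2 * g) (i%:R / m%:R) <= gbump g (j%:R / m%:R).
    move=> ij; rewrite ler_expR lerN2.
    have -> : (Num.sqrt 2 * g) ^- 2 = g ^- 2 * 2^-1.
      by rewrite exprMn sqr_sqrtr// invfM mulrC.
    rewrite -[leRHS]mulrA ler_wpM2l ?invr_ge0 ?sqr_ge0//.
    have : (j.*2)%:R <= i%:R :> R by rewrite ler_nat.
    rewrite -mul2n natrM => ij'.
    have m1 : 0 < m%:R^-1 :> R by rewrite invr_gt0 ltr0n.
    have : 2 * (j%:R / m%:R) <= i%:R / m%:R :> R by rewrite mulrA ler_pM2r.
    have j0 : 0 <= j%:R / m%:R :> R by pos.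
    by move: (j%:R / m%:R) (i%:R / m%:R) j0 => J I j0 JI; rewrite !expr2; nra.
  elim: N => [|N IH]; first by rewrite !big_geq// mulr0.
  rewrite doubleS !big_nat_recr//= mulrDr -addrA lerD//.
  by rewrite mulr2n mulrDl mul1r lerD// P//; lia.
apply: le_trans (H (4 * m).+1).
apply: sum_nat_sub_le => //; last by lia.
by move=> i; exact: gbump_ge0.
Qed.

End GridSum.

Section GridApprox.
Context {R : realType} {d : nat}.
Local Notation pt := (d.-tuple R).
Context (g : R) (m : nat) (e : pt -> R).
Local Notation idx := ({ffun 'I_d -> 'I_(4 * m).+1}).

Definition grid_node (k : idx) : pt := [tuple gnode m (k i) | i < d].

Lemma kgauss_prod h (x z : pt) : kgauss h x z = \prod_(i < d) gbump h (tnth x i - tnth z i).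
Proof. by rewrite /kgauss sqr_dist2 big_distrr -sumrN expR_sum. Qed.

Lemma grid_total h (x : pt) :
  \sum_(k : idx) kgauss h x (grid_node k) = \prod_(i < d) gsum h m (tnth x i).
Proof.
under [RHS]eq_bigr do rewrite /gsum big_mkord.
rewrite (bigA_distr_bigA (fun i (k : 'I_(4 * m).+1) => gbump h (tnth x i - gnode m k))).
by apply: eq_bigr => k _; rewrite kgauss_prod; apply: eq_bigr => i _; rewrite tnth_mktuple.
Qed.

Definition grid_elem : seq (R * pt) :=
  [seq (e (grid_node k) / gtop g m ^+ d, grid_node k) | k : idx].

Lemma grid_elem_eval x : pre_eval g grid_elem x =
  (gtop g m ^+ d)^-1 * \sum_(k : idx) e (grid_node k) * kgauss g x (grid_node k).
Proof.
rewrite /pre_eval big_map big_enum big_distrr /=; apply: eq_bigr => k _.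
by rewrite kgaussC mulrCA mulrA.
Qed.

Context (m0 : (0 < m)%N) (e1 : forall z, `|e z| <= 1) (g16 : 0 < g <= 16).

Let M0 : 0 < gtop g m := gtop_gt0 g m.
Let Md0 : 0 < gtop g m ^+ d := exprn_gt0 d M0.

Lemma grid_total_le h x : (forall i, -2 <= tnth x i <= 2) ->
  \sum_(k : idx) kgauss h x (grid_node k) <= gtop h m ^+ d.
Proof.
move=> hx; rewrite grid_total -[d in leRHS]card_ord -prodr_const.
by apply: ler_prod => i _; rewrite gsum_ge0 gsum_le.
Qed.

(** In the double sum one factor [gtop g m ^+ d] absorbs the inner sum, and the other absorbs the
    number of nodes through [gtop_ge]. The mesh disappears, so [m] can be taken as large as
    desired. *)
Lemma grid_elem_norm : pre_norm2 g grid_elem <= (10 * expR 1) ^+ d * g^-1 ^+ d.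
Proof.
have /andP[g0 _] := g16.
have m0' : 0 < m%:R :> R by rewrite ltr0n.
have nodeB (k : idx) i : -2 <= tnth (grid_node k) i <= 2.
  rewrite tnth_mktuple /gnode; have := ltn_ord (k i); rewrite ltnS => kim.
  have : (k i)%:R / m%:R <= 4 :> R by rewrite ler_pdivrMr// -natrM ler_nat.
  have : 0 <= (k i)%:R / m%:R :> R by rewrite divr_ge0.
  by move=> *; apply/andP; split; lra.
apply: (@le_trans _ _ (\sum_(k : idx) (gtop g m ^+ d)^-1)).
  rewrite /pre_norm2 big_map big_enum; apply: ler_sum => k _ /=.
  rewrite big_map big_enum /=.
  apply: (@le_trans _ _ (\sum_(k' : idx) (gtop g m ^+ d)^-1 * (gtop g m ^+ d)^-1 *
     kgauss g (grid_node k) (grid_node k'))).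
    apply: ler_sum => k' _; apply: ler_wpM2r; first by rewrite ltW// kgauss_gt0.
    apply: le_trans (ler_norm _) _; rewrite !normrM.
    have i0 : 0 <= (gtop g m ^+ d)^-1 by rewrite invr_ge0 ltW.
    rewrite (ger0_norm i0); apply: ler_pM; rewrite ?mulr_ge0//.
      by rewrite ler_piMl.
    by rewrite ler_piMl.
  rewrite -big_distrr /= -mulrA -[leRHS]mulr1 ler_wpM2l ?invr_ge0 ?(ltW Md0)//.
  by rewrite ler_pdivrMl// mulr1; exact: grid_total_le.
rewrite sumr_const card_ffun !card_ord -[leLHS]mulr_natr natrX -exprVn -!exprMn.
apply: lerXn2r; rewrite ?nnegrE; [by pos|by pos|].
rewrite ler_pdivrMl//.
have := gtop_ge m0 g16; rewrite mulrC -ler_pdivlMr// => H.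
apply: (@le_trans _ _ (5 * m%:R)).
  by rewrite -natrM ler_nat; lia.
apply: le_trans (ler_wpM2l _ H) _ => //.
by rewrite le_eqVlt; apply/orP; left; apply/eqP; ring.
Qed.

Lemma grid_elem_le1 x : cube x -> `|pre_eval g grid_elem x| <= 1.
Proof.
move=> hx; rewrite grid_elem_eval normrM gtr0_norm ?invr_gt0// ler_pdivrMl// mulr1.
apply: le_trans (ler_norm_sum _ _ _) _.
apply: le_trans (@grid_total_le g x _); last first.
  by move=> i; have /andP[a b] := hx i; apply/andP; split; lra.
apply: ler_sum => k _; rewrite normrM (gtr0_norm (kgauss_gt0 _ _ _)).
by rewrite ler_piMl// ltW// kgauss_gt0.
Qed.

(** Two errors: the mass missing from the total Gaussian sum, at most [d%:R * eps], and the nodes at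
    distance at least [rho], where half of the exponent gives the decay and the other half is a
    Gaussian of width [sqrt 2 * g]. *)
Lemma grid_elem_close x (sg rho eps : R) : cube x -> `|sg| <= 1 -> 0 <= rho ->
  (forall z, dist2 z x < rho -> e z = sg) ->
  0 <= eps <= 1 -> 2 + 6 * m%:R * expR (- g ^-2) <= eps * gtop g m ->
  `|pre_eval g grid_elem x - sg| <= d%:R * eps + 2 * 2 ^+ d * expR (- (rho ^+ 2 / (2 * g ^+ 2))).
Proof.
move=> hx sg1 rho0 He /andP[eps0 eps1] Heps; have /andP[g0 _] := g16.
set W := \sum_(k : idx) kgauss g x (grid_node k).
have hx2 i : -2 <= tnth x i <= 2.
  by have /andP[a b] := hx i; apply/andP; split; lra.
have W1 : 1 - d%:R * eps <= W / gtop g m ^+ d.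
  rewrite /W grid_total -[X in _ / gtop g m ^+ X]card_ord -prodr_const -prodf_div.
  have := @prod_ge_1B R 'I_d (enum 'I_d) (fun i => gsum g m (tnth x i) / gtop g m) eps eps0.
  rewrite big_enum size_enum_ord /= => H.
  suff /andP[] : 1 - d%:R * eps <=
      \prod_(i in 'I_d) (gsum g m (tnth x i) / gtop g m) <= 1 by [].
  apply: H.
  - move=> i; rewrite ler_pdivrMr// mul1r gsum_le// andbT ler_pdivlMr// mulrBl mul1r.
    by have := gtop_gap g m0 (hx i); lra.
  - by move=> i; rewrite divr_ge0// ?gsum_ge0// ltW.
have -> : pre_eval g grid_elem x - sg =
    (gtop g m ^+ d)^-1 * (\sum_(k : idx) (e (grid_node k) - sg) * kgauss g x (grid_node k))
    + sg * (W / gtop g m ^+ d - 1).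
  rewrite grid_elem_eval; under [in RHS]eq_bigr do rewrite mulrBl.
  by rewrite sumrB -big_distrr /= -/W; ring.
apply: le_trans (ler_normD _ _) _; rewrite addrC; apply: lerD.
  rewrite normrM -[leRHS]mul1r; apply: ler_pM => //.
  have W2 : W / gtop g m ^+ d <= 1 by rewrite ler_pdivrMr// mul1r grid_total_le.
  by rewrite ler_norml; apply/andP; split; lra.
rewrite normrM gtr0_norm ?invr_gt0// ler_pdivrMl//.
apply: le_trans (ler_norm_sum _ _ _) _.
set E := expR _.
apply: (@le_trans _ _ (\sum_(k : idx) 2 * E * kgauss (Num.sqrt 2 * g) x (grid_node k))).
  apply: ler_sum => k _; rewrite normrM (gtr0_norm (kgauss_gt0 _ _ _)).
  have [H|H] := ltP (dist2 (grid_node k) x) rho.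
    by rewrite He// subrr normr0 mul0r mulr_ge0 ?mulr_ge0 ?expR_ge0// ltW// kgauss_gt0.
  rewrite -mulrA; apply: ler_pM => //; first by rewrite ltW// kgauss_gt0.
    by apply: le_trans (ler_normB _ _) _; apply: lerD.
  rewrite /E /kgauss -expRD ler_expR -opprD lerN2.
  rewrite exprMn sqr_sqrtr//; rewrite dist2C in H.
  have H2 : rho ^+ 2 <= dist2 x (grid_node k) ^+ 2.
    by rewrite lerXn2r ?nnegrE ?dist2_ge0.
  have -> : rho ^+ 2 / (2 * g ^+ 2) + (2 * g ^+ 2)^-1 * dist2 x (grid_node k) ^+ 2
    = g ^- 2 * (2^-1 * (rho ^+ 2 + dist2 x (grid_node k) ^+ 2)).
    by field; rewrite gt_eqF.
  rewrite ler_wpM2l ?invr_ge0 ?sqr_ge0//; lra.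
rewrite -big_distrr /= mulrC [leRHS]mulrCA -mulrA [leRHS]mulrA -/(2 * E).
rewrite [leRHS](_ : _ = 2 ^+ d * gtop g m ^+ d * (2 * E)); last by ring.
rewrite ler_wpM2r ?mulr_ge0 ?expR_ge0// -exprMn.
apply: le_trans (@grid_total_le _ _ hx2) _.
apply: lerXn2r; rewrite ?nnegrE; [by rewrite ltW// gtop_gt0|by pos|exact: gtop_sqrt2].
Qed.

End GridApprox.

Lemma gauss_approx (R : realType) (d : nat) (beta : R) : 0 < beta ->
  exists2 C : R, 0 < C & forall (g : R) (e : d.-tuple R -> R),
  0 < g <= 16 -> (forall z, `|e z| <= 1) ->
  exists s : seq (R * d.-tuple R), pre_norm2 g s <= C * g `^ (- d%:R) /\
  forall x, cube x -> `|pre_eval g s x| <= 1 /\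
    forall sg rho : R, `|sg| <= 1 -> 0 <= rho -> (forall z, dist2 z x < rho -> e z = sg) ->
    `|pre_eval g s x - sg| <= C * (g `^ beta + expR (- (rho ^+ 2 / (2 * g ^+ 2)))).
Proof.
move=> b0; pose a := (beta + 1) / 2.
have a0 : 0 < a by rewrite divr_gt0// addr_gt0.
pose c1 : R := 4 * expR 1 * (1 + 3 * a `^ a).
have c10 : 0 < c1 by rewrite /c1; pos.
exists ((10 * expR 1) ^+ d + d%:R * c1 + 2 * 2 ^+ d + 2 * c1); first by pos.
move=> g e g16 e1; have /andP[g0 g16'] := g16.
(* The gap relative to [gtop] is of order [1 / (g m) + exp (- 1 / g^2) / g]. This [m] makes the
   first term at most [g^beta]; [a = (beta + 1) / 2] does so for the second, up to a constant. *)
pose m := (Num.truncn (g `^ (- (beta + 1)))).+1.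
have mg : g `^ (- (beta + 1)) <= m%:R by rewrite ltW// truncnS_gt.
have m0' : 0 < m%:R :> R by rewrite ltr0n.
have gap : 2 + 6 * m%:R * expR (- g ^-2) <= c1 * g `^ beta * gtop g m.
  have H1 := gtop_ge (isT : (0 < m)%N) g16.
  have H2 : expR (- g ^-2) <= a `^ a * g `^ (beta + 1).
    apply: le_trans (expRN_le_powR a0 _) _; first by rewrite invr_gt0 exprn_gt0.
    rewrite powRVN ?sqr_ge0// opprK -powR_mulrn ?(ltW g0)// -powRrM.
    by rewrite /a [2 * _]mulrC divfK.
  have H3 : g `^ (beta + 1) = g * g `^ beta.
    by rewrite powRD ?powRr1 ?(ltW g0) 1?mulrC// [g == 0]gt_eqF ?implybT.
  have H4 : 1 <= m%:R * (g * g `^ beta).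
    by rewrite -H3 -ler_pdivrMr ?powR_gt0// mul1r -powRN.
  rewrite H3 in H2.
  have b1 : 0 <= g `^ beta by exact: powR_ge0.
  have H5 : m%:R * expR (- g ^-2) <= m%:R * (a `^ a * (g * g `^ beta)) by rewrite ler_pM2l.
  have H6 : g `^ beta * (g * m%:R) <= g `^ beta * (2 * expR 1 * gtop g m) by rewrite ler_wpM2l.
  have aa : 0 <= a `^ a by exact: powR_ge0.
  rewrite /c1; move: (a `^ a) (g `^ beta) (gtop g m) (expR 1) (expR (- _)) (m%:R : R) aa b1 H4 H5 H6.
  move=> A B G X Y m' A0 B0 H4 H5 H6.
  have H7 := ler_wpM2l A0 H6.
  have -> : 4 * X * (1 + 3 * A) * B * G = 2 * (B * (2 * X * G)) + 6 * (A * (B * (2 * X * G))) by ring.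
  have E1 : B * (g * m') = m' * (g * B) by ring.
  have E2 : A * (B * (g * m')) = m' * (A * (g * B)) by ring.
  by rewrite -mulrA; lra.
exists (grid_elem g m e); split.
  apply: le_trans (grid_elem_norm (isT : (0 < m)%N) e1 g16) _.
  rewrite powRN powR_mulrn ?(ltW g0)// exprVn ler_wpM2r ?invr_ge0 ?exprn_ge0 ?(ltW g0)//.
  by rewrite -!addrA lerDl; pos.
move=> x hx; have le1 := grid_elem_le1 g (isT : (0 < m)%N) e1 hx; split => //.
move=> sg rho sg1 rho0 He.
have gb0 : 0 <= g `^ beta by exact: powR_ge0.
set E := expR (- _); have E0 : 0 <= E by exact: expR_ge0.
have k0 : 0 <= (10 * expR 1) ^+ d :> R by pos.
have d0 : 0 <= d%:R * c1 by pos.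
have t0 : 0 <= 2 * 2 ^+ d :> R by pos.
(* When [c1 g^beta > 1], the trivial bound 2 is already below the claim. *)
have [H|H] := leP (c1 * g `^ beta) 1.
  have H' : 0 <= c1 * g `^ beta <= 1 by rewrite H andbT; pos.
  apply: le_trans (grid_elem_close (isT : (0 < m)%N) e1 g16 hx sg1 rho0 He H' gap) _.
  rewrite -/E mulrA; move: ((10 * expR 1) ^+ d) (d%:R * c1) (2 * 2 ^+ d) (g `^ beta) k0 d0 t0 gb0 E0.
  move: E => E A B D G A0 B0 D0 G0 E0.
  have -> : (A + B + D + 2 * c1) * (G + E) =
     (B * G + D * E) + (A * (G + E) + B * E + D * G + 2 * c1 * (G + E)) by ring.
  by rewrite lerDl; pos.
apply: (@le_trans _ _ 2).
  by apply: le_trans (ler_normB _ _) _; apply: lerD.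
move: H k0 d0 t0 gb0 E0 c10; clear gap; move: ((10 * expR 1) ^+ d) (d%:R * c1) (2 * 2 ^+ d) (g `^ beta).
move: E (c1) => E c A B D G H A0 B0 D0 G0 E0 C0.
have -> : (A + B + D + 2 * c) * (G + E) =
   2 * (c * G) + ((A + B + D) * (G + E) + 2 * c * E) by ring.
have : 0 <= (A + B + D) * (G + E) + 2 * c * E by pos.
by move: (_ + _ * E) (c * G) H => X Y; lra.
Qed.

(** * Hinge risk, noise exponent and margin-noise exponent *)

Section SetDist.
Context {R : realType} {d : nat}.
Local Notation pt := (d.-tuple R).
Implicit Types (x y z : pt) (S : set pt).

Lemma measurable_ball2 z (e : R) : measurable (ball2 z e).
Proof.
have [e0|e0] := leP e 0.
  rewrite (_ : ball2 z e = set0)//; apply/seteqP; split=> // x /=.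
  by rewrite /ball2 /= ltNge (le_trans e0)// dist2_ge0.
rewrite (_ : ball2 z e = (fun x => dist2 x z ^+ 2) @^-1` `]-oo, e ^+ 2[%classic).
  by rewrite -[X in measurable X]setTI; exact: measurable_sqr_dist2.
apply/seteqP; split=> x; rewrite /ball2 /= in_itv /= dist2C => H.
  by rewrite dist2C ltrXn2r ?nnegrE ?dist2_ge0 ?ltW// dist2C.
by move: H; rewrite ltr_pXn2r ?nnegrE ?dist2_ge0 ?ltW.
Qed.

Lemma rat_dense x (e : R) : 0 < e ->
  exists q : d.-tuple rat, dist2 x [tuple ratr (tnth q i) | i < d] < e.
Proof.
move=> e0; pose c := e / (d%:R + 1).
have d1 : 0 < d%:R + 1 :> R by rewrite ltr_wpDl.
have c0 : 0 < c by rewrite divr_gt0.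
have /choice[f Hf] : forall i : 'I_d, exists q : rat, `|tnth x i - ratr q| < c.
  move=> i; have : tnth x i < tnth x i + c by rewrite ltrDl.
  move=> /rat_in_itvoo[q]; rewrite in_itv /= => /andP[a b].
  by exists q; rewrite ltr_norml; apply/andP; split; lra.
exists [tuple f i | i < d]; rewrite -(@ltr_pXn2r _ 2)// ?nnegrE ?dist2_ge0 ?ltW//.
rewrite sqr_dist2; apply: (@le_lt_trans _ _ (\sum_(i < d) c ^+ 2)).
  apply: ler_sum => i _; rewrite !tnth_mktuple -[leLHS]real_normK ?num_real//.
  by rewrite lerXn2r ?nnegrE ?(ltW c0)// ltW.
rewrite sumr_const card_ord -mulr_natl /c expr_div_n mulrA ltr_pdivrMr ?exprn_gt0//.
rewrite mulrC ltr_pM2l ?exprn_gt0// expr2.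
have d0 : 0 <= d%:R :> R by [].
by nra.
Qed.

Lemma setdist_ltP x S (t : R) :
  (setdist x S < t%:E)%E <-> exists2 s, S s & dist2 x s < t.
Proof.
split=> [/ereal_inf_lt[_ [s Ss <-]]|[s Ss xs]]; first by rewrite lte_fin => H; exists s.
by apply: (@le_lt_trans _ _ (dist2 x s)%:E); [apply: ereal_inf_lbound; exists s|rewrite lte_fin].
Qed.

(** The set is open, but the measurable structure is generated by coordinates: it is exhibited as a
    countable union of balls with rational centres and radii [1 / (j + 1)]. *)
Lemma measurable_setdist S (t : R) : measurable [set x | (setdist x S < t%:E)%E].
Proof.
pose D := [set u : d.-tuple rat * nat | exists2 s, S s &
   dist2 [tuple ratr (tnth u.1 i) | i < d] s + u.2.+1%:R^-1 <= t].
rewrite (_ : [set x | _] = \bigcup_(u in D) ball2 [tuple ratr (tnth u.1 i) | i < d] u.2.+1%:R^-1).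
  rewrite bigcup_mkcond; apply: countable_bigcupT_measurable => [|u].
    exact: countableP.
  by case: ifP => // _; exact: measurable_ball2.
apply/seteqP; split=> x /=.
  move=> /setdist_ltP[s Ss xs].
  pose e := (t - dist2 x s) / 2.
  have e0 : 0 < e by rewrite divr_gt0// subr_gt0.
  pose j := Num.truncn e^-1.
  have j1 : j.+1%:R^-1 <= e.
    by rewrite -[leRHS]invrK lef_pV2 ?posrE ?invr_gt0//; apply: ltW; exact: truncnS_gt.
  have j0 : 0 < j.+1%:R^-1 :> R by rewrite invr_gt0.
  have [q Hq] := rat_dense x j0.
  exists (q, j) => //=; exists s => //=.
  have := dist2_triangle [tuple ratr (tnth q i) | i < d] s x.
  rewrite [dist2 _ x]dist2C; move: Hq j1; rewrite /e; move: (j.+1%:R^-1) (dist2 x _) => u v.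
  by lra.
move=> [[q j] [s Ss /= H] xq]; apply/setdist_ltP; exists s => //.
apply: le_lt_trans (dist2_triangle _ _ [tuple ratr (tnth q i) | i < d]) _.
by move: xq H; rewrite /ball2 /=; move: (j.+1%:R^-1) => u; lra.
Qed.

Lemma setdist_triangle x y S (t u : R) : (t%:E <= setdist x S)%E -> dist2 x y <= u ->
  ((t - u)%:E <= setdist y S)%E.
Proof.
move=> H xy; apply: le_ereal_inf_tmp => _ [s Ss <-]; rewrite lee_fin.
have : (t%:E <= (dist2 x s)%:E)%E by apply: le_trans H _; apply: ereal_inf_lbound; exists s.
by rewrite lee_fin; have := dist2_triangle x s y; lra.
Qed.

End SetDist.

Section Risk.
Context {R : realType} {d : nat}.
Local Notation pt := (d.-tuple R).
Implicit Types (x y z : pt) (f g : pt -> R).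

Lemma clip_bound (t : R) : -1 <= clip t <= 1.
Proof.
rewrite /clip le_max lexx/= ge_max; apply/andP; split; first by lra.
by rewrite ge_min lexx orbT.
Qed.

Lemma clip_norm (t : R) : `|clip t| <= 1.
Proof. by rewrite ler_norml clip_bound. Qed.

Lemma clip_id (t : R) : `|t| <= 1 -> clip t = t.
Proof.
by rewrite ler_norml /clip => /andP[a b]; rewrite (min_idPl b) (max_idPr a).
Qed.

Lemma clipE (t : R) : clip t = if t <= -1 then -1 else if t <= 1 then t else 1.
Proof.
rewrite /clip; case: ifPn => [t1|]; last rewrite -ltNge => t1.
  by apply/max_idPl; rewrite ge_min t1.
case: ifPn => [t2|]; last rewrite -ltNge => t2.
  by rewrite (min_idPl t2); apply/max_idPr; exact: ltW.
by rewrite (min_idPr (ltW t2)); apply/max_idPr; lra.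
Qed.

Lemma clip_lip (s t : R) : `|clip s - clip t| <= `|s - t|.
Proof.
wlog st : s t / s <= t.
  by move=> H; have [/H//|/ltW/H] := leP s t; rewrite distrC [leRHS]distrC.
rewrite distrC [leRHS]distrC [leRHS]ger0_norm ?subr_ge0// ler_norml !clipE.
by repeat (case: ifPn; rewrite -?ltNge => ?); apply/andP; split; lra.
Qed.

Lemma ysgn_norm b : `|ysgn b| = 1 :> R.
Proof. by case: b; rewrite /ysgn ?normrN normr1. Qed.

Lemma hingeE b (t : R) : hinge b t = if ysgn b * t <= 1 then 1 - ysgn b * t else 0.
Proof.
rewrite /hinge; case: ifPn => [t1|]; last rewrite -ltNge => t1.
  by apply/max_idPr; rewrite subr_ge0.
by apply/max_idPl; rewrite subr_le0 ltW.
Qed.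

Lemma hinge_clip_le b (t : R) : hinge b (clip t) <= hinge b t.
Proof.
rewrite !hingeE clipE; case: b; rewrite /ysgn ?mul1r ?mulN1r;
  case: (lerP t (-1)) => t1; case: (lerP t 1) => t2;
  by repeat (case: ifPn; rewrite -?ltNge => ?); lra.
Qed.

Lemma hinge_small b (t : R) : `|t| <= 1 -> hinge b t = 1 - ysgn b * t.
Proof.
move=> t1; apply/max_idPr; rewrite subr_ge0.
by apply: le_trans (ler_norm _) _; rewrite normrM ysgn_norm mul1r.
Qed.

Lemma hinge_ge0 b (t : R) : 0 <= hinge b t.
Proof. by rewrite /hinge le_max lexx. Qed.

Lemma hinge_lip b (s t : R) : `|hinge b s - hinge b t| <= `|s - t|.
Proof.
rewrite !hingeE; case: b; rewrite /ysgn ?mul1r ?mulN1r; do 2 case: ifPn; rewrite -?ltNge => *;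
 by rewrite ler_norml; apply/andP; split; case: (ger0P (s - t)) => *; lra.
Qed.

Lemma hinge_convex b (l s t : R) : 0 <= l <= 1 ->
  hinge b ((1 - l) * s + l * t) <= (1 - l) * hinge b s + l * hinge b t.
Proof.
move=> /andP[l0 l1]; rewrite {1}/hinge ge_max.
have l1' : 0 <= 1 - l by rewrite subr_ge0.
rewrite addr_ge0 ?mulr_ge0 ?hinge_ge0//=.
have H (u : R) : 1 - ysgn b * u <= hinge b u by rewrite /hinge le_max lexx orbT.
apply: (@le_trans _ _ ((1 - l) * (1 - ysgn b * s) + l * (1 - ysgn b * t))).
  by rewrite le_eqVlt; apply/orP; left; apply/eqP; ring.
by apply: lerD; apply: ler_wpM2l.
Qed.

Lemma measurable_clip f : measurable_fun setT f -> measurable_fun setT (fun x => clip (f x)).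
Proof.
move=> mf; apply: measurable_maxr => //; apply: measurable_minr => //.
Qed.

Lemma measurable_ysgn : measurable_fun setT (fun z : pt * bool => ysgn z.2 : R).
Proof.
apply: (@measurableT_comp _ _ _ _ _ _ (fun b : bool => ysgn b : R) _ snd) => //.
Qed.

Lemma bmeas_ysgn : bmeas (fun z : pt * bool => ysgn z.2 : R).
Proof.
apply: (@bmeas_bound _ _ _ _ 1); first exact: measurable_ysgn.
by move=> z; rewrite ysgn_norm.
Qed.

Lemma bmeas_fst f : bmeas f -> bmeas (fun z : pt * bool => f z.1).
Proof.
move=> [mf [M fM]]; split; last by exists M => z.
exact: measurableT_comp.
Qed.

Lemma bmeas_clip f : measurable_fun setT f -> bmeas (fun x => clip (f x)).
Proof.
move=> mf; apply: (@bmeas_bound _ _ _ _ 1); first exact: measurable_clip.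
by move=> z; exact: clip_norm.
Qed.

Context (P : probability (pt * bool)%type R) (eta : pt -> R).
Context (etaP : is_eta P eta).

Lemma bmeas_eta : bmeas eta.
Proof.
have [me e01 _] := etaP; apply: (@bmeas_bound _ _ _ _ 1) => // x.
by have /andP[a b] := e01 x; rewrite ger0_norm.
Qed.

Lemma bmeas_weight : bmeas (fun x => 2 * eta x - 1).
Proof.
apply: bmeasB; last exact: bmeas_cst.
by apply: bmeasZ; exact: bmeas_eta.
Qed.

(** Both sides are bounded linear functionals of [f], so indicators suffice, and for these the claim
    is the defining property of [eta]. *)
Lemma Ex_ysgn f : bmeas f ->
  Ex P (fun z : pt * bool => ysgn z.2 * f z.1) = Ex P (fun z : pt * bool => (2 * eta z.1 - 1) * f z.1).
Proof.
apply: (@bounded_linear_ext _ _ _ (fun f => Ex P (fun z : pt * bool => ysgn z.2 * f z.1))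
  (fun f => Ex P (fun z : pt * bool => (2 * eta z.1 - 1) * f z.1))).
- split.
  + move=> g h bg bh; rewrite -ExD; [|by apply: bmeasM; [exact: bmeas_ysgn|exact: bmeas_fst]..].
    by congr (Ex P); apply/funext => z; rewrite mulrDr.
  + move=> a g bg; rewrite -ExZ; last by apply: bmeasM; [exact: bmeas_ysgn|exact: bmeas_fst].
    by congr (Ex P); apply/funext => z; rewrite mulrCA.
  + exists 1 => g M bg gM; rewrite mul1r; apply: Ex_bound.
      by apply: bmeasM; [exact: bmeas_ysgn|exact: bmeas_fst].
    by move=> z; rewrite normrM ysgn_norm mul1r.
- have bw : bmeas (fun z : pt * bool => 2 * eta z.1 - 1).
    exact: (bmeas_fst bmeas_weight).
  split.
  + move=> g h bg bh; rewrite -ExD; [|by apply: bmeasM => //; exact: bmeas_fst..].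
    by congr (Ex P); apply/funext => z; rewrite mulrDr.
  + move=> a g bg; rewrite -ExZ; last by apply: bmeasM => //; exact: bmeas_fst.
    by congr (Ex P); apply/funext => z; rewrite mulrCA.
  + exists 1 => g M bg gM; apply: Ex_bound.
      by apply: bmeasM => //; exact: bmeas_fst.
    move=> z; rewrite normrM ler_pM//; have [_ e01 _] := etaP.
    by have /andP[a b] := e01 z.1; rewrite ler_norml; apply/andP; split; lra.
move=> B mB; have [me e01 etaE] := etaP.
have mBT b : measurable (B `*` [set b] : set (pt * bool)) by exact: measurableX.
have mBS : measurable (B `*` setT : set (pt * bool)) by exact: measurableX.
have bI : bmeas (fun z : pt * bool => (\1_B z.1 : R)) by apply: bmeas_fst; exact: bmeas_indic.
have bIe : bmeas (fun z : pt * bool => eta z.1 * (\1_B z.1 : R)).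
  by apply: bmeasM => //; apply: bmeas_fst; exact: bmeas_eta.
have -> : (fun z : pt * bool => ysgn z.2 * (\1_B z.1 : R)) =
   (fun z : pt * bool => 2 * (\1_(B `*` [set true]) : pt * bool -> R) z - \1_B z.1).
  apply/funext => -[x b]; rewrite !indicE /= in_setX.
  case: b; rewrite /ysgn; case: (x \in B) => /=.
  - by rewrite mem_set//=; ring.
  - by ring.
  - by rewrite memNset//=; ring.
  - by ring.
have -> : (fun z : pt * bool => (2 * eta z.1 - 1) * (\1_B z.1 : R)) =
   (fun z : pt * bool => 2 * (eta z.1 * (\1_B z.1 : R)) - \1_B z.1).
  by apply/funext => z; ring.
rewrite !ExB//; [|by apply: bmeasZ|by apply: bmeasZ; exact: bmeas_indic].
rewrite !ExZ//; last exact: bmeas_indic.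
congr (2 * _ - _); rewrite Ex_indic// etaE// /Ex /Rintegral; congr fine.
rewrite [LHS]integral_mkcond; apply: eq_integral => z _.
rewrite patchE indicE; case: ifPn => /= H.
  by move: H; rewrite inE => -[/= Bz _]; rewrite mem_set// mulr1.
rewrite memNset ?mulr0// => Bz; move/negP: H; apply.
by rewrite inE; split.
Qed.

Lemma risk_small f : measurable_fun setT f -> (forall x, `|f x| <= 1) ->
  risk P f = (1 - Ex P (fun z : pt * bool => (2 * eta z.1 - 1) * f z.1))%:E.
Proof.
move=> mf f1; have bf : bmeas f by exact: bmeas_bound f1.
have by_ : bmeas (fun z : pt * bool => ysgn z.2 * f z.1).
  by apply: bmeasM; [exact: bmeas_ysgn|exact: bmeas_fst].
rewrite -Ex_ysgn// -[X in (X - _)%:E](Ex_cst P) -ExB//; last exact: bmeas_cst.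
rewrite -Ex_fin; last by apply: bmeasB => //; exact: bmeas_cst.
by apply: eq_integral => z _; rewrite hinge_small.
Qed.

Lemma measurable_hinge f : measurable_fun setT f ->
  measurable_fun setT (fun z : pt * bool => hinge z.2 (f z.1)).
Proof.
move=> mf; apply: measurable_maxr => //; apply: measurable_funB => //.
apply: measurable_funM; first exact: measurable_ysgn.
exact: measurableT_comp.
Qed.

(** Clipping lowers the risk, and for a clipped [f] the risk is 1 minus the expectation of
    [(2 * eta - 1) * f]. *)
Lemma bayes_risk_ge : ((1 - Ex P (fun z : pt * bool => `|2 * eta z.1 - 1|))%:E <= bayes_risk P)%E.
Proof.
apply: le_ereal_inf_tmp => _ [f mf <-]; apply: (@le_trans _ _ (risk P (fun x => clip (f x)))).
  rewrite risk_small; [|exact: measurable_clip|by move=> x; exact: clip_norm].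
  rewrite lee_fin lerD2l lerN2.
  have bw := bmeas_fst bmeas_weight.
  apply: Ex_le.
  - by apply: bmeasM => //; exact: (bmeas_fst (bmeas_clip mf)).
  - exact: bmeas_norm.
  - move=> z; apply: le_trans (ler_norm _) _; rewrite normrM ler_piMr//.
    exact: clip_norm.
apply: ge0_le_integral => //.
- by move=> z _; rewrite lee_fin hinge_ge0.
- by apply/measurable_EFinP; exact: (measurable_hinge (measurable_clip mf)).
- by apply/measurable_EFinP; exact: (measurable_hinge mf).
- by move=> z _; rewrite lee_fin hinge_clip_le.
Qed.

End Risk.

(* The exponent in [E |fstar - clip g| <= V (excess risk)^theta]. *)
Definition noise_theta {R : realType} (q : \bar R) : R :=
  match q with EFin q' => q' / (q' + 1) | _ => 1 end.

Lemma noise_theta01 {R : realType} (q : \bar R) : (0 <= q)%E -> 0 <= noise_theta q <= 1.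
Proof.
case: q => [q|//|//] /=; last by rewrite ler01 lexx.
rewrite lee_fin => q0; have q1 : 0 < q + 1 by rewrite ltr_wpDl.
by rewrite divr_ge0 ?(ltW q1)//= ler_pdivrMr// mul1r lerDl.
Qed.

Section Excess.
Context {R : realType} {d : nat}.
Local Notation pt := (d.-tuple R).
Implicit Types (x y : pt) (f g : pt -> R).
Context (X : set pt) (P : probability (pt * bool)%type R) (eta : pt -> R).

(* Bayes classifier; ties [eta = 1/2] get [-1], and it vanishes off [X], where the SVM does too. *)
Definition fstar x : R := \1_X x * (2 * \1_[set x | 1 / 2 < eta x] x - 1).

(* The hinge loss is affine on [[-1, 1]]: this is [hinge y (clip (g x)) - hinge y (fstar x)] on [X]. *)
Definition hdiff g (z : pt * bool) : R := ysgn z.2 * (fstar z.1 - clip (g z.1)).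

Definition exc g : R := Ex P (hdiff g).

Definition supported g := forall x, ~ X x -> g x = 0.

Context (mX : measurable X) (PX : P (X `*` setT) = 1%E) (etaP : is_eta P eta).

Lemma fstar_out x : ~ X x -> fstar x = 0.
Proof. by move=> Xx; rewrite /fstar indicE memNset// mul0r. Qed.

Lemma fstar_pos x : X x -> 1 / 2 < eta x -> fstar x = 1.
Proof. by move=> Xx ex; rewrite /fstar !indicE !mem_set//= mul1r; ring. Qed.

Lemma fstar_neg x : X x -> eta x <= 1 / 2 -> fstar x = -1.
Proof.
move=> Xx ex; have N : ~ [set x | 1 / 2 < eta x] x by apply/negP; rewrite -leNgt.
by rewrite /fstar !indicE mem_set// (memNset N) /= mul1r mulr0 sub0r.
Qed.

Lemma fstar_norm x : `|fstar x| <= 1.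
Proof.
have [Xx|Xx] := pselect (X x); last by rewrite fstar_out// normr0.
have [ex|ex] := ltP (1 / 2) (eta x); first by rewrite fstar_pos// normr1.
by rewrite fstar_neg// normrN normr1.
Qed.

Lemma bmeas_fstar : bmeas fstar.
Proof.
apply: bmeasM; first exact: bmeas_indic.
apply: bmeasB; last exact: bmeas_cst.
apply: bmeasZ; apply: bmeas_indic.
have [me _ _] := etaP.
rewrite (_ : [set x | _] = eta @^-1` `]1/2, +oo[%classic).
  by rewrite -[X in measurable X]setTI; exact: me.
by apply/seteqP; split=> x /=; rewrite in_itv /= andbT.
Qed.

Lemma hdiff_bound g z : `|hdiff g z| <= 2.
Proof.
rewrite /hdiff normrM ysgn_norm mul1r; apply: le_trans (ler_normB _ _) _.
by have := lerD (fstar_norm z.1) (clip_norm (g z.1)).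
Qed.

Lemma bmeas_fdiff g : measurable_fun setT g -> bmeas (fun x => fstar x - clip (g x)).
Proof. by move=> mg; apply: bmeasB; [exact: bmeas_fstar|exact: bmeas_clip]. Qed.

Lemma bmeas_hdiff g : measurable_fun setT g -> bmeas (hdiff g).
Proof.
by move=> mg; apply: bmeasM; [exact: bmeas_ysgn|exact: (bmeas_fst (bmeas_fdiff mg))].
Qed.

Lemma sqr_hdiff_sub f g z :
  (hdiff f z - hdiff g z) ^+ 2 = (clip (f z.1) - clip (g z.1)) ^+ 2.
Proof.
rewrite /hdiff -mulrBr exprMn -[X in X * _]real_normK ?num_real// ysgn_norm expr1n mul1r.
by rewrite -sqrrN; congr (_ ^+ 2); ring.
Qed.

Lemma sqr_hdiff g z : (hdiff g z) ^+ 2 = (fstar z.1 - clip (g z.1)) ^+ 2.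
Proof.
by rewrite /hdiff exprMn -[X in X * _]real_normK ?num_real// ysgn_norm expr1n mul1r.
Qed.

(** On [X] the Bayes classifier is the extreme value of sign [2 * eta - 1], and no clipped value
    lies beyond it, so the two factors never have opposite signs; off [X] both functions vanish. *)
Lemma weight_fdiff g x : supported g ->
  (2 * eta x - 1) * (fstar x - clip (g x)) = `|2 * eta x - 1| * `|fstar x - clip (g x)|.
Proof.
move=> sg; have [Xx|Xx] := pselect (X x); last first.
  by rewrite fstar_out// sg// clip_id ?normr0 ?ler01// subrr normr0 !mulr0.
have /andP[a b] := clip_bound (g x).
have [ex|ex] := ltP (1 / 2) (eta x).
  by rewrite fstar_pos// !ger0_norm; lra.
by rewrite fstar_neg// !ler0_norm; [ring|lra|lra].
Qed.

Lemma excE g : measurable_fun setT g -> supported g ->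
  exc g = Ex P (fun z : pt * bool => `|2 * eta z.1 - 1| * `|fstar z.1 - clip (g z.1)|).
Proof.
move=> mg sg; rewrite /exc /hdiff (Ex_ysgn etaP (bmeas_fdiff mg)).
by congr (Ex P); apply/funext => z; exact: weight_fdiff.
Qed.

Lemma Ex_outside : Ex P (fun z : pt * bool => \1_(~` X) z.1 : R) = 0.
Proof.
have mXT : measurable (X `*` setT : set (pt * bool)) by exact: measurableX.
have -> : (fun z : pt * bool => \1_(~` X) z.1 : R) = \1_(~` (X `*` setT)).
  apply/funext => z; rewrite !indicE; congr ((nat_of_bool _)%:R).
  apply/idP/idP; rewrite !inE /=; first by move=> H [].
  by move=> H Xz; apply: H.
rewrite Ex_indic; last exact: measurableC.
by rewrite probability_setC// PX subee.
Qed.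

Lemma risk_bayes_le g : measurable_fun setT g ->
  (risk P (fun x => clip (g x)) - bayes_risk P <= (exc g)%:E)%E.
Proof.
move=> mg; rewrite (risk_small etaP (measurable_clip mg)); last by move=> x; exact: clip_norm.
have bw := bmeas_fst (bmeas_weight etaP).
have bg := bmeas_fst (bmeas_clip mg).
have bf := bmeas_fst bmeas_fstar.
have bo : bmeas (fun z : pt * bool => \1_(~` X) z.1 : R).
  apply: bmeas_fst; apply: bmeas_indic; exact: measurableC.
apply: le_trans (leeB (lexx _) (bayes_risk_ge etaP)) _.
rewrite -EFinB lee_fin /exc /hdiff (Ex_ysgn etaP (bmeas_fdiff mg)).
have -> : (fun z : pt * bool => (2 * eta z.1 - 1) * (fstar z.1 - clip (g z.1))) =
  (fun z : pt * bool => (2 * eta z.1 - 1) * fstar z.1 - (2 * eta z.1 - 1) * clip (g z.1)).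
  by apply/funext => z; rewrite mulrBr.
rewrite ExB; [|exact: bmeasM|exact: bmeasM].
have : Ex P (fun z : pt * bool => `|2 * eta z.1 - 1|) <=
    Ex P (fun z : pt * bool => (2 * eta z.1 - 1) * fstar z.1 + \1_(~` X) z.1).
  apply: Ex_le; [exact: bmeas_norm|by apply: bmeasD => //; exact: bmeasM|].
  move=> z; have [_ e01 _] := etaP; have /andP[a b] := e01 z.1.
  rewrite indicE; have [Xz|Xz] := pselect (X z.1).
    rewrite memNset; last by move=> /=; apply.
    rewrite addr0; have [ez|ez] := ltP (1 / 2) (eta z.1).
      by rewrite fstar_pos// ger0_norm; lra.
    by rewrite fstar_neg// ler0_norm; lra.
  by rewrite mem_set// fstar_out// mulr0 add0r ler_norml; apply/andP; split => /=; lra.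
by rewrite ExD ?Ex_outside//; [lra|exact: bmeasM].
Qed.

Lemma exc_le2 g : measurable_fun setT g -> exc g <= 2.
Proof.
move=> mg; apply: le_trans (ler_norm _) _; apply: Ex_bound; first exact: bmeas_hdiff.
exact: hdiff_bound.
Qed.

Lemma exc_ge0 g : measurable_fun setT g -> supported g -> 0 <= exc g.
Proof. by move=> mg sg; rewrite excE//; apply: Ex_ge0 => z; rewrite mulr_ge0. Qed.

(** Where [|2 * eta - 1| >= e] the weight in the excess risk is at least [e]; elsewhere the
    difference is at most 2. *)
Lemma Ex_fdiff_le g (e : R) : measurable_fun setT g -> supported g -> 0 < e ->
  Ex P (fun z : pt * bool => `|fstar z.1 - clip (g z.1)|) <=
  e^-1 * exc g + 2 * fine (P [set z : pt * bool | `|2 * eta z.1 - 1| < e]).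
Proof.
move=> mg sg e0; rewrite excE//.
have bw := bmeas_norm (bmeas_fst (bmeas_weight etaP)).
have bd := bmeas_norm (bmeas_fst (bmeas_fdiff mg)).
have mS : measurable [set z : pt * bool | `|2 * eta z.1 - 1| < e].
  rewrite (_ : [set z | _] = (fun z : pt * bool => `|2 * eta z.1 - 1|) @^-1` `]-oo, e[%classic).
    by rewrite -[X in measurable X]setTI; exact: bw.1.
  by apply/seteqP; split=> x /=; rewrite in_itv.
rewrite -Ex_indic// -ExZ; last exact: bmeasM.
rewrite -(ExZ _ 2); last exact: bmeas_indic.
have bi : bmeas (\1_[set z : pt * bool | `|2 * eta z.1 - 1| < e] : pt * bool -> R).
  exact: bmeas_indic.
rewrite -ExD; [|by apply: bmeasZ; exact: bmeasM|exact: bmeasZ].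
apply: Ex_le => //; first by apply: bmeasD; apply: bmeasZ => //; exact: bmeasM.
move=> z; have [H|H] := ltP `|2 * eta z.1 - 1| e.
  rewrite indicE mem_set//= mulr1.
  have : `|fstar z.1 - clip (g z.1)| <= 2.
    by apply: le_trans (ler_normB _ _) _; have := lerD (fstar_norm z.1) (clip_norm (g z.1)).
  move=> /le_trans; apply; rewrite lerDr; pos.
rewrite indicE memNset; last by move=> /=; apply/negP; rewrite -leNgt.
rewrite mulr0 addr0 mulrA ler_peMl// ler_pdivlMl// mulr1 //.
Qed.

Lemma Ex_sqr_hdiff_le g : measurable_fun setT g ->
  Ex P (fun z => hdiff g z ^+ 2) <= 2 * Ex P (fun z : pt * bool => `|fstar z.1 - clip (g z.1)|).
Proof.
move=> mg; have bd := bmeas_norm (bmeas_fst (bmeas_fdiff mg)).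
have bh := bmeas_hdiff mg.
rewrite -ExZ//; apply: Ex_le; [|exact: bmeasZ|].
  by under eq_fun do rewrite expr2; exact: bmeasM.
move=> z; rewrite sqr_hdiff -[leLHS]real_normK ?num_real// expr2 ler_wpM2r//.
by apply: le_trans (ler_normB _ _) _; have := lerD (fstar_norm z.1) (clip_norm (g z.1)).
Qed.

End Excess.

Lemma noise_variance (R : realType) (d : nat) (q : \bar R) (c : R) : (0 <= q)%E -> 1 <= c ->
  exists2 V : R, 1 <= V &
  forall (X : set (d.-tuple R)) (P : probability (d.-tuple R * bool)%type R) eta,
    measurable X -> is_eta P eta -> has_NE P eta q c ->
  forall (g : d.-tuple R -> R) (s : R), measurable_fun setT g -> supported X g -> 0 < s <= 1 -> exc X P eta g <= s ->
  Ex P (fun z : d.-tuple R * bool => `|fstar X eta z.1 - clip (g z.1)|) <=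
    V * s `^ noise_theta q.
Proof.
move=> q0 c1; have c0 : 0 < c by exact: lt_le_trans c1.
case: q q0 => [q|_|//].
  rewrite lee_fin => q0; have q1 : 0 < q + 1 by rewrite ltr_wpDl.
  exists (1 + 2 * c `^ q); first by rewrite lerDl; pos.
  move=> X P eta mX etaP NE g s mg sg /andP[s0 s1] es.
  (* This threshold balances [s / e] against [e^q]: both become [s^(q/(q+1))]. *)
  pose e := s `^ ((q + 1)^-1).
  have e0 : 0 < e by exact: powR_gt0.
  apply: le_trans (Ex_fdiff_le mX etaP mg sg e0) _.
  have N := NE _ e0.
  have Pfin : P [set z : d.-tuple R * bool | `|2 * eta z.1 - 1| < e] \is a fin_num.
    by rewrite ge0_fin_numE// (le_lt_trans N)// ltry.
  rewrite -[X in (X <= _)%E]fineK// lee_fin in N.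
  have E1 : e^-1 * s = s `^ (q / (q + 1)).
    rewrite /e -powRN -[X in _ * X](@powRr1 _ s) ?(ltW s0)// -powRD; last first.
      by rewrite [s == 0]gt_eqF// implybT.
    by congr (_ `^ _); field; rewrite gt_eqF.
  have E2 : (c * e) `^ q = c `^ q * s `^ (q / (q + 1)).
    by rewrite powRM ?(ltW c0) ?(ltW e0)// /e -powRrM [(q + 1)^-1 * q]mulrC.
  rewrite E2 in N.
  have H1 : e^-1 * exc X P eta g <= s `^ (q / (q + 1)).
    by rewrite -E1 ler_wpM2l// invr_ge0 ltW.
  rewrite /=; move: H1 N; move: (s `^ _) (c `^ q) (e^-1 * _) (fine _) => A B D F H1 N.
  have -> : (1 + 2 * B) * A = A + 2 * (B * A) by ring.
  lra.
exists (2 * c); first by lra.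
move=> X P eta mX etaP NE g s mg sg /andP[s0 s1] es.
(* For [q = +oo] a fixed threshold, with [c * e = 1 / 2 < 1], makes the exceptional set null. *)
have e0 : 0 < (2 * c)^-1 by rewrite invr_gt0 mulr_gt0.
apply: le_trans (Ex_fdiff_le mX etaP mg sg e0) _.
rewrite (NE _ e0); last by rewrite invfM mulrCA mulfV ?mulr1 ?gt_eqF// invf_lt1 ?ltr1n.
by rewrite mulr0 addr0 invrK /= powRr1 ?(ltW s0)// ler_wpM2l// mulr_ge0// ltW.
Qed.

(** * Margin noise and the excess risk of near-Bayes functions *)

Section MarginNoise.
Context {R : realType} {d : nat}.
Local Notation pt := (d.-tuple R).
Implicit Types (x y : pt) (f g : pt -> R).

(** The Gaussian factor beats the power, so the terms are dominated by a multiple of [(k + 1)^-2].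
    The bound is uniform in [K], which will depend on the bandwidth. *)
Lemma layer_sum_le (beta : R) : 0 < beta -> exists2 C : R, 0 < C & forall K : nat,
  \sum_(k < K) expR (- (k%:R ^+ 2 / 8)) * k.+1%:R `^ beta <= C.
Proof.
move=> b0; pose a := (beta + 2) / 2; have a0 : 0 < a by rewrite divr_gt0// addr_gt0.
pose C0 : R := expR 1 * (a `^ a * 16 `^ a).
have C00 : 0 < C0 by rewrite /C0; pos.
exists (2 * C0); first by rewrite mulr_gt0.
have term (k : nat) : expR (- (k%:R ^+ 2 / 8)) * k.+1%:R `^ beta <= C0 * (k.+1%:R ^+ 2)^-1.
  have j0 : 0 < k.+1%:R :> R by rewrite ltr0n.
  have H1 : expR (- (k%:R ^+ 2 / 8)) <= expR 1 * expR (- (k.+1%:R ^+ 2 / 16) : R).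
    rewrite -expRD ler_expR -[k.+1%:R]natr1; have := sqr_ge0 (k%:R - 1 : R).
    by move: (k%:R : R) => x; rewrite !expr2; lra.
  have H2 : expR (- (k.+1%:R ^+ 2 / 16)) <= a `^ a * (k.+1%:R ^+ 2 / 16 : R) `^ (- a).
    by apply: expRN_le_powR => //; rewrite divr_gt0// exprn_gt0.
  have H3 : (k.+1%:R ^+ 2 / 16 : R) `^ (- a) = 16 `^ a * k.+1%:R `^ (- (beta + 2)).
    rewrite powRM ?sqr_ge0// powRVN// opprK mulrC; congr (_ * _).
    rewrite -powR_mulrn ?(ltW j0)// -powRrM; congr (_ `^ _).
    by rewrite /a; field.
  have H4 : k.+1%:R `^ (- (beta + 2)) * k.+1%:R `^ beta = (k.+1%:R ^+ 2)^-1 :> R.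
    rewrite -powRD; last by rewrite [k.+1%:R == 0]gt_eqF// implybT.
    have -> : - (beta + 2) + beta = - 2%:R by ring.
    by rewrite powRN powR_mulrn// ltW.
  rewrite H3 in H2.
  apply: le_trans (ler_wpM2r (powR_ge0 _ _) (le_trans H1 (ler_wpM2l (expR_ge0 1) H2))) _.
  by rewrite -H4 /C0 le_eqVlt; apply/orP; left; apply/eqP; ring.
move=> K; apply: (@le_trans _ _ (C0 * (2 * (1 - K.+1%:R^-1)))); last first.
  by rewrite mulrC ler_pM2r// ler_piMr// gerBl.
elim: K => [|K IH]; first by rewrite big_ord0 invr1 subrr !mulr0.
rewrite big_ord_recr /=; apply: le_trans (lerD IH (term K)) _.
rewrite -mulrDr ler_pM2l//.
have k1 : 1 <= K.+1%:R :> R by rewrite ler1n.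
have -> : K.+2%:R = K.+1%:R + 1 :> R by rewrite natr1.
move: k1; move: (K.+1%:R : R) => x x1.
have x0 : 0 < x by exact: lt_le_trans x1.
have x10 : 0 < x + 1 by rewrite addr_gt0.
rewrite -subr_ge0.
have -> : 2 * (1 - (x + 1)^-1) - (2 * (1 - x^-1) + (x ^+ 2)^-1) =
    (x - 1) / (x ^+ 2 * (x + 1)) by field; rewrite !gt_eqF.
by rewrite divr_ge0 ?subr_ge0// mulr_ge0 ?sqr_ge0// ltW.
Qed.

Lemma exp_layer_small (e : R) : 0 < e -> exists K : nat, expR (- (K%:R ^+ 2 / 8)) <= e.
Proof.
move=> e0; pose K := (Num.truncn (8 / e)).+1; exists K.
have K0 : 0 < K%:R :> R by rewrite ltr0n.
have K1 : 1 <= K%:R :> R by rewrite ler1n.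
have H : 8 / e < K%:R by exact: truncnS_gt.
rewrite expRN invf_ple ?posrE ?expR_gt0//.
apply: le_trans (expR_ge1Dx _).
have : K%:R <= K%:R ^+ 2 :> R by rewrite expr2 ler_peMr// ltW.
by move: H; move: (e^-1) (K%:R ^+ 2) => u v; lra.
Qed.

Context (X : set pt) (P : probability (pt * bool)%type R) (eta : pt -> R).
Context (mX : measurable X) (etaP : is_eta P eta).

Lemma measurable_Xpos : measurable (Xpos X eta).
Proof.
have [me _ _] := etaP.
rewrite (_ : Xpos X eta = X `&` eta @^-1` `]1/2, +oo[%classic).
  by apply: measurableI => //; rewrite -[X in measurable X]setTI; exact: me.
by apply/seteqP; split=> x /=; rewrite in_itv /= andbT.
Qed.

Lemma measurable_Xneg : measurable (Xneg X eta).
Proof.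
have [me _ _] := etaP.
rewrite (_ : Xneg X eta = X `&` eta @^-1` `]-oo, 1/2[%classic).
  by apply: measurableI => //; rewrite -[X in measurable X]setTI; exact: me.
by apply/seteqP; split=> x /=; rewrite in_itv.
Qed.

Lemma measurable_Delta (t : R) : 0 < t -> measurable [set x | (Delta X eta x < t%:E)%E].
Proof.
move=> t0; have mp := measurable_Xpos; have mn := measurable_Xneg.
rewrite (_ : [set x | _] = (Xneg X eta `&` [set x | (setdist x (Xpos X eta) < t%:E)%E])
  `|` ((~` Xneg X eta `&` Xpos X eta) `&` [set x | (setdist x (Xneg X eta) < t%:E)%E])
  `|` (~` Xneg X eta `&` ~` Xpos X eta)).
  apply: measurableU; last by apply: measurableI; exact: measurableC.
  apply: measurableU; apply: measurableI => //; try exact: measurable_setdist.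
  by apply: measurableI => //; exact: measurableC.
apply/seteqP; split=> x /=; rewrite /Delta; case: asboolP => Hn; try case: asboolP => Hp.
- by move=> H; left; left.
- by move=> H; left; right.
- by move=> _; right.
- by move=> [[[]//|[[]//]]|[]].
- by move=> [[[]//|[[]//]]|[]].
- by move=> _; rewrite lte_fin.
Qed.

Lemma Delta_weight (beta cM t : R) : has_MNE X P eta beta cM -> 0 < t ->
  Ex P (fun z : pt * bool => \1_[set x | (Delta X eta x < t%:E)%E] z.1 * `|2 * eta z.1 - 1|)
    <= (cM * t) `^ beta.
Proof.
move=> MNE t0.
have bw := bmeas_norm (bmeas_fst (bmeas_weight etaP)).
have bi : bmeas (fun z : pt * bool => \1_[set x | (Delta X eta x < t%:E)%E] z.1 : R).
  by apply: bmeas_fst; apply: bmeas_indic; exact: measurable_Delta.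
rewrite -lee_fin -Ex_fin; last exact: bmeasM.
apply: le_trans (MNE _ t0); rewrite [leRHS]integral_mkcond.
rewrite le_eqVlt; apply/orP; left; apply/eqP; apply: eq_integral => z _.
rewrite patchE indicE; case: ifPn => H.
  by rewrite mem_set ?mul1r//; move: H; rewrite inE.
by rewrite memNset ?mul0r// => Hz; move/negP: H; apply; rewrite inE.
Qed.

(** [D] may be [+oo]: this happens for [Delta] when the other class is empty. *)
Lemma layer_find (h : R) (D : \bar R) (K : nat) : 0 < h -> (0 <= D)%E ->
  ((K%:R * h)%:E <= D)%E \/
  exists2 k : 'I_K, ((k%:R * h)%:E <= D)%E & (D < (k.+1%:R * h)%:E)%E.
Proof.
move=> h0 D0; elim: K => [|K IH]; first by left; rewrite mul0r.
have [H|H] := leP (K.+1%:R * h)%:E D; first by left.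
right; case: IH => [H'|[k Hk Hk']]; first by exists ord_max.
by exists (widen_ord (leqnSn K) k).
Qed.

End MarginNoise.

Lemma setdist_ge0 (R : realType) (d : nat) (x : d.-tuple R) S : (0 <= setdist x S)%E.
Proof. by apply: le_ereal_inf_tmp => _ [s _ <-]; rewrite lee_fin dist2_ge0. Qed.

Lemma Delta_ge0 (R : realType) (d : nat) (X : set (d.-tuple R)) eta x :
  (0 <= Delta X eta x)%E.
Proof. by rewrite /Delta; case: asboolP => _; [|case: asboolP => _ //]; exact: setdist_ge0. Qed.

(** Slice by [Delta] into layers of width [h]: the exponential part of the error on layer [k] is
    [exp (- k^2 / 8)], while the weighted mass of the layer is at most [(cM (k + 1) h)^beta], so the
    sum is a constant times [h^beta]. Points with [eta = 1/2] carry no weight. *)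
Lemma margin_noise_excess (R : realType) (d : nat) (beta cM : R) : 0 < beta -> 1 <= cM ->
  exists2 C : R, 0 < C &
  forall (X : set (d.-tuple R)) (P : probability (d.-tuple R * bool)%type R) eta,
    measurable X -> is_eta P eta -> has_MNE X P eta beta cM ->
  forall (g : d.-tuple R -> R) (h B : R), measurable_fun setT g -> supported X g -> (forall x, `|g x| <= 1) ->
    0 < h -> 0 <= B ->
    (forall x, Xpos X eta x \/ Xneg X eta x -> forall t : R, 0 <= t -> (t%:E <= Delta X eta x)%E ->
      `|fstar X eta x - g x| <= B * (h `^ beta + expR (- (t ^+ 2 / (8 * h ^+ 2))))) ->
    exc X P eta g <= B * (C * h `^ beta).
Proof.
move=> b0 c1; have c0 : 0 < cM by exact: lt_le_trans c1.
have [S S0 HS] := layer_sum_le b0.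
exists (2 + S * cM `^ beta); first by rewrite addr_gt0// mulr_gt0// powR_gt0.
move=> X P eta mX etaP MNE g h B mg sg g1 h0 B0 close.
have hb0 : 0 < h `^ beta by exact: powR_gt0.
have [K HK] := exp_layer_small hb0.
have bw := bmeas_norm (bmeas_fst (bmeas_weight etaP)).
pose wt (k : nat) (z : d.-tuple R * bool) : R :=
  \1_[set x | (Delta X eta x < (k.+1%:R * h)%:E)%E] z.1 * `|2 * eta z.1 - 1|.
have kh0 k : 0 < k.+1%:R * h by rewrite mulr_gt0// ltr0n.
have bwt k : bmeas (wt k).
  apply: bmeasM => //; apply: bmeas_fst; apply: bmeas_indic.
  exact: (measurable_Delta mX etaP (kh0 k)).
(* One [h^beta] is the uniform part of the assumed error, the other bounds the exponential beyond
   the last layer. *)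
pose F (z : d.-tuple R * bool) : R :=
  B * ((h `^ beta + h `^ beta) + \sum_(k < K) expR (- (k%:R ^+ 2 / 8)) * wt k z).
have bF1 : bmeas (fun z => \sum_(k < K) expR (- (k%:R ^+ 2 / 8)) * wt k z).
  by apply: bmeas_sum => k; exact: bmeasZ.
have bF2 : bmeas (fun z => (h `^ beta + h `^ beta) + \sum_(k < K) expR (- (k%:R ^+ 2 / 8)) * wt k z).
  by apply: bmeasD => //; exact: bmeas_cst.
have bd := bmeas_norm (bmeas_fst (bmeas_fdiff mX etaP mg)).
rewrite (excE mX etaP mg sg).
apply: (@le_trans _ _ (Ex P F)).
  apply: Ex_le; [exact: bmeasM|exact: bmeasZ|].
  move=> z; rewrite clip_id//.
  have wt0 k : 0 <= wt k z by rewrite mulr_ge0// indicE.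
  have sum0 : 0 <= \sum_(k < K) expR (- (k%:R ^+ 2 / 8)) * wt k z.
    by apply: sumr_ge0 => k _; rewrite mulr_ge0// expR_ge0.
  have [pn|npn] := pselect (Xpos X eta z.1 \/ Xneg X eta z.1); last first.
    have -> : `|2 * eta z.1 - 1| * `|fstar X eta z.1 - g z.1| = 0.
      have [Xz|Xz] := pselect (X z.1); last first.
        by rewrite fstar_out// sg// subrr normr0 mulr0.
      have -> : eta z.1 = 1 / 2.
        apply/eqP; rewrite eq_le !leNgt; apply/andP; split; apply/negP => H; apply: npn.
          by left.
        by right.
      by rewrite mulrA mulr1 divff// subrr normr0 mul0r.
    by rewrite mulr_ge0// addr_ge0// addr_ge0// ltW.
  have w1 : `|2 * eta z.1 - 1| <= 1.
    have [_ e01 _] := etaP; have /andP[a b] := e01 z.1.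
    by rewrite ler_norml; apply/andP; split; lra.
  have ex_t (k : nat) : - ((k%:R * h) ^+ 2 / (8 * h ^+ 2)) = - (k%:R ^+ 2 / 8).
    by field; rewrite gt_eqF.
  have [H|[k Hk Hk']] := layer_find K h0 (Delta_ge0 X eta z.1).
    have Kh0 : 0 <= K%:R * h by rewrite mulr_ge0// ltW.
    have := close z.1 pn _ Kh0 H; rewrite ex_t => cl.
    apply: (@le_trans _ _ (1 * (B * (h `^ beta + expR (- (K%:R ^+ 2 / 8)))))).
      exact: ler_pM.
    rewrite mul1r ler_wpM2l// -addrA lerD2l.
    by apply: le_trans HK _; rewrite lerDl.
  have Kh0 : 0 <= k%:R * h by rewrite mulr_ge0// ltW.
  have := close z.1 pn _ Kh0 Hk; rewrite ex_t => cl.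
  have wk : wt k z = `|2 * eta z.1 - 1| by rewrite /wt indicE mem_set// mul1r.
  apply: le_trans (ler_wpM2l _ cl) _ => //.
  rewrite mulrCA ler_wpM2l// mulrDr; apply: lerD.
    by apply: (@le_trans _ _ (1 * h `^ beta)); [rewrite ler_wpM2r// ltW|rewrite mul1r lerDl ltW].
  rewrite (bigD1 k)//= wk mulrC lerDl.
  by apply: sumr_ge0 => i _; rewrite mulr_ge0// expR_ge0.
rewrite /F ExZ// ler_wpM2l// ExD//; last exact: bmeas_cst.
rewrite Ex_cst Ex_sum; last by move=> k; exact: bmeasZ.
rewrite mulrDl; apply: lerD; first by rewrite mulrDl mul1r.
apply: (@le_trans _ _ (\sum_(k < K) cM `^ beta * h `^ beta *
   (expR (- (k%:R ^+ 2 / 8)) * k.+1%:R `^ beta))).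
  apply: ler_sum => k _; rewrite ExZ//.
  apply: le_trans (ler_wpM2l (expR_ge0 _) (Delta_weight mX etaP MNE (kh0 k))) _.
  rewrite powRM ?(ltW c0) ?(ltW (kh0 k))// powRM ?(ltW h0)//.
  by rewrite le_eqVlt; apply/orP; left; apply/eqP; ring.
rewrite -big_distrr /= -[leRHS]mulrA [leRHS]mulrC.
by apply: ler_wpM2l; [pos|exact: HS].
Qed.

(** * Chaining *)

Lemma arith_geo_sum_le (R : realType) (w : R) : 0 <= w < 1 ->
  exists2 C : R, 0 < C & forall K : nat, \sum_(k < K) (k%:R + 7) * w ^+ k <= C.
Proof.
move=> /andP[w0 w1]; have w1' : 0 < 1 - w by rewrite subr_gt0.
(* The tail of the series from index [k] on, in closed form; the partial sums telescope. *)
pose B (k : nat) : R := w ^+ k * ((k%:R + 7) / (1 - w) + w / (1 - w) ^+ 2).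
have B0 k : 0 <= B k by rewrite /B; pos.
exists (B 0%N + 1); first by rewrite ltr_wpDl.
suff H K : \sum_(k < K) (k%:R + 7) * w ^+ k = B 0%N - B K.
  by move=> K; rewrite H; have := B0 K; lra.
elim: K => [|K IH]; first by rewrite big_ord0 subrr.
rewrite big_ord_recr /= IH /B [w ^+ K.+1]exprS -[K.+1%:R]natr1; field.
by rewrite gt_eqF.
Qed.

Section Chain.
Context {R : realType} {dT dO : measure_display}.
Context {T : measurableType dT} {Om : measurableType dO}.
Context (P : probability T R) (Q : probability Om R) (n : nat) (Z : 'I_n -> Om -> T).
Context (mZ : forall i, measurable_fun setT (Z i)).
Context (ZP : forall i (B : set T), measurable B -> Q (Z i @^-1` B) = P B).
Context (Zind : forall B : 'I_n -> set T, (forall i, measurable (B i)) ->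
  Q (\bigcap_(i in [set: 'I_n]) (Z i @^-1` B i)) =
  (\prod_(i < n) Q (Z i @^-1` B i))%E).
Context (n0 : (0 < n)%N).

Local Notation sqdist f g := (Ex P (fun x => (f x - g x) ^+ 2)).

Lemma sqdist_triangle (f g h : T -> R) : bmeas f -> bmeas g -> bmeas h ->
  sqdist f g <= 2 * sqdist h f + 2 * sqdist h g.
Proof.
move=> bf bg bh.
have b2 (u v : T -> R) : bmeas u -> bmeas v -> bmeas (fun x => (u x - v x) ^+ 2).
  by move=> bu bv; under eq_fun do rewrite expr2; apply: bmeasM; exact: bmeasB.
rewrite -!ExZ; [|exact: b2..].
rewrite -ExD; [|by apply: bmeasZ; exact: b2..].
apply: Ex_le; [exact: b2|by apply: bmeasD; apply: bmeasZ; exact: b2|].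
move=> x; have := sqr_ge0 (f x + g x - 2 * h x).
by rewrite !expr2; nra.
Qed.

(** [RI] and [RJ] say which net points represent [f]. Two representatives of the same [f] are close
    to each other through [f], so Bernstein over all pairs controls the passage from one net to the
    next, and only net points are evaluated on the sample. *)
Lemma chain_step (FF : set (T -> R)) (I J : finType) (F : I -> T -> R) (G : J -> T -> R)
    (RI : (T -> R) -> I -> Prop) (RJ : (T -> R) -> J -> Prop)
    (E : set Om) (B b v t : R) :
  (forall f, FF f -> bmeas f) ->
  (forall i, bmeas (F i)) -> (forall j, bmeas (G j)) ->
  (forall i x, `|F i x| <= b) -> (forall j x, `|G j x| <= b) ->
  0 < b -> 0 <= v -> 0 <= t ->
  (forall f i j, FF f -> RI f i -> RJ f j -> 2 * sqdist f (F i) + 2 * sqdist f (G j) <= v) ->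
  (forall f, FF f -> exists j, RJ f j) ->
  measurable E ->
  (forall w, E w -> forall f, FF f -> exists2 i, RI f i & Ex P (F i) - emp Z (F i) w <= B) ->
  exists2 E', measurable E' &
    (Q (~` E') <= (fine (Q (~` E)) + #|I|%:R * #|J|%:R * expR (- t))%:E)%E /\
    forall w, E' w -> forall f, FF f -> exists2 j, RJ f j &
      Ex P (G j) - emp Z (G j) w <= B + dev n (2 * b) v t.
Proof.
move=> bFF bF bG Fb Gb b0 v0 t0 Hv HJ mE HE.
pose phi (ij : I * J) x := G ij.2 x - F ij.1 x.
have bphi ij : bmeas (phi ij) by exact: bmeasB.
have phib ij x : `|phi ij x| <= 2 * b.
  by apply: le_trans (ler_normB _ _) _; rewrite mulr_natl mulr2n; apply: lerD.
have b20 : 0 < 2 * b by rewrite mulr_gt0.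
have [E1 mE1 [QE1 HE1]] := bernstein_family mZ ZP Zind n0 b20 v0 t0 bphi phib.
exists (E `&` E1); first exact: measurableI.
split.
  rewrite setCI.
  have mC : measurable (~` E) by exact: measurableC.
  have mC1 : measurable (~` E1) by exact: measurableC.
  apply: le_trans (measureU2 Q mC mC1) _.
  rewrite EFinD fineK; last exact: fin_num_measure.
  by apply: leeD => //; apply: le_trans QE1 _; rewrite card_prod natrM.
move=> w [Ew E1w] f Ff.
have [i Ri Hi] := HE w Ew f Ff.
have [j Rj] := HJ f Ff.
exists j => //.
have Hij : Ex P (fun x => phi (i, j) x ^+ 2) <= v.
  apply: le_trans (Hv f i j Ff Ri Rj).
  rewrite addrC; apply: sqdist_triangle => //; exact: bFF.
have := HE1 w E1w (i, j) Hij.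
rewrite /phi /= ExB// /emp.
under eq_bigr do rewrite /=.
rewrite sumrB mulrBr => H.
move: Hi; rewrite /emp => Hi; lra.
Qed.

Context (FF : set (T -> R)) (bFF : forall f, FF f -> bmeas f).

Lemma two_step_lin (x y z : R) : 0 <= z -> x <= z -> y <= 4 * z -> 2 * x + 2 * y <= 10 * z.
Proof. by lra. Qed.

(** The exponents of [s] in the hypotheses make [D k * t k / n] at most [V (k + 7) w^(2k) s^2 / A],
    where [w < 1] because [p < 1]. The square roots then sum to a multiple of [s / sqrt A]; the
    linear Bernstein term is as small because no level falls below [s / 4]. The last link leads to
    the prescribed net [G], whose relation [RJ] may carry more than L2 closeness. *)
Lemma chain_deviation (p V C0 th s A N tau : R) : 0 < p < 1 -> 1 <= V ->
   (forall K : nat, \sum_(k < K) (k%:R + 7) * (4 `^ (- ((1 - p) / 2))) ^+ k <= C0) ->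
   0 <= th <= 1 -> 0 < s <= 1 -> 1 <= A ->
   0 <= N -> 1 <= tau ->
   N / n%:R <= A^-1 * s `^ (2 - th - p * (1 - th)) ->
   tau / n%:R <= A^-1 * s `^ (2 - th) ->
   (forall f, FF f -> Ex P (fun x => f x ^+ 2) <= V * s `^ th) ->
   (forall D : R, 0 < D -> exists (I : finType) (F : I -> T -> R),
     [/\ forall i, bmeas (F i), forall i x, `|F i x| <= 2, #|I|%:R <= expR (N * (s / D) `^ p) &
      forall f, FF f -> exists i, sqdist f (F i) <= D]) ->
   forall (J : finType) (G : J -> T -> R) (RJ : (T -> R) -> J -> Prop),
    (forall j, bmeas (G j)) -> (forall j x, `|G j x| <= 2) -> #|J|%:R <= expR N ->
    (forall f, FF f -> exists j, RJ f j) ->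
    (forall f j, FF f -> RJ f j -> sqdist f (G j) <= s) ->
   exists2 E, measurable E & (Q (~` E) <= (expR (- tau))%:E)%E /\
    forall w, E w -> forall f, FF f -> exists2 j, RJ f j &
      Ex P (G j) - emp Z (G j) w <= 3 * (10 * V + 16 * V) * C0 * (Num.sqrt A^-1 * s).
Proof.
move=> /andP[p0 p1] V1 HC0 /andP[th0 th1] /andP[s0 s1] A1 N0 tau1 HN Htau HV HD J G RJ bG Gb Jc HJ RJs.
have V0 : 0 < V by exact: lt_le_trans V1.
pose w := 4 `^ (- ((1 - p) / 2)) : R.
have w01 : 0 <= w < 1.
  rewrite powR_ge0/= /w powRN invf_lt1 ?powR_gt0//.
  have := @gt0_ltr_powR R ((1 - p) / 2) _ 1 4.
  by rewrite powR1; apply; rewrite ?nnegrE// ?divr_gt0 ?subr_gt0// ltr1n.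
have w2 : w ^+ 2 = 4 `^ (- (1 - p)).
  by rewrite /w -powR_mulrn ?powR_ge0// -powRrM; congr (_ `^ _); field.
have A0 : 0 < A by exact: lt_le_trans A1.
have n0' : 0 < n%:R :> R by rewrite ltr0n.
pose D (k : nat) : R := V * s `^ th / 4 ^+ k.
have D0 k : 0 < D k by rewrite divr_gt0 ?exprn_gt0// mulr_gt0// powR_gt0.
have DS k : D k.+1 = D k / 4 by rewrite /D exprS; field; rewrite gt_eqF// exprn_gt0.
have sth : s <= s `^ th.
  by rewrite -[leLHS](powRr1 (ltW s0)); apply: ger_powR; rewrite ?s0.
(* The first summand pays for the pairs of consecutive net points, the second makes the failure
   probabilities summable; the levels stop at the first [K] with [D K <= s]. *)
pose t (k : nat) : R := 5 * (N * (s / D k) `^ p) + (k.+2)%:R * tau.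
have t0 k : 0 <= t k.
  by rewrite addr_ge0// ?mulr_ge0// ?powR_ge0//; lra.
pose dv k := dev n (2 * 2) (10 * D k) (t k).
(* The 7 is the 5 of the entropy term plus the 2 of [k.+2]. [10 * V] bounds the square root in
   [dev], and [16 * V] is the bound 4 on the links times the estimate [4 * V] of the linear term. *)
pose eb k : R := 3 * (10 * V + 16 * V) * ((k%:R + 7) * w ^+ k) * (Num.sqrt A^-1 * s).
have two0 : 0 < 2 :> R by [].
have sA0 : 0 <= Num.sqrt A^-1 by exact: sqrtr_ge0.
have sA1 : Num.sqrt A^-1 <= 1.
  by rewrite -[leRHS]sqrtr1; apply: ler_wsqrtr; rewrite invf_le1.
have sA2 : Num.sqrt A^-1 ^+ 2 = A^-1 by rewrite sqr_sqrtr// invr_ge0 ltW.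
have k7 k : 1 <= k%:R + 7 :> R by have := ler0n R k; lra.
have dvle k : s / 4 <= D k -> dv k <= eb k.
  move=> sD.
  have wk0 : 0 <= w ^+ k by rewrite exprn_ge0//; case/andP: w01.
  have wk1 : w ^+ k <= 1 by rewrite exprn_ile1//; case/andP: w01 => // _ /ltW.
  pose X : R := V * ((k%:R + 7) * (w ^+ k) ^+ 2) * (A^-1 * s ^+ 2).
  have E4 : (w ^+ k) ^+ 2 = (4 ^+ k) `^ (- (1 - p)).
    by rewrite -exprM mulnC exprM w2 -powR_mulrn ?powR_ge0// powRAC powR_mulrn// ltW.
  have DtX : D k * t k / n%:R <= X.
    have -> : D k * t k / n%:R = 5 * (N / n%:R * (D k * (s / D k) `^ p)) +
        D k * k.+2%:R * (tau / n%:R) by rewrite /t; field; rewrite gt_eqF.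
    have e1 : D k * (s / D k) `^ p = s `^ p * D k `^ (1 - p).
      rewrite powRM ?(ltW s0) ?invr_ge0 ?(ltW (D0 k))// mulrCA; congr (_ * _).
      rewrite powRB; last by rewrite [D k == 0]gt_eqF ?implybT.
      by rewrite powRr1 ?(ltW (D0 k))// -powR_inv1 ?(ltW (D0 k))// -powRrM mulN1r powRN.
    have e2 : D k `^ (1 - p) <= V * (s `^ (th * (1 - p)) * (w ^+ k) ^+ 2).
      rewrite /D -mulrA powRM ?(ltW V0)//; last by pos.
      rewrite [(s `^ th / _) `^ _]powRM ?powR_ge0//.
      rewrite -powRrM E4; apply: ler_pM; rewrite ?powR_ge0//; first by pos.
        by rewrite -[leRHS](powRr1 (ltW V0)); apply: ler_powR => //; lra.
      by rewrite -[(4 ^+ k)^-1]powR_inv1 ?exprn_ge0// -powRrM mulN1r.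
    have e3 : s `^ (2 - th - p * (1 - th)) * (s `^ p * s `^ (th * (1 - p))) = s ^+ 2.
      have sn : s != 0 by rewrite gt_eqF.
      rewrite -!powRD ?sn ?implybT// -powR_mulrn ?(ltW s0)//; congr (_ `^ _); ring.
    have e4 : s `^ (2 - th) * s `^ th = s ^+ 2.
      have sn : s != 0 by rewrite gt_eqF.
      by rewrite -!powRD ?sn ?implybT// -powR_mulrn ?(ltW s0)//; congr (_ `^ _); ring.
    have f1 : N / n%:R * (D k * (s / D k) `^ p) <= V * (w ^+ k) ^+ 2 * (A^-1 * s ^+ 2).
      rewrite e1; apply: (@le_trans _ _ (A^-1 * s `^ (2 - th - p * (1 - th)) *
         (s `^ p * (V * (s `^ (th * (1 - p)) * (w ^+ k) ^+ 2))))).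
        apply: ler_pM => //; [by pos|by pos|].
        by apply: ler_wpM2l => //; exact: powR_ge0.
      by rewrite -e3 le_eqVlt; apply/orP; left; apply/eqP; ring.
    have f2 : D k * k.+2%:R * (tau / n%:R) <= V * (k.+2%:R * (w ^+ k) ^+ 2) * (A^-1 * s ^+ 2).
      apply: (@le_trans _ _ (D k * k.+2%:R * (A^-1 * s `^ (2 - th)))).
        by rewrite ler_wpM2l// mulr_ge0// ltW.
      have g1 : (4 ^+ k)^-1 <= (w ^+ k) ^+ 2.
        rewrite E4 -[leLHS]powR_inv1 ?exprn_ge0//; apply: ler_powR; last by lra.
        by rewrite exprn_ege1// ler1n.
      apply: (@le_trans _ _ (V * (k.+2%:R * (4 ^+ k)^-1) * (A^-1 * s ^+ 2))).
        by rewrite -e4 /D le_eqVlt; apply/orP; left; apply/eqP; ring.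
      apply: ler_wpM2r; first by pos.
      by apply: ler_wpM2l; [exact: ltW|apply: ler_wpM2l].
    apply: le_trans (lerD (ler_wpM2l _ f1) f2) _ => //.
    by rewrite /X -[k.+2%:R]natr1 -[k.+1%:R]natr1 le_eqVlt; apply/orP; left; apply/eqP; ring.
  have X0 : 0 <= X.
    by rewrite /X; have := k7 k => ?; pos.
  have tn : t k / n%:R <= 4 * (X / s).
    have Xs : 0 <= X / s by pos.
    rewrite -(ler_pM2l (D0 k)); apply: (@le_trans _ _ X); first by rewrite mulrA.
    apply: (@le_trans _ _ (s / 4 * (4 * (X / s)))).
      by rewrite le_eqVlt; apply/orP; left; apply/eqP; field; rewrite gt_eqF.
    by apply: ler_wpM2r => //; pos.
  have XE : X / s = V * ((k%:R + 7) * (w ^+ k) ^+ 2) * (A^-1 * s).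
    by rewrite /X; field; rewrite !gt_eqF.
  have sq : Num.sqrt (10 * D k * t k / n%:R) <= 10 * V * ((k%:R + 7) * w ^+ k) * (Num.sqrt A^-1 * s).
    apply: (@le_trans _ _ (Num.sqrt ((10 * V * ((k%:R + 7) * w ^+ k) * (Num.sqrt A^-1 * s)) ^+ 2))).
      apply: ler_wsqrtr; have -> : 10 * D k * t k / n%:R = 10 * (D k * t k / n%:R) by ring.
      apply: (@le_trans _ _ (10 * X)); first by rewrite ler_wpM2l.
      have -> : (10 * V * ((k%:R + 7) * w ^+ k) * (Num.sqrt A^-1 * s)) ^+ 2 =
         10 * X * (10 * V * (k%:R + 7)).
        by rewrite /X; move: (w ^+ k) sA2 => W; move: (A^-1) (Num.sqrt A^-1) => v u <-; ring.
      rewrite ler_peMr//; first by pos.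
      by have := k7 k => ?; rewrite !mulr_ege1//; lra.
    rewrite sqrtr_sqr ger0_norm//; have k70 : 0 <= k%:R + 7 :> R by have := k7 k; lra.
    by pos.
  have lin : t k / n%:R <= 4 * V * ((k%:R + 7) * w ^+ k) * (Num.sqrt A^-1 * s).
    apply: le_trans tn _; rewrite XE.
    have -> : 4 * (V * ((k%:R + 7) * w ^+ k ^+ 2) * (A^-1 * s)) =
      4 * V * ((k%:R + 7) * w ^+ k) * (Num.sqrt A^-1 * s) * (w ^+ k * Num.sqrt A^-1).
      by move: (w ^+ k) sA2 => W; move: (A^-1) (Num.sqrt A^-1) => v u <-; ring.
    have k70 : 0 <= k%:R + 7 :> R by have := k7 k; lra.
    rewrite ler_piMr//; first by pos.
    by rewrite mulr_ile1.
  rewrite /dv /eb /dev -[2 * 2 * _ / _]mulrA.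
  move: sq lin; set Y := (k%:R + 7) * w ^+ k; move: (Num.sqrt A^-1 * s) (Num.sqrt (_ / n%:R)) (t k / n%:R).
  move=> a b c sq lin.
  have -> : 3 * (10 * V + 16 * V) * Y * a = 3 * (10 * V * Y * a + 4 * (4 * V * Y * a)) by ring.
  by move: sq lin; move: (10 * V * Y * a) (4 * V * Y * a) => u v sq lin; lra.
have Nstep k : N * (s / D k.+1) `^ p <= 4 * (N * (s / D k) `^ p).
  rewrite mulrCA; apply: ler_wpM2l => //.
  have -> : s / D k.+1 = 4 * (s / D k) by rewrite DS; field; rewrite gt_eqF.
  rewrite powRM//; last by rewrite divr_ge0 ?ltW.
  apply: ler_wpM2r; first exact: powR_ge0.
  by rewrite -[leRHS](powRr1 (ler0n _ 4)); apply: ler_powR; [rewrite ler1n|exact: ltW].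
(* The two nets contribute [1 + 4 = 5] times the entropy, which [t k] cancels; what is left is
   [expR (- tau)] times further factors [expR (- tau) <= 1 / 2]. *)
have cstep k (c1 c2 : R) : 0 <= c1 -> 0 <= c2 -> c1 <= expR (N * (s / D k) `^ p) ->
    c2 <= expR (4 * (N * (s / D k) `^ p)) ->
    c1 * c2 * expR (- t k) <= expR (- tau) * 2^-1 ^+ k.+1.
  move=> c10 c20 h1 h2.
  apply: (@le_trans _ _ (expR (N * (s / D k) `^ p) * expR (4 * (N * (s / D k) `^ p)) * expR (- t k))).
    by apply: ler_wpM2r; [exact: expR_ge0|exact: ler_pM].
  rewrite -!expRD.
  have -> : N * (s / D k) `^ p + 4 * (N * (s / D k) `^ p) - t k = - tau + k.+1%:R * - tau.
    by rewrite /t -[k.+2%:R]natr1; ring.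
  rewrite expRD ler_pM2l ?expR_gt0// expRM_natl.
  apply: lerXn2r; rewrite ?nnegrE ?expR_ge0// expRN lef_pV2 ?posrE ?expR_gt0//.
  by apply: le_trans (expR_ge1Dx _); lra.
have chain : forall k : nat, (forall i, (i < k)%N -> s / 4 <= D i) ->
  exists (I : finType) (F : I -> T -> R) (E : set Om),
   [/\ (forall i, bmeas (F i)), (forall i x, `|F i x| <= 2), #|I|%:R <= expR (N * (s / D k) `^ p),
    measurable E & (fine (Q (~` E)) <= expR (- tau) * (1 - 2^-1 ^+ k)) /\
    forall om, E om -> forall f, FF f -> exists2 i, sqdist f (F i) <= D k &
      Ex P (F i) - emp Z (F i) om <= \sum_(i < k) eb i].
  elim=> [_|k IH Hk].
    (* The first net is the zero function alone: the second moment bound makes it a net at level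
       [D 0], and its deviation is 0. *)
    exists unit, (fun _ _ => 0), setT; split => //.
    - by move=> _; exact: bmeas_cst.
    - by move=> _ x; rewrite normr0.
    - rewrite card_unit; apply: le_trans (expR_ge1Dx _); rewrite lerDl.
      by rewrite mulr_ge0// powR_ge0.
    split; first by rewrite setCT measure0 expr0 subrr mulr0.
    move=> om _ f Ff; exists tt.
      under eq_fun do rewrite subr0.
      by rewrite /D expr0 divr1; exact: HV.
    by rewrite big_ord0 Ex_cst /emp big1// mulr0 subrr.
  have [|I [F [E [bF Fb cI mE [QE HE]]]]] := IH; first by move=> i ik; apply: Hk; exact: ltnW.
  have [I' [F' [bF' Fb' cI' HF']]] := HD _ (D0 k.+1).
  have Hv f i j : FF f -> sqdist f (F i) <= D k -> sqdist f (F' j) <= D k.+1 ->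
      2 * sqdist f (F i) + 2 * sqdist f (F' j) <= 10 * D k.
    move=> Ff h1 h2; apply: two_step_lin => //; first exact: ltW.
    apply: le_trans h2 _; rewrite DS mulrC ler_pM2r// (@le_trans _ _ 1) ?invf_le1 ?ler1n//.
  have v0 : 0 <= 10 * D k by pos.
  have [E' mE' [QE' HE']] := chain_step bFF bF bF' Fb Fb' two0 v0 (t0 k) Hv HF' mE HE.
  exists I', F', E'; split => //; split.
    rewrite -lee_fin fineK; last by apply: fin_num_measure; exact: measurableC.
    apply: le_trans QE' _; rewrite lee_fin.
    have cI'' : #|I'|%:R <= expR (4 * (N * (s / D k) `^ p)).
      by apply: le_trans cI' _; rewrite ler_expR; exact: Nstep.
    apply: le_trans (lerD QE (cstep k _ _ _ _ cI cI'')) _; rewrite ?ler0n//.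
    rewrite -mulrDr ler_pM2l ?expR_gt0// exprS.
    by move: (2^-1 ^+ k) => u; lra.
  move=> om E'om f Ff; have [j Rj Hj] := HE' om E'om f Ff; exists j => //.
  rewrite big_ord_recr /=; apply: le_trans Hj _; rewrite lerD2l; apply: dvle.
  exact: Hk.
have /ex_minnP[K HK Kmin] : exists k, D k <= s.
  exists (Num.truncn (V * s `^ th / s)).+1; rewrite /D ler_pdivrMr ?exprn_gt0//.
  rewrite [leRHS]mulrC -ler_pdivrMr//.
  apply: (@le_trans _ _ (Num.truncn (V * s `^ th / s)).+1%:R); first by rewrite ltW// truncnS_gt.
  by rewrite -natrX ler_nat ltnW// ltn_expl.
have Dlt i : (i < K)%N -> s < D i.
  by move=> iK; rewrite ltNge; apply/negP => /Kmin; rewrite leqNgt iK.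
(* By minimality the level before [K] exceeds [s]; if [K = 0], then [D 0 >= s] because [V >= 1] and
   [s <= 1]. *)
have sK : s / 4 <= D K.
  case: K HK Kmin Dlt => [|K] HK Kmin Dlt.
    rewrite /D expr0 divr1; apply: (@le_trans _ _ s); first by lra.
    by apply: le_trans sth _; rewrite ler_peMl// powR_ge0.
  by rewrite DS ler_pM2r// ltW// Dlt.
have sI i : (i < K)%N -> s / 4 <= D i by move=> /Dlt; lra.
have [I [F [E [bF Fb cI mE [QE HE]]]]] := chain K sI.
have Hv f i j : FF f -> sqdist f (F i) <= D K -> RJ f j ->
    2 * sqdist f (F i) + 2 * sqdist f (G j) <= 10 * D K.
  move=> Ff h1 h2; apply: two_step_lin => //; first exact: ltW.
  by apply: le_trans (RJs f j Ff h2) _; rewrite mulrC -ler_pdivrMr.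
have v0 : 0 <= 10 * D K by pos.
have [E' mE' [QE' HE']] := chain_step bFF bF bG Fb Gb two0 v0 (t0 K) Hv HJ mE HE.
exists E' => //; split.
  apply: le_trans QE' _; rewrite lee_fin.
  have cJ : #|J|%:R <= expR (4 * (N * (s / D K) `^ p)).
    apply: le_trans Jc _; rewrite ler_expR.
    have H1 : 1 <= (s / D K) `^ p.
      rewrite -(powRr0 (s / D K)); apply: ler_powR; last exact: ltW.
      by rewrite ler_pdivlMr// mul1r.
    have := ler_wpM2l N0 H1; rewrite mulr1; lra.
  apply: le_trans (lerD QE (cstep K _ _ _ _ cI cJ)) _; rewrite ?ler0n//.
  rewrite -mulrDr -[leRHS]mulr1 ler_pM2l ?expR_gt0// exprS.
  have : 0 <= 2^-1 ^+ K :> R by rewrite exprn_ge0// invr_ge0.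
  by move: (2^-1 ^+ K) => u; lra.
move=> om E'om f Ff; have [j Rj Hj] := HE' om E'om f Ff; exists j => //.
apply: le_trans Hj _; apply: (@le_trans _ _ (\sum_(i < K.+1) eb i)).
  by rewrite big_ord_recr /= lerD2l; exact: dvle.
rewrite /eb -big_distrl -big_distrr /=.
apply: ler_wpM2r; first by pos.
by apply: ler_wpM2l; [pos|exact: HC0].
Qed.
End Chain.

(** * Nets for piecewise functions *)

Section Patchwork.
Context {R : realType} {d m : nat}.
Local Notation pt := (d.-tuple R).
Context (A : 'I_m -> set pt).
Context (mA : forall j, measurable (A j)).
Context (Adisj : forall i j, i != j -> A i `&` A j = set0).
Implicit Types (g h : 'I_m -> pt -> R) (c : 'I_m -> R) (x : pt).

Definition patchwork g x : R := \sum_(j < m) \1_(A j) x * g j x.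

Lemma patchwork_in g j x : A j x -> patchwork g x = g j x.
Proof.
move=> Ax; rewrite /patchwork (bigD1 j)//= big1 ?addr0 => [|i ij].
  by rewrite indicE mem_set// mul1r.
rewrite indicE memNset ?mul0r// => Aix.
by have := Adisj ij; rewrite -subset0 => /(_ x); apply.
Qed.

Lemma patchwork_out g x : (forall j, ~ A j x) -> patchwork g x = 0.
Proof. by move=> Ax; rewrite /patchwork big1// => j _; rewrite indicE memNset// mul0r. Qed.

Lemma patchwork_ind (Q : R -> Prop) g x : (forall j, A j x -> Q (g j x)) -> Q 0 -> Q (patchwork g x).
Proof.
move=> H H0; have [[j Aj]|N] := pselect (exists j, A j x); first by rewrite (patchwork_in _ Aj); exact: H.
by rewrite patchwork_out// => j Aj; apply: N; exists j.
Qed.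

Lemma measurable_patchwork g : (forall j, measurable_fun setT (g j)) -> measurable_fun setT (patchwork g).
Proof.
by move=> mg; apply: measurable_sum => j; apply: measurable_funM => //; exact: measurable_indic.
Qed.

Lemma bmeas_patchwork c : bmeas (patchwork (fun j _ => c j)).
Proof.
apply: bmeas_sum => j; apply: bmeasM; [exact: bmeas_indic|exact: bmeas_cst].
Qed.

Context (P : probability (pt * bool)%type R).

Lemma Ex_patchwork_cst c :
  Ex P (fun z : pt * bool => patchwork (fun j _ => c j) z.1) =
  \sum_(j < m) c j * fine (P (A j `*` setT)).
Proof.
rewrite /patchwork Ex_sum => [|j]; last first.
  by apply: bmeasM; [exact: (bmeas_fst (bmeas_indic (mA j)))|exact: bmeas_cst].
apply: eq_bigr => j _.
have -> : (fun z : pt * bool => \1_(A j) z.1 * c j) = (fun z => c j * \1_(A j `*` setT) z).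
  apply/funext => z; rewrite mulrC; congr (_ * _); rewrite !indicE; congr (nat_of_bool _)%:R.
  by apply/idP/idP; rewrite !inE /=; [|move=> []].
have mAT : measurable (A j `*` setT : set (pt * bool)) by exact: measurableX.
by rewrite ExZ ?Ex_indic//; exact: bmeas_indic.
Qed.

(** The minimum with 2 keeps the comparison function bounded, however coarse the net is on a piece
    of small mass. *)
Lemma patchwork_clip_close g h c x : (forall j, A j x -> `|g j x - h j x| <= c j) ->
  `|clip (patchwork g x) - clip (patchwork h x)| <= patchwork (fun j _ => Num.min 2 (c j)) x.
Proof.
move=> gh; have [[j Aj]|N] := pselect (exists j, A j x); last first.
  have Nj j : ~ A j x by move=> Aj; apply: N; exists j.
  by rewrite !patchwork_out// subrr normr0.
rewrite !(patchwork_in _ Aj) le_min; apply/andP; split; last first.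
  by apply: le_trans (gh j Aj); exact: clip_lip.
apply: le_trans (ler_normB _ _) _.
by have := lerD (clip_norm (g j x)) (clip_norm (h j x)).
Qed.

Context (X : set pt) (eta : pt -> R).
Context (mX : measurable X) (etaP : is_eta P eta).

Lemma hdiff_sqdist_le g h c : (forall j, measurable_fun setT (g j)) ->
  (forall j, measurable_fun setT (h j)) -> (forall j, 0 <= c j) ->
  (forall j x, A j x -> `|g j x - h j x| <= c j) ->
  Ex P (fun z => (hdiff X eta (patchwork g) z - hdiff X eta (patchwork h) z) ^+ 2) <=
  \sum_(j < m) Num.min 2 (c j) ^+ 2 * fine (P (A j `*` setT)).
Proof.
move=> mg mh c0 gh; rewrite -Ex_patchwork_cst.
have b1 k : (forall j, measurable_fun setT (k j)) -> bmeas (hdiff X eta (patchwork k)).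
  by move=> mk; exact: (bmeas_hdiff mX etaP (measurable_patchwork mk)).
apply: Ex_le.
- by under eq_fun do rewrite expr2; apply: bmeasM; apply: bmeasB; exact: b1.
- exact: (bmeas_fst (bmeas_patchwork _)).
move=> z; rewrite sqr_hdiff_sub -[leLHS]real_normK ?num_real//.
have := patchwork_clip_close (gh ^~ z.1).
have [[j Aj]|N] := pselect (exists j, A j z.1); last first.
  have Nj j : ~ A j z.1 by move=> Aj; apply: N; exists j.
  by rewrite !patchwork_out// subrr normr0 expr0n.
rewrite !(patchwork_in _ Aj) => H; apply: lerXn2r; rewrite ?nnegrE//.
exact: le_trans H.
Qed.

End Patchwork.

(** For [eps >= Rad] the zero function alone is a net, of zero entropy, so [B] has to bound the
    ratio in the other case only. Natural numbers as indices let the nets of different pieces be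
    combined in one product. *)
Lemma gauss_cover_ord (R : realType) (d : nat) (a : R) : 0 < a ->
  exists2 K : R, 0 < K & forall (s0 : d.-tuple R) (r g Rad eps B : R),
   0 < g <= r -> 0 < eps -> 0 < Rad -> 0 <= B -> (eps < Rad -> (Rad / eps) `^ a <= B) ->
   exists (N : nat) (F : nat -> d.-tuple R -> R),
    [/\ forall i, measurable_fun setT (F i), N%:R <= expR (K * (r / g) ^+ d * B) &
     forall s, pre_norm2 g s <= Rad ^+ 2 -> exists2 i, (i < N)%N &
       forall x, dist2 x s0 < r -> `|pre_eval g s x - F i x| <= eps].
Proof.
move=> a0; have [K K0 HK] := @gauss_cover R d a a0.
exists K => // s0 r g Rad eps B /andP[g0 gr] e0 R0 B0 HB.
have r0 : 0 < r by exact: lt_le_trans gr.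
have [eR|Re] := ltP eps Rad; last first.
  exists 1%N, (fun _ _ => 0); split.
  - by move=> i; exact: measurable_cst.
  - by apply: le_trans (expR_ge1Dx _); rewrite lerDl; pos.
  move=> s sR; exists 0%N => // x _; rewrite subr0.
  have : pre_eval g s x ^+ 2 <= eps ^+ 2.
    apply: le_trans (pre_eval_le g s x) _; apply: le_trans sR _.
    by apply: lerXn2r => //; rewrite nnegrE ltW.
  by rewrite -[X in X <= _]real_normK ?num_real// ler_sqr ?nnegrE// ltW.
have [|| I [F [mF cI HF]]] := HK g r Rad eps s0; rewrite ?g0 ?gr ?e0 ?(ltW eR)//.
exists #|I|, (fun k x => if insub k is Some i then F (enum_val (i : 'I_#|I|)) x else 0); split.
- by move=> k; case: insubP => [i _ _|_]; [exact: mF|exact: measurable_cst].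
- apply: le_trans cI _; rewrite ler_expR; apply: ler_wpM2l; [by pos|exact: HB].
move=> s sR; have [i Hi] := HF s sR; exists (enum_rank i) => // x xr.
by rewrite valK enum_rankK; exact: Hi.
Qed.

(** The nets of the pieces are chosen independently: cardinalities multiply and entropies add. *)
Lemma pieces_cover (R : realType) (d : nat) (a : R) : 0 < a ->
  exists2 K : R, 0 < K & forall (m : nat) (A : 'I_m -> set (d.-tuple R)) (s0 : 'I_m -> d.-tuple R)
     (r : R) (g Rad eps B : 'I_m -> R),
   (forall j, A j `<=` ball2 (s0 j) r) ->
   (forall j, 0 < g j <= r) -> (forall j, 0 < eps j) -> (forall j, 0 < Rad j) ->
   (forall j, 0 <= B j) -> (forall j, eps j < Rad j -> (Rad j / eps j) `^ a <= B j) ->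
   exists (I : finType) (F : I -> 'I_m -> d.-tuple R -> R),
    [/\ forall i j, measurable_fun setT (F i j),
     #|I|%:R <= expR (\sum_(j < m) K * (r / g j) ^+ d * B j) &
     forall S : 'I_m -> seq (R * d.-tuple R), (forall j, pre_norm2 (g j) (S j) <= Rad j ^+ 2) ->
      exists i, forall j x, A j x -> `|pre_eval (g j) (S j) x - F i j x| <= eps j].
Proof.
move=> a0; have [K K0 HK] := @gauss_cover_ord R d a a0.
exists K => // m A s0 r g Rad eps B Ar gr e0 R0 B0 HB.
have net j := HK (s0 j) r (g j) (Rad j) (eps j) (B j) (gr j) (e0 j) (R0 j) (B0 j) (HB j).
have {net}[N /choice [F net]] := choice net.
exists ({dffun forall j : 'I_m, 'I_(N j)} : finType),
  (fun (i : {dffun forall j : 'I_m, 'I_(N j)}) j => F j (i j)); split.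
- by move=> i j; have [mF _ _] := net j; exact: mF.
- rewrite card_dep_ffun foldrE big_map big_enum /= natr_prod expR_sum.
  apply: ler_prod => j _; rewrite ler0n /= card_ord.
  by have [_ cN _] := net j.
move=> S HS.
have H j : {i : 'I_(N j) | forall x, A j x ->
    `|pre_eval (g j) (S j) x - F j i x| <= eps j}.
  apply: cid; have [_ _ /(_ _ (HS j)) [i iN Hi]] := net j.
  by exists (Ordinal iN) => x /Ar; exact: Hi.
exists (finfun (fun j => sval (H j)) : {dffun forall j, 'I_(N j)}) => j x Ax.
by rewrite ffunE; exact: (svalP (H j)).
Qed.

(* Young's inequality with exponents [1/p] and [1/(1-p)]. *)
Lemma powR_tangent (R : realType) (p y : R) : 0 < p < 1 -> 0 <= y -> y `^ p <= 1 + p * (y - 1).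
Proof.
move=> /andP[p0 p1] y0; have q0 : 0 < 1 - p by rewrite subr_gt0.
have := @conjugate_powR R (y `^ p) 1 p^-1 (1 - p)^-1.
rewrite powR_ge0 ler01 !invr_gt0 p0 q0 !invrK addrC subrK powR1 mulr1 => /(_ erefl erefl erefl erefl erefl).
rewrite -powRrM mulfV ?gt_eqF// powRr1// mul1r => H.
by apply: le_trans H _; rewrite le_eqVlt; apply/orP; left; apply/eqP; ring.
Qed.

(** The tangent bound is taken at the mean of the [x j]; the linear terms cancel in the sum. *)
Lemma sum_powR_le (R : realType) (p : R) (m : nat) (x : 'I_m -> R) : 0 < p < 1 ->
  (forall j, 0 <= x j) -> \sum_(j < m) x j `^ p <= m%:R `^ (1 - p) * (\sum_(j < m) x j) `^ p.
Proof.
move=> p01 x0; have /andP[p0 p1] := p01; have q0 : 0 < 1 - p by rewrite subr_gt0.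
set s := \sum_(j < m) x j; have s0 : 0 <= s by exact: sumr_ge0.
have [sz|sn] := eqVneq s 0.
  rewrite big1 => [|j _]; first by rewrite mulr_ge0// powR_ge0.
  have : x j <= 0 by rewrite -sz /s (bigD1 j)//= lerDl sumr_ge0.
  by move=> xj; rewrite (le_anti (_ : x j <= 0 <= x j)) ?xj ?x0// powR0// gt_eqF.
have sp : 0 < s by rewrite lt_neqAle eq_sym sn.
have m0 : 0 < m%:R :> R.
  rewrite ltr0n lt0n; apply: contraNneq sn => m0; rewrite /s.
  by apply/eqP; apply: big1 => j _; move: (leq_trans (ltn_ord j) (eq_leq m0)).
have H j : x j `^ p <= (s / m%:R) `^ p * (1 + p * (x j * (m%:R / s) - 1)).
  have -> : x j = s / m%:R * (x j * (m%:R / s)) by field; rewrite !gt_eqF.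
  have y0 : 0 <= x j * (m%:R / s) by rewrite mulr_ge0// divr_ge0// ltW.
  rewrite powRM//; last by rewrite divr_ge0// ltW.
  have -> : s / m%:R * (x j * (m%:R / s)) * (m%:R / s) = x j * (m%:R / s).
    by field; rewrite !gt_eqF.
  by apply: ler_wpM2l (powR_tangent p01 y0); exact: powR_ge0.
apply: le_trans (ler_sum _ (fun j _ => H j)) _.
rewrite -mulr_sumr big_split /= -mulr_sumr sumrB -mulr_suml -/s sumr_const card_ord.
have -> : m%:R + p * (s * (m%:R / s) - 1 *+ m) = m%:R by field; rewrite gt_eqF.
rewrite powRM ?invr_ge0 ?(ltW m0)//.
rewrite powRB ?gt_eqF ?implybT// powRr1 ?(ltW m0)// -powR_inv1 ?(ltW m0)// -powRrM mulN1r powRN.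
by rewrite le_eqVlt; apply/orP; left; apply/eqP; ring.
Qed.

Lemma powR_natr (R : realType) (x a : R) (k : nat) : 0 <= x -> x `^ a ^+ k = x `^ (k%:R * a).
Proof. by move=> x0; rewrite -powR_mulrn ?powR_ge0// -powRrM mulrC. Qed.

Lemma sum_average_le (R : realType) (m : nat) (D : R) : 0 <= D -> \sum_(j < m) D * m%:R^-1 <= D.
Proof.
move=> D0; rewrite -mulr_sumr sumr_const card_ord -[X in D * X]mulr_natr ler_piMr//.
by have [->|mn] := eqVneq m 0%N; rewrite ?mulr0// mulVf ?pnatr_eq0.
Qed.

(** Concavity merges the [m] powers at the price [m^(1-p)], which with [m^p] makes a full factor
    [m]; the bound on [r] turns [r^d m] into [16^d]. Trading [gam j ^+ 2] for [r ^+ 2] produces the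
    exponent [(d + 2p) / p] and the factor [r^(2p)]. *)
Lemma entropy_sum_le (R : realType) (d m : nat) (p r : R) (lam gam w : 'I_m -> R) :
  (0 < d)%N -> (0 < m)%N -> 0 < p < 1 -> r <= 16 * m%:R `^ (- d%:R^-1) ->
  (forall j, 0 < lam j) -> (forall j, 0 < gam j <= r) -> (forall j, 0 <= w j) ->
  \sum_(j < m) (r / gam j) ^+ d * (m%:R * w j / lam j) `^ p <=
  16 ^+ d * (r `^ (2 * p) *
    (\sum_(j < m) (lam j)^-1 * gam j `^ (- ((d%:R + 2 * p) / p)) * w j) `^ p).
Proof.
move=> d0 m0 p01 rm lam0 gr w0; have /andP[p0 p1] := p01.
have g0 j : 0 < gam j by case/andP: (gr j).
have gler j : gam j <= r by case/andP: (gr j).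
have r0 : 0 < r by exact: lt_le_trans (g0 (Ordinal m0)) (gler _).
have M0 : 0 < m%:R :> R by rewrite ltr0n.
pose x j := (lam j)^-1 * gam j `^ (- (d%:R / p)) * w j.
have x0 j : 0 <= x j by rewrite /x; have := lam0 j => ?; have := w0 j => ?; pos.
have E j : (r / gam j) ^+ d * (m%:R * w j / lam j) `^ p = r ^+ d * m%:R `^ p * x j `^ p.
  have li : 0 <= (lam j)^-1 by rewrite invr_ge0 ltW.
  have wj := w0 j; have gj := ltW (g0 j).
  rewrite /x [X in _ = _ * X `^ p]mulrAC -mulrA mulrC powRM//; last by pos.
  rewrite [in RHS]powRM//; [|by pos|by pos].
  rewrite -powRrM mulNr divfK ?gt_eqF// powRN powR_mulrn// exprMn exprVn (mulrC (w j)).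
  ring.
rewrite (eq_bigr _ (fun j _ => E j)) -mulr_sumr.
have rd : r ^+ d * m%:R <= 16 ^+ d.
  apply: (@le_trans _ _ ((16 * m%:R `^ (- d%:R^-1)) ^+ d * m%:R)).
    apply: ler_wpM2r; first exact: ltW.
    by apply: lerXn2r; rewrite ?nnegrE ?mulr_ge0// ltW.
  rewrite exprMn powR_natr ?(ltW M0)// mulrN mulfV ?pnatr_eq0 -?lt0n// powR_inv1 ?(ltW M0)//.
  by rewrite mulfVK// gt_eqF.
have xs : \sum_(j < m) x j <= r ^+ 2 * \sum_(j < m) (lam j)^-1 * gam j `^ (- ((d%:R + 2 * p) / p)) * w j.
  rewrite mulr_sumr; apply: ler_sum => j _.
  have -> : x j = gam j ^+ 2 * ((lam j)^-1 * gam j `^ (- ((d%:R + 2 * p) / p)) * w j).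
    have gn : gam j != 0 by rewrite gt_eqF.
    rewrite /x (_ : gam j `^ (- (d%:R / p)) = gam j ^+ 2 * gam j `^ (- ((d%:R + 2 * p) / p))).
      by ring.
    rewrite -powR_mulrn ?(ltW (g0 j))// -powRD ?gn ?implybT//; congr (_ `^ _); field.
    by rewrite gt_eqF.
  apply: ler_wpM2r.
    by have := lam0 j => ?; have := w0 j => ?; pos.
  by apply: lerXn2r; rewrite ?nnegrE// ltW.
apply: (@le_trans _ _ (r ^+ d * m%:R `^ p * (m%:R `^ (1 - p) * (\sum_(j < m) x j) `^ p))).
  by apply: ler_wpM2l; [pos|exact: sum_powR_le].
have -> : r ^+ d * m%:R `^ p * (m%:R `^ (1 - p) * (\sum_(j < m) x j) `^ p) =
   r ^+ d * m%:R * (\sum_(j < m) x j) `^ p.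
  have mn : m%:R != 0 :> R by rewrite gt_eqF.
  have {3}<- : m%:R `^ p * m%:R `^ (1 - p) = m%:R :> R.
    by rewrite -powRD ?mn ?implybT// addrC subrK powRr1// ltW.
  by ring.
apply: ler_pM => //; [by pos|exact: powR_ge0|].
have -> : r `^ (2 * p) = (r ^+ 2) `^ p by rewrite powRrM powR_mulrn// ltW.
have s0 : 0 <= \sum_(j < m) (lam j)^-1 * gam j `^ (- ((d%:R + 2 * p) / p)) * w j.
  by apply: sumr_ge0 => j _; have := lam0 j => ?; have := w0 j => ?; pos.
rewrite -powRM ?exprn_ge0 ?(ltW r0)//; apply: ge0_ler_powR; rewrite ?nnegrE//; first exact: ltW.
- by apply: sumr_ge0.
- by apply: mulr_ge0 => //; exact: sqr_ge0.
Qed.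

(** * Uniform deviations on the localized class *)

Section Deviation.
Context {R : realType} {d : nat}.
Local Notation pt := (d.-tuple R).

(** Two kinds of nets. At level [D] the radius [sqrt (D / u j)] on piece [j] shares [D] equally
    among the pieces, and the covering exponent [2 * p] turns the ratio of radii into
    [(s / D)^p (u j / lam j)^p]. The last net has radius [s / (32 u j)], hence L1 size [s / 32];
    with covering exponent [p] and [lam j <= 16 ^+ d * s] it costs [(u j / lam j)^p] up to a
    constant. Pieces of mass zero get the radius [Rad j], which costs nothing. *)
Lemma local_deviation (p : R) (q : \bar R) (cNE : R) : 0 < p < 1 -> (0 <= q)%E -> 1 <= cNE ->
  exists C K : R, [/\ 0 < C, 1 <= K &
  forall (X : set pt) (P : probability (pt * bool)%type R) (eta : pt -> R)
    (m : nat) (A : 'I_m -> set pt) (s0 : 'I_m -> pt) (r : R)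
    (n : nat) (tau s a : R) (lam gam : 'I_m -> R)
    (dO : measure_display) (Om : measurableType dO) (Q : probability Om R)
    (Z : 'I_n -> Om -> pt * bool),
  measurable X -> is_eta P eta -> has_NE P eta q cNE ->
  (forall j, measurable (A j)) -> (forall i j, i != j -> A i `&` A j = set0) ->
  (forall j, A j `<=` X) -> (forall j, A j `<=` ball2 (s0 j) r) ->
  (0 < n)%N -> 1 <= tau -> 0 < s <= 1 -> 1 <= a ->
  (forall j, 0 < lam j <= 16 ^+ d * s) -> (forall j, 0 < gam j <= r) ->
  K * (\sum_(j < m) (r / gam j) ^+ d * (m%:R * fine (P (A j `*` setT)) / lam j) `^ p) / n%:R <=
    a^-1 * s `^ (2 - noise_theta q - p * (1 - noise_theta q)) ->
  tau / n%:R <= a^-1 * s `^ (2 - noise_theta q) ->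
  iid_sample Q P Z ->
  exists2 E : set Om, measurable E & (Q (~` E) <= (2 * expR (- tau))%:E)%E /\
   forall w, E w -> forall S : 'I_m -> seq (R * pt),
     \sum_(j < m) lam j * pre_norm2 (gam j) (S j) <= s ->
     exc X P eta (patchwork A (fun j => pre_eval (gam j) (S j))) <= s ->
     exc X P eta (patchwork A (fun j => pre_eval (gam j) (S j)))
     - emp Z (hdiff X eta (patchwork A (fun j => pre_eval (gam j) (S j)))) w
       <= (1 / 16 + C * Num.sqrt a^-1) * s].
Proof.
move=> p01 q0 c1; have /andP[p0 p1] := p01.
have [V V1 HV] := @noise_variance R d q cNE q0 c1.
have [|C0 C00 HC0] := @arith_geo_sum_le R (4 `^ (- ((1 - p) / 2))).
  rewrite powR_ge0/= powRN invf_lt1 ?powR_gt0//.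
  have := @gt0_ltr_powR R ((1 - p) / 2) _ 1 4.
  by rewrite powR1; apply; rewrite ?nnegrE// ?divr_gt0 ?subr_gt0// ltr1n.
have pp0 : 0 < 2 * p by rewrite mulr_gt0.
have [K2 K20 HK2] := @pieces_cover R d (2 * p) pp0.
have [K1 K10 HK1] := @pieces_cover R d p p0.
pose K3 : R := (4 ^+ d * 32) `^ p.
have K30 : 0 < K3 by apply: powR_gt0; rewrite mulr_gt0// exprn_gt0.
have V0 : 0 < V by exact: lt_le_trans V1.
(* The 9 is [3 * (1 + 2)], from the two terms of the last Bernstein bound; [2 * V] includes the
   factor 2 of [Ex_sqr_hdiff_le]. The [1 / 16] of the conclusion is twice [1 / 32], for the mean of
   the net error and its empirical counterpart. *)
exists (3 * (10 * (2 * V) + 16 * (2 * V)) * C0 + 9), (1 + K2 + K1 * K3); split.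
- by pos.
- by rewrite -addrA lerDl; pos.
move=> X P eta m A s0 r n tau s a lam gam dO Om Q Z mX etaP NE mA Adis AX Ar n0 tau1 /andP[sp s1] a1.
move=> lams gr HN Htau [mZ ZP Zind].
have lam0 j : 0 < lam j by case/andP: (lams j).
have lam16 j : lam j <= 16 ^+ d * s by case/andP: (lams j).
have g0 j : 0 < gam j by case/andP: (gr j).
have a0 : 0 < a by exact: lt_le_trans a1.
set th := noise_theta q in HN Htau *.
have th01 : 0 <= th <= 1 by exact: noise_theta01.
pose w j : R := fine (P (A j `*` setT)).
have w0 j : 0 <= w j by exact: fine_ge0.
pose u j : R := m%:R * w j.
have u0 j : 0 <= u j by rewrite mulr_ge0.
have uP j : u j != 0 -> 0 < u j by move=> un; rewrite lt_neqAle eq_sym un u0.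
pose Rad j : R := Num.sqrt (s / lam j).
have Rad0 j : 0 < Rad j by rewrite sqrtr_gt0 divr_gt0.
have Rad2 j : Rad j ^+ 2 = s / lam j by rewrite sqr_sqrtr// ltW// divr_gt0.
pose f (S : 'I_m -> seq (R * pt)) := patchwork A (fun j => pre_eval (gam j) (S j)).
have mf S : measurable_fun setT (f S) by apply: measurable_patchwork => // j; exact: measurable_pre_eval.
have suppf S : supported X (f S) by move=> x Xx; apply: patchwork_out => j /AX.
pose NS (S : 'I_m -> seq (R * pt)) := \sum_(j < m) lam j * pre_norm2 (gam j) (S j).
pose FF h := exists S, [/\ NS S <= s, exc X P eta (f S) <= s & h = hdiff X eta (f S)].
have bFF h : FF h -> bmeas h.
  by move=> [S [_ _ ->]]; exact: (bmeas_hdiff mX etaP (mf S)).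
have FFR S : NS S <= s -> forall j, pre_norm2 (gam j) (S j) <= Rad j ^+ 2.
  move=> HS j; rewrite Rad2 ler_pdivlMr// mulrC; apply: le_trans HS.
  rewrite /NS (bigD1 j)//= lerDl; apply: sumr_ge0 => i _.
  by rewrite mulr_ge0 ?pre_norm2_ge0// ltW.
set U := \sum_(j < m) _ in HN.
have U0 : 0 <= U by apply: sumr_ge0 => j _; rewrite mulr_ge0 ?powR_ge0// exprn_ge0// divr_ge0 ?(ltW (g0 j))//; case/andP: (gr j) => /ltW; exact: le_trans.
set N := (1 + K2 + K1 * K3) * U in HN.
have N0 : 0 <= N by rewrite /N; pos.
have FFV h : FF h -> Ex P (fun z => h z ^+ 2) <= 2 * V * s `^ th.
  move=> [S [_ ES ->]]; apply: le_trans (Ex_sqr_hdiff_le mX etaP (mf S)) _.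
  rewrite -mulrA ler_wpM2l//.
  exact: (HV X P eta mX etaP NE (f S) s (mf S) (suppf S) (introT andP (conj sp s1)) ES).
have bnet g : (forall j, measurable_fun setT (g j)) -> bmeas (hdiff X eta (patchwork A g)).
  by move=> mg; apply: (bmeas_hdiff mX etaP); exact: measurable_patchwork.
have nets (D : R) : 0 < D -> exists (I : finType) (F : I -> pt * bool -> R),
     [/\ forall i, bmeas (F i), forall i x, `|F i x| <= 2, #|I|%:R <= expR (N * (s / D) `^ p) &
      forall f, FF f -> exists i, Ex P (fun x => (f x - F i x) ^+ 2) <= D].
  move=> D0; pose eps j := if u j == 0 then Rad j else Num.sqrt (D / u j).
  pose B j := (s / D) `^ p * (u j / lam j) `^ p.
  have e0 j : 0 < eps j.
    by rewrite /eps; case: ifPn => // /uP uj; rewrite sqrtr_gt0 divr_gt0.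
  have B0 j : 0 <= B j by rewrite mulr_ge0 ?powR_ge0.
  have HB j : eps j < Rad j -> (Rad j / eps j) `^ (2 * p) <= B j.
    rewrite /eps; case: ifPn => [_|/uP uj _]; first by rewrite ltxx.
    rewrite powRrM powR_mulrn ?divr_ge0 ?sqrtr_ge0// expr_div_n Rad2 sqr_sqrtr; last first.
      by rewrite ltW// divr_gt0.
    rewrite /B -powRM; [|by rewrite ltW// divr_gt0|by rewrite ltW// divr_gt0].
    rewrite le_eqVlt; apply/orP; left; apply/eqP; congr (_ `^ _); field.
    by rewrite !gt_eqF.
  have [I [F [mF cI HF]]] := HK2 m A s0 r gam Rad eps B Ar gr e0 Rad0 B0 HB.
  exists I, (fun i => hdiff X eta (patchwork A (F i))); split.
  - by move=> i; exact: bnet.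
  - by move=> i x; exact: hdiff_bound.
  - apply: le_trans cI _; rewrite ler_expR /N -mulrA.
    have -> : \sum_(j < m) K2 * (r / gam j) ^+ d * B j = K2 * (U * (s / D) `^ p).
      by rewrite /U mulr_suml mulr_sumr; apply: eq_bigr => j _; rewrite /B; ring.
    apply: ler_wpM2r; first by rewrite mulr_ge0 ?powR_ge0.
    by rewrite addrAC lerDr; pos.
  move=> h [S [HS _ ->]]; have [i Hi] := HF S (FFR S HS); exists i.
  apply: le_trans (hdiff_sqdist_le mA Adis mX etaP _ (mF i) (fun j => ltW (e0 j)) Hi) _.
    by move=> j; exact: measurable_pre_eval.
  have term j : Num.min 2 (eps j) ^+ 2 * w j <= D * m%:R^-1.
    have m0 : 0 < m%:R :> R by rewrite ltr0n (leq_ltn_trans _ (ltn_ord j)).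
    apply: (@le_trans _ _ (eps j ^+ 2 * w j)).
      apply: ler_wpM2r => //; apply: lerXn2r; rewrite ?nnegrE ?le_min ?(ltW (e0 j)) ?andbT//.
      by rewrite ge_min lexx orbT.
    rewrite /eps; case: ifPn => [|/uP uj].
      by rewrite mulf_eq0 gt_eqF//= => /eqP ->; rewrite mulr0 divr_ge0// ltW.
    rewrite sqr_sqrtr; last by rewrite ltW// divr_gt0.
    move: uj; rewrite /u pmulr_rgt0// => wj.
    by rewrite le_eqVlt; apply/orP; left; apply/eqP; field; rewrite !gt_eqF.
  apply: le_trans (ler_sum _ (fun j _ => term j)) _.
  exact: sum_average_le (ltW D0).
pose eps j := if u j == 0 then Rad j else 1 / 32 * s / u j.
have e0 j : 0 < eps j by rewrite /eps; case: ifPn => // /uP uj; rewrite divr_gt0// mulr_gt0// divr_gt0.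
pose B j := K3 * (u j / lam j) `^ p.
have B0 j : 0 <= B j by rewrite mulr_ge0 ?powR_ge0.
have HB j : eps j < Rad j -> (Rad j / eps j) `^ p <= B j.
  rewrite /eps; case: ifPn => [_|/uP uj _]; first by rewrite ltxx.
  rewrite /B -powRM; [|by rewrite mulr_ge0// exprn_ge0|by rewrite ltW// divr_gt0].
  apply: ge0_ler_powR; rewrite ?nnegrE ?(ltW p0)//.
  - by have := Rad0 j => ?; apply: divr_ge0; [pos|rewrite !mulr_ge0 ?invr_ge0// ltW].
  - by rewrite !mulr_ge0 ?invr_ge0 ?exprn_ge0// ltW.
  have -> : Rad j / (1 / 32 * s / u j) = Rad j * lam j / s * 32 * (u j / lam j).
    by field; rewrite !gt_eqF.
  apply: ler_wpM2r; first by rewrite ltW// divr_gt0.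
  rewrite ler_pM2r// ler_pdivrMr// -ler_sqr ?nnegrE; last 2 first.
  - by have := Rad0 j => ?; have := lam0 j => ?; pos.
  - by rewrite mulr_ge0 ?exprn_ge0// ltW.
  rewrite !exprMn Rad2 -exprM mulnC exprM.
  have -> : s / lam j * lam j ^+ 2 = lam j * s by field; rewrite gt_eqF.
  rewrite expr2 -[s ^+ 2]/(s * s) mulrA ler_pM2r//.
  by have -> : 4 * 4 = 16 :> R by ring.
have [J [G [mG cJ HJ]]] := HK1 m A s0 r gam Rad eps B Ar gr e0 Rad0 B0 HB.
pose RJ h j := exists S, h = hdiff X eta (f S) /\
   forall i x, A i x -> `|pre_eval (gam i) (S i) x - G j i x| <= eps i.
pose c0 j := Num.min 2 (eps j).
have c00 j : 0 <= c0 j by rewrite le_min ler0n ltW.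
have c0s : \sum_(j < m) c0 j * w j <= 1 / 32 * s.
  have term j : c0 j * w j <= 1 / 32 * s * m%:R^-1.
    have m0 : 0 < m%:R :> R by rewrite ltr0n (leq_ltn_trans _ (ltn_ord j)).
    apply: (@le_trans _ _ (eps j * w j)).
      by apply: ler_wpM2r => //; rewrite ge_min lexx orbT.
    rewrite /eps; case: ifPn => [|/uP uj].
      by rewrite mulf_eq0 gt_eqF//= => /eqP ->; rewrite mulr0 !mulr_ge0 ?invr_ge0// ltW.
    move: uj; rewrite /u pmulr_rgt0// => wj.
    by rewrite le_eqVlt; apply/orP; left; apply/eqP; field; rewrite !gt_eqF.
  apply: le_trans (ler_sum _ (fun j _ => term j)) _.
  by apply: sum_average_le; rewrite mulr_ge0 ?(ltW sp).
have cJ' : #|J|%:R <= expR N.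
  apply: le_trans cJ _; rewrite ler_expR /N.
  have -> : \sum_(j < m) K1 * (r / gam j) ^+ d * B j = K1 * K3 * U.
    by rewrite /U mulr_sumr; apply: eq_bigr => j _; rewrite /B; ring.
  by apply: ler_wpM2r => //; rewrite lerDr; pos.
have HRJ h : FF h -> exists j, RJ h j.
  by move=> [S [HS _ ->]]; have [j Hj] := HJ S (FFR S HS); exists j, S.
have RJs h j : FF h -> RJ h j -> Ex P (fun x => (h x - hdiff X eta (patchwork A (G j)) x) ^+ 2) <= s.
  move=> _ [S [-> Hj]].
  apply: le_trans (hdiff_sqdist_le mA Adis mX etaP _ (mG j) (fun j => ltW (e0 j)) Hj) _.
    by move=> i; exact: measurable_pre_eval.
  apply: (@le_trans _ _ (2 * \sum_(j < m) c0 j * w j)); last by move: c0s sp; lra.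
  rewrite mulr_sumr; apply: ler_sum => i _; rewrite mulrA; apply: ler_wpM2r; first exact: w0.
  by rewrite expr2; apply: ler_wpM2r; [exact: c00|rewrite /c0 ge_min lexx].
have V1' : 1 <= 2 * V by lra.
have [E1 mE1 [QE1 HE1]] := chain_deviation mZ ZP Zind n0 bFF p01 V1' HC0 th01
  (introT andP (conj sp s1)) a1 N0 tau1 HN Htau FFV nets
  (fun j => bnet _ (mG j)) (fun j z => hdiff_bound _ _ _ z) cJ' HRJ RJs.
(* The last net is only [ee]-close uniformly on each piece, so replacing [f] by its net point
   costs [Ex ee] plus the empirical mean of [ee]. *)
pose ee := patchwork A (fun j _ => c0 j).
have bee : bmeas (fun z : pt * bool => ee z.1) by exact: bmeas_fst (bmeas_patchwork mA c0).
have ee0 x : 0 <= ee x by apply: (patchwork_ind Adis (Q := fun v => 0 <= v)) => // j _; exact: c00.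
have ee2 x : ee x <= 2.
  by apply: (patchwork_ind Adis (Q := fun v => v <= 2)) => // j _; rewrite /c0 ge_min lexx.
have Exee : Ex P (fun z : pt * bool => ee z.1) <= 1 / 32 * s by rewrite /ee Ex_patchwork_cst.
have v0 : 0 <= 1 / 16 * s by rewrite mulr_ge0// ltW.
have ee2v : Ex P (fun z : pt * bool => (- ee z.1) ^+ 2) <= 1 / 16 * s.
  apply: (@le_trans _ _ (2 * Ex P (fun z : pt * bool => ee z.1))); last first.
    by have := ler_wpM2l (ler0n _ 2) Exee; congr (_ <= _); field.
  rewrite -ExZ//; apply: Ex_le; [|exact: bmeasZ|].
    by under eq_fun do rewrite expr2; apply: bmeasM; exact: bmeasN.
  by move=> z; rewrite sqrrN expr2 ler_wpM2r.
have two0 : 0 < 2 :> R by [].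
have tau0 : 0 <= tau by exact: le_trans tau1.
have nee (z : pt * bool) : `|- ee z.1| <= 2 by rewrite normrN ger0_norm.
have [E2 mE2 [QE2 HE2]] := bernstein mZ ZP Zind n0 two0 v0 tau0 (bmeasN bee) nee ee2v.
exists (E1 `&` E2); first exact: measurableI.
split.
  rewrite setCI.
  have mC1 : measurable (~` E1) by exact: measurableC.
  have mC2 : measurable (~` E2) by exact: measurableC.
  apply: le_trans (measureU2 Q mC1 mC2) _.
  have -> : 2 * expR (- tau) = expR (- tau) + expR (- tau) by ring.
  by rewrite EFinD; apply: leeD.
move=> om [E1om E2om] S HS ES.
have FFS : FF (hdiff X eta (f S)) by exists S.
have [j Rj Hj] := HE1 om E1om _ FFS.
have [S' [ES' Hj']] := Rj.
have hG z : `|hdiff X eta (f S) z - hdiff X eta (patchwork A (G j)) z| <= ee z.1.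
  rewrite ES'; apply: le_trans (patchwork_clip_close Adis (Hj' ^~ z.1)).
  rewrite -ler_sqr ?nnegrE// real_normK ?num_real// real_normK ?num_real//.
  rewrite sqr_hdiff_sub; exact: lexx.
have bS := bmeas_hdiff mX etaP (mf S).
have bG := bnet _ (mG j).
have I1 : exc X P eta (f S) <= Ex P (hdiff X eta (patchwork A (G j))) + 1 / 32 * s.
  apply: le_trans (_ : _ <= Ex P (fun z => hdiff X eta (patchwork A (G j)) z + ee z.1)) _.
    apply: Ex_le => //; first exact: bmeasD.
    by move=> z; have := le_trans (ler_norm _) (hG z); rewrite lerBlDl.
  by rewrite ExD// lerD2l.
have I2 : emp Z (hdiff X eta (patchwork A (G j))) om <=
    emp Z (hdiff X eta (f S)) om + emp Z (fun z => ee z.1) om.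
  rewrite /emp -mulrDr -big_split /=; apply: ler_wpM2l; first by rewrite invr_ge0.
  apply: ler_sum => i _; have := hG (Z i om); rewrite distrC => /(le_trans (ler_norm _)).
  by rewrite lerBlDl.
have I3 : emp Z (fun z => ee z.1) om <= Ex P (fun z : pt * bool => ee z.1) + dev n 2 (1 / 16 * s) tau.
  have := HE2 om E2om; rewrite /emp.
  have -> : Ex P (fun z : pt * bool => - ee z.1) = - Ex P (fun z : pt * bool => ee z.1).
    rewrite -mulN1r -ExZ//; congr (Ex P); apply/funext => z; by rewrite mulN1r.
  by rewrite sumrN mulrN opprK [X in X <= _]addrC lerBlDl.
have sa0 : 0 <= Num.sqrt a^-1 by exact: sqrtr_ge0.
have sa1 : Num.sqrt a^-1 <= 1.
  by rewrite -[leRHS]sqrtr1; apply: ler_wsqrtr; rewrite invf_le1.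
have sa2 : Num.sqrt a^-1 ^+ 2 = a^-1 by rewrite sqr_sqrtr// invr_ge0 ltW.
have taus : tau / n%:R <= a^-1 * s.
  apply: le_trans Htau _; apply: ler_wpM2l; first by rewrite invr_ge0 ltW.
  rewrite -[leRHS](powRr1 (ltW sp)); apply: ger_powR; rewrite ?sp//.
  by case/andP: th01 => _ th1; rewrite lerBrDr -[2]/(1 + 1) lerD2l.
have I4 : dev n 2 (1 / 16 * s) tau <= 9 * (Num.sqrt a^-1 * s).
  have h1 : Num.sqrt (1 / 16 * s * tau / n%:R) <= Num.sqrt a^-1 * s.
    rewrite -[leRHS]ger0_norm ?mulr_ge0 ?(ltW sp)// -sqrtr_sqr; apply: ler_wsqrtr.
    rewrite exprMn sa2 -[1 / 16 * s * tau / _]mulrA -mulrA.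
    have q0' : 0 <= tau / n%:R by rewrite divr_ge0.
    have h : s * (tau / n%:R) <= a^-1 * s ^+ 2.
      by rewrite expr2 [leRHS]mulrCA; apply: ler_wpM2l; [exact: ltW|].
    apply: le_trans h; rewrite ler_piMl//; last by rewrite ler_pdivrMr// mul1r ler1n.
    by rewrite mulr_ge0// ltW.
  have h2 : 2 * tau / n%:R <= 2 * (Num.sqrt a^-1 * s).
    rewrite -mulrA ler_wpM2l//; apply: le_trans taus _; apply: ler_wpM2r; first exact: ltW.
    by rewrite -[leLHS]sa2 expr2 ler_piMr.
  rewrite /dev; move: h1 h2; clear.
  by move: (Num.sqrt (_ / n%:R)) (2 * tau / n%:R) (Num.sqrt a^-1 * s) => x y z; lra.
have -> : exc X P eta (patchwork A (fun j => pre_eval (gam j) (S j))) = exc X P eta (f S) by [].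
rewrite -/(f S).
set C := 3 * _ * C0 in Hj *.
have -> : (1 / 16 + (C + 9) * Num.sqrt a^-1) * s =
  1 / 16 * s + C * (Num.sqrt a^-1 * s) + 9 * (Num.sqrt a^-1 * s) by ring.
move: Hj I1 I2 I3 I4 Exee; move: (Num.sqrt a^-1 * s) => y; move: (C * y) (dev _ _ _ _) => cy dv.
by clear; lra.
Qed.
End Deviation.

(** * Comparison with the oracle *)

(** If [x] is at distance at least [t] from the other class, every point within [t / 2] of [x] is
    closer to the class of [x], so the labels equal [fstar X eta x] there; this radius turns the 2
    of [gauss_approx] into the 8 of [margin_noise_excess]. Both error terms grow with the bandwidth,
    so [gam j] may be replaced by the largest one. *)
Lemma oracle_pieces (R : realType) (d : nat) (beta cM : R) : 0 < beta -> 1 <= cM ->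
  exists2 C : R, 0 < C &
  forall (X : set (d.-tuple R)) (P : probability (d.-tuple R * bool)%type R) eta
    (m : nat) (A : 'I_m -> set (d.-tuple R)) (gam : 'I_m -> R),
    measurable X -> X `<=` cube -> is_eta P eta -> has_MNE X P eta beta cM ->
    (0 < m)%N -> (forall j, measurable (A j)) -> (forall i j, i != j -> A i `&` A j = set0) ->
    (\bigcup_(j in [set: 'I_m]) A j = X) -> (forall j, 0 < gam j <= 16) ->
  exists a : 'I_m -> seq (R * d.-tuple R),
    [/\ forall j, pre_norm2 (gam j) (a j) <= C * gam j `^ (- d%:R),
     forall j x, A j x -> `|pre_eval (gam j) (a j) x| <= 1 &
     exc X P eta (patchwork A (fun j => pre_eval (gam j) (a j))) <=
       C * (\big[Num.max/0]_(j < m) gam j) `^ beta].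
Proof.
move=> b0 c1; have [C1 C10 HC1] := @gauss_approx R d beta b0.
have [C2 C20 HC2] := @margin_noise_excess R d beta cM b0 c1.
exists (C1 + C1 * C2); first by pos.
move=> X P eta m A gam mX Xc etaP MNE m0 mA Adis AX gam16.
have g0 j : 0 < gam j by case/andP: (gam16 j).
set gmax := \big[Num.max/0]_(j < m) gam j.
have gm j : gam j <= gmax by exact: le_bigmax.
have gmax0 : 0 < gmax by exact: lt_le_trans (g0 (Ordinal m0)) (gm _).
(* The labels are defined on the whole space, since grid nodes need not lie in [X]. *)
pose e (z : d.-tuple R) : R := if (setdist z (Xpos X eta) < setdist z (Xneg X eta))%E then 1 else -1.
have e1 z : `|e z| <= 1 by rewrite /e; case: ifP; rewrite ?normrN normr1.
have /choice[a Ha] j := HC1 (gam j) e (gam16 j) e1.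
have AXj j : A j `<=` X by rewrite -AX; exact: bigcup_sup.
exists a; split.
- move=> j; have [h _] := Ha j; apply: le_trans h _; apply: ler_wpM2r; first exact: powR_ge0.
  by rewrite lerDl; pos.
- by move=> j x Ax; have [_ /(_ x (Xc _ (AXj _ _ Ax))) []] := Ha j.
have mg : measurable_fun setT (patchwork A (fun j => pre_eval (gam j) (a j))).
  by apply: measurable_patchwork => // j; exact: measurable_pre_eval.
apply: le_trans (HC2 X P eta mX etaP MNE _ gmax C1 mg _ _ gmax0 (ltW C10) _) _.
- by move=> x Xx; apply: patchwork_out => j /AXj.
- move=> x; apply: (patchwork_ind Adis (Q := fun v => `|v| <= 1)); last by rewrite normr0.
  by move=> j Ax; have [_ /(_ x (Xc _ (AXj _ _ Ax))) []] := Ha j.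
- move=> x Hx t t0 tD.
  have Xx : X x by case: Hx => [[]|[]].
  have [j _ Ax] : (\bigcup_(j in [set: 'I_m]) A j) x by rewrite AX.
  rewrite (patchwork_in Adis _ Ax) distrC.
  have [_ /(_ x (Xc _ Xx)) [_ H]] := Ha j.
  have t20 : 0 <= t / 2 by rewrite divr_ge0.
  have He z : dist2 z x < t / 2 -> e z = fstar X eta x.
    move=> zx; have xz : dist2 x z <= t / 2 by rewrite dist2C ltW.
    have tt : (t / 2)%:E = (t - t / 2)%:E :> \bar R by congr (_%:E); field.
    case: Hx => Hx.
      have Nx : ~ Xneg X eta x by move=> [_]; case: Hx => _ /lt_trans h /h; rewrite ltxx.
      move: tD; rewrite /Delta; case: asboolP => // _; case: asboolP => // _ tD.
      have h1 : (setdist z (Xpos X eta) < (t / 2)%:E)%E by apply/setdist_ltP; exists x.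
      have h2 : ((t / 2)%:E <= setdist z (Xneg X eta))%E.
        by rewrite tt; exact: setdist_triangle tD xz.
      by rewrite /e (lt_le_trans h1 h2); case: Hx => _ ex; rewrite fstar_pos.
    move: tD; rewrite /Delta; case: asboolP => // _ tD.
    have h1 : (setdist z (Xneg X eta) < (t / 2)%:E)%E by apply/setdist_ltP; exists x.
    have h2 : ((t / 2)%:E <= setdist z (Xpos X eta))%E.
      by rewrite tt; exact: setdist_triangle tD xz.
    rewrite /e ltNge (ltW (lt_le_trans h1 h2)) /=; case: Hx => _ ex.
    by rewrite fstar_neg// ltW.
  apply: le_trans (H _ _ (fstar_norm X eta x) t20 He) _.
  apply: ler_wpM2l; first exact: ltW.
  apply: lerD.
    by apply: ge0_ler_powR; rewrite ?nnegrE// ltW.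
  rewrite ler_expR lerN2.
  have -> : (t / 2) ^+ 2 / (2 * gam j ^+ 2) = t ^+ 2 / (8 * gam j ^+ 2).
    by field; rewrite gt_eqF.
  apply: ler_wpM2l; first exact: sqr_ge0.
  have gj0 := g0 j.
  rewrite lef_pV2 ?posrE; [|by pos|by pos].
  rewrite ler_pM2l//; apply: lerXn2r; rewrite ?nnegrE//; exact: ltW.
rewrite mulrA; apply: ler_wpM2r; first exact: powR_ge0.
by rewrite lerDr ltW.
Qed.

(** * Localization of the SVM solution along a segment *)

Section Localization.
Context {R : realType} {d : nat}.
Local Notation pt := (d.-tuple R).

Lemma measurable_hat_rkhs (A : set pt) (gam : R) f c : measurable A ->
  hat_rkhs_elem A gam f c -> measurable_fun setT f.
Proof.
move=> mA [[h [_ _ hf _]] f0].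
apply: (@measurable_fun_cvg _ _ _ _ (fun k x => \1_A x * pre_eval gam (h k) x)).
  by move=> k; apply: measurable_funM; [exact: measurable_indic|exact: measurable_pre_eval].
move=> x _; have [Ax|Ax] := pselect (A x).
  rewrite (_ : (fun k => _) = (fun k => pre_eval gam (h k) x)); first exact: hf.
  by apply/funext => k; rewrite indicE mem_set// mul1r.
rewrite f0// (_ : (fun k => _) = fun=> 0); first exact: cvg_cst.
by apply/funext => k; rewrite indicE memNset// mul0r.
Qed.

Lemma rkhs_elem_ext (A : set pt) (gam : R) f g c : (forall x, A x -> f x = g x) ->
  rkhs_elem A gam f c -> rkhs_elem A gam g c.
Proof.
move=> fg [h [h1 h2 h3 h4]]; exists h; split => //.
by move=> x Ax; rewrite -fg//; exact: h3.
Qed.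

Definition blend (t : R) (a b : seq (R * pt)) := kscale (1 - t) a ++ kscale t b.

Lemma pre_eval_blend g t a b x :
  pre_eval g (blend t a b) x = (1 - t) * pre_eval g a x + t * pre_eval g b x.
Proof. by rewrite /blend pre_evalD !pre_evalZ. Qed.

Lemma pre_norm2_blend_le g t a b : 0 <= t <= 1 ->
  pre_norm2 g (blend t a b) <= (1 - t) * pre_norm2 g a + t * pre_norm2 g b.
Proof. by move=> t01; rewrite !pre_norm2E; apply: kform_convex => //; exact: kgauss_psd. Qed.

(** The squared norm is a quadratic polynomial in [t]. A one-sided bound is enough for the path
    argument, which excludes upward jumps. *)
Lemma pre_norm2_blend_lip g a b : exists2 L, 0 <= L & forall t t' : R, 0 <= t -> t <= t' -> t' <= 1 ->
  pre_norm2 g (blend t' a b) <= pre_norm2 g (blend t a b) + (t' - t) * L.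
Proof.
pose al := pre_norm2 g a; pose be := kform (kgauss g) a b; pose ga := pre_norm2 g b.
have E t : pre_norm2 g (blend t a b) = al + 2 * t * (be - al) + t ^+ 2 * (al - 2 * be + ga).
  rewrite pre_norm2E /blend !kform_catl !kform_catr !kform_scalel !kform_scaler.
  rewrite (kform_sym b a); last exact: kgaussC.
  by rewrite /al /be /ga !pre_norm2E; ring.
exists (2 * `|be - al| + 2 * `|al - 2 * be + ga|); first by pos.
move=> t t' t0 tt t1; rewrite !E.
have h1 : (t' - t) * (be - al) <= (t' - t) * `|be - al|.
  by apply: ler_wpM2l; [rewrite subr_ge0|exact: ler_norm].
have h2 : (t' - t) * (t + t') * (al - 2 * be + ga) <= (t' - t) * 2 * `|al - 2 * be + ga|.
  apply: (@le_trans _ _ ((t' - t) * (t + t') * `|al - 2 * be + ga|)).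
    apply: ler_wpM2l; last exact: ler_norm.
    by rewrite mulr_ge0 ?subr_ge0// addr_ge0// (le_trans t0).
  apply: ler_wpM2r => //; apply: ler_wpM2l; first by rewrite subr_ge0.
  by rewrite -[leRHS]/(1 + 1); apply: lerD => //; exact: le_trans t1.
have h3 : (t' - t) * (t + t') * (al - 2 * be + ga) = (t' ^+ 2 - t ^+ 2) * (al - 2 * be + ga) by ring.
move: h1 h2; rewrite h3; move: (al - 2 * be + ga) (be - al) => y x.
move: (`|y|) (`|x|) => ny nx; clear; move: al => al h1 h2; nra.
Qed.

Lemma sum_pieces (m n : nat) (A : 'I_m -> set pt) (D : 'I_n -> pt * bool) (u : 'I_m -> 'I_n -> R) :
  \sum_(j < m) \sum_(i < n | `[< A j (D i).1 >]) u j i =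
  \sum_(i < n) patchwork A (fun j _ => u j i) (D i).1.
Proof.
rewrite /patchwork exchange_big /=; apply: eq_bigr => j _.
rewrite big_mkcond /=; apply: eq_bigr => i _; rewrite indicE.
by case: asboolP => H; [rewrite mem_set// mul1r|rewrite memNset// mul0r].
Qed.

End Localization.

Local Notation pwk A gam S := (patchwork A (fun j => pre_eval (gam j) (S j))).
Local Notation empD n D h := (n%:R^-1 * \sum_(i < n) h (D i)).
Local Notation NS lam gam S := (\sum_j lam j * pre_norm2 (gam j) (S j)).

(** A deterministic statement: the sample is fixed, and randomness enters only through the two
    deviation hypotheses, for the class and for the oracle. *)
Lemma svm_localized (R : realType) (d : nat) (X : set (d.-tuple R))
    (P : probability (d.-tuple R * bool)%type R) (eta : d.-tuple R -> R)
    (m : nat) (A : 'I_m -> set (d.-tuple R)) (lam gam : 'I_m -> R)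
    (n : nat) (D : 'I_n -> d.-tuple R * bool) (f : 'I_m -> d.-tuple R -> R)
    (a : 'I_m -> seq (R * d.-tuple R)) (s : R) :
  measurable X -> is_eta P eta -> (forall j, measurable (A j)) ->
  (forall i j, i != j -> A i `&` A j = set0) -> \bigcup_(j in [set: 'I_m]) A j = X ->
  (forall j, 0 < lam j) -> 0 < s ->
  (forall j, is_svm_sol D (A j) (lam j) (gam j) (f j)) ->
  (forall j x, A j x -> `|pre_eval (gam j) (a j) x| <= 1) ->
  (forall S, NS lam gam S <= s -> exc X P eta (pwk A gam S) <= s ->
     exc X P eta (pwk A gam S) - empD n D (hdiff X eta (pwk A gam S)) <= s / 8) ->
  empD n D (hdiff X eta (pwk A gam a)) - exc X P eta (pwk A gam a) <= s / 8 ->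
  exc X P eta (pwk A gam a) <= s / 8 -> 4 * NS lam gam a <= s / 16 ->
  measurable_fun setT (fun x => \sum_(j < m) f j x) /\
  exc X P eta (fun x => \sum_(j < m) f j x) <= s.
Proof.
move=> mX etaP mA Adis AX lam0 s0 sol a1 Hdev Ha Hex HN.
have /choice[c Hc] := sol.
have mf j : measurable_fun setT (f j).
  by have [h _] := Hc j; exact: measurable_hat_rkhs (mA j) h.
split; first exact: measurable_sum.
have mpw S : measurable_fun setT (pwk A gam S).
  by apply: measurable_patchwork => // j; exact: measurable_pre_eval.
have AXj j : A j `<=` X by rewrite -AX; exact: bigcup_sup.
have supp S : supported X (pwk A gam S) by move=> x Xx; apply: patchwork_out => j /AXj.
have NS0 (S : 'I_m -> seq (R * d.-tuple R)) : 0 <= NS lam gam S.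
  by apply: sumr_ge0 => j _; rewrite mulr_ge0 ?pre_norm2_ge0// ltW.
have E0 S : 0 <= exc X P eta (pwk A gam S) by exact: (exc_ge0 mX etaP (mpw S) (@supp S)).
(* When the solution on a piece is replaced by a finite sum within [k], the norm term changes by at
   most [k * lam j] and the hinge term by at most [k]; the choice of [k] keeps the total below
   [s / 16]. *)
pose La := \sum_(j < m) (lam j + 1).
have La0 : 0 <= La by apply: sumr_ge0 => j _; rewrite addr_ge0// ltW.
pose k := s / (16 * (La + 1)).
have k0 : 0 < k by rewrite divr_gt0// mulr_gt0// ltr_wpDl.
have kLa : k * La <= s / 16.
  have -> : s / 16 = k * (La + 1) by rewrite /k; field; rewrite gt_eqF// ltr_wpDl.
  by apply: ler_wpM2l; [exact: ltW|rewrite lerDl].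
have ks : k <= s / 2.
  rewrite /k; apply: ler_wpM2l; first exact: ltW.
  by rewrite lef_pV2 ?posrE// ?mulr_gt0 ?ltr_wpDl//; move: La0; clear; lra.
have /choice[b Hb] j : exists h, `|pre_norm2 (gam j) h - c j| <= k /\
    forall x, A j x -> `|f j x - pre_eval (gam j) h x| <= k.
  have [[hj _] _] := Hc j; have [h [_ h1 h2]] := rkhs_approx hj k0.
  by exists h.
pose S t j := blend t (a j) (b j).
have n10 : 0 <= n%:R^-1 :> R by rewrite invr_ge0.
have avgle j (u : 'I_n -> R) (v : R) : 0 <= v -> (forall i, A j (D i).1 -> u i <= v) ->
    n%:R^-1 * \sum_(i < n | `[< A j (D i).1 >]) u i <= v.
  move=> v0 uv; apply: (@le_trans _ _ (n%:R^-1 * \sum_(i < n) v)).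
    apply: ler_wpM2l => //; rewrite big_mkcond /=; apply: ler_sum => i _.
    by case: asboolP => // h; exact: uv.
  rewrite sumr_const card_ord -[v *+ n]mulr_natr mulrCA ler_piMr//.
  by have [->|nn] := eqVneq n 0%N; rewrite ?mulr0// mulVf ?pnatr_eq0.
pose H j (u : (d.-tuple R) -> R) := n%:R^-1 * \sum_(i < n | `[< A j (D i).1 >]) hinge (D i).2 (u (D i).1).
(* The competitor is the oracle restricted to the piece and extended by 0; the factor 4 is that of
   [rkhs_restrict]. *)
have opt j : lam j * pre_norm2 (gam j) (b j) + H j (pre_eval (gam j) (b j)) <=
    4 * (lam j * pre_norm2 (gam j) (a j)) + H j (pre_eval (gam j) (a j)) + k * (lam j + 1).
  have [hc hopt] := Hc j; have [hb1 hb2] := Hb j.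
  have [c' c'le hc'] := rkhs_restrict (A j) (gam j) (a j).
  pose ga x := \1_(A j) x * pre_eval (gam j) (a j) x.
  have gaE x : A j x -> ga x = pre_eval (gam j) (a j) x.
    by move=> Ax; rewrite /ga indicE mem_set// mul1r.
  have hga : hat_rkhs_elem (A j) (gam j) ga c'.
    split; last by move=> x Ax; rewrite /ga indicE memNset// mul0r.
    by apply: rkhs_elem_ext hc' => x /gaE.
  have := hopt ga c' hga; rewrite /svm_obj.
  have -> : n%:R^-1 * \sum_(i < n | `[< A j (D i).1 >]) hinge (D i).2 (ga (D i).1) =
     H j (pre_eval (gam j) (a j)).
    by congr (_ * _); apply: eq_bigr => i /asboolP /gaE ->.
  have h1 : H j (pre_eval (gam j) (b j)) <= H j (f j) + k.
    rewrite -lerBlDl /H -mulrBr -sumrB; apply: avgle; first exact: ltW.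
    move=> i Ai; apply: le_trans (ler_norm _) _; apply: le_trans (hinge_lip _ _ _) _.
    by rewrite distrC; exact: hb2.
  have h2 : lam j * pre_norm2 (gam j) (b j) <= lam j * c j + k * lam j.
    rewrite (mulrC k) -mulrDr; apply: ler_wpM2l; first exact: ltW.
    by rewrite -lerBlDl; apply: le_trans (ler_norm _) hb1.
  have h3 : lam j * c' <= 4 * (lam j * pre_norm2 (gam j) (a j)).
    by rewrite mulrCA; apply: ler_wpM2l => //; exact: ltW.
  move: h1 h2 h3; rewrite -/(H j (f j)) mulrDr mulr1.
  move: (H j _) (H j _) (H j _) (lam j * _) (lam j * _) (lam j * _) (lam j * _) (k * lam j).
  by clear; move=> x1 x2 x3 x4 x5 x6 x7 x8; lra.
(* The end [t = 0] satisfies the bound trivially and the end [t = 1] by optimality; convexity gives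
   the segment between them. *)
have optS t j : 0 <= t <= 1 ->
    lam j * pre_norm2 (gam j) (S t j) + H j (fun x => clip (pre_eval (gam j) (S t j) x)) <=
    4 * (lam j * pre_norm2 (gam j) (a j)) + H j (pre_eval (gam j) (a j)) + k * (lam j + 1).
  move=> t01; have /andP[t0 t1] := t01; have t1' : 0 <= 1 - t by rewrite subr_ge0.
  have h1 : lam j * pre_norm2 (gam j) (S t j) <=
      (1 - t) * (lam j * pre_norm2 (gam j) (a j)) + t * (lam j * pre_norm2 (gam j) (b j)).
    rewrite mulrCA [X in _ + X]mulrCA -mulrDr; apply: ler_wpM2l; first exact: ltW.
    exact: pre_norm2_blend_le.
  have h2 : H j (fun x => clip (pre_eval (gam j) (S t j) x)) <=
      (1 - t) * H j (pre_eval (gam j) (a j)) + t * H j (pre_eval (gam j) (b j)).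
    rewrite /H mulrCA [X in _ + X]mulrCA -mulrDr; apply: ler_wpM2l => //.
    rewrite !mulr_sumr -big_split /=; apply: ler_sum => i _.
    apply: le_trans (hinge_clip_le _ _) _; rewrite pre_eval_blend.
    exact: hinge_convex.
  have ha : 0 <= lam j * pre_norm2 (gam j) (a j) by rewrite mulr_ge0 ?pre_norm2_ge0// ltW.
  have hk : 0 <= k * (lam j + 1) by rewrite mulr_ge0 ?addr_ge0// ltW.
  have h3 := ler_wpM2l t0 (opt j).
  move: h1 h2 h3 ha hk; move: (H j _) (H j _) (H j _) (lam j * _) (lam j * _) (lam j * _) (k * _).
  move: t0 t1'; clear=> t0 t1 x1 x2 x3 x4 x5 x6 x7 h1 h2 h3 h4 h5.
  have h6 := mulr_ge0 t1 h4; have h7 := mulr_ge0 t1 h5.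
  by move: h1 h2 h3 h6 h7 h4; rewrite !mulrDr; lra.
have HS (u : 'I_m -> d.-tuple R -> R) : \sum_(j < m) H j (u j) =
    n%:R^-1 * \sum_(i < n) patchwork A (fun j _ => hinge (D i).2 (u j (D i).1)) (D i).1.
  by rewrite /H -mulr_sumr sum_pieces.
have emp_opt t : 0 <= t <= 1 ->
    NS lam gam (S t) + empD n D (hdiff X eta (pwk A gam (S t))) <= 4 * NS lam gam a + empD n D (hdiff X eta (pwk A gam a)) + k * La.
  move=> t01; have := @ler_sum _ _ (index_enum 'I_m) xpredT _ _ (fun j _ => optS t j t01).
  rewrite !big_split /= (HS (fun j x => clip (pre_eval (gam j) (S t j) x))).
  rewrite (HS (fun j => pre_eval (gam j) (a j))) -[\sum_j 4 * _]mulr_sumr -[\sum_j k * _]mulr_sumr => h.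
  (* On a piece both losses are affine, and the contribution of [fstar] cancels in the difference of
     the two [hdiff]; sample points outside all pieces contribute 0 to both sides. *)
  suff HE : \sum_(i < n) patchwork A (fun j _ => hinge (D i).2 (clip (pre_eval (gam j) (S t j) (D i).1))) (D i).1 -
     \sum_(i < n) patchwork A (fun j _ => hinge (D i).2 (pre_eval (gam j) (a j) (D i).1)) (D i).1 =
     \sum_(i < n) hdiff X eta (pwk A gam (S t)) (D i) - \sum_(i < n) hdiff X eta (pwk A gam a) (D i).
    have := congr1 (fun v => n%:R^-1 * v) HE; rewrite /= !mulrBr.
    move: h; rewrite -/La; move: (n%:R^-1 * _) (n%:R^-1 * _) (n%:R^-1 * _) (n%:R^-1 * _) => x1 x2 x3 x4.
    by move: (\sum_(j < m) _) (k * La) (4 * _); clear=> x5 x6 x7; lra.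
  rewrite -!sumrB; apply: eq_bigr => i _.
  have [[j Aj]|N] := pselect (exists j, A j (D i).1); last first.
    have Nj j : ~ A j (D i).1 by move=> Aj; apply: N; exists j.
    by rewrite /hdiff !patchwork_out// subrr subrr.
  rewrite /hdiff !(patchwork_in Adis _ Aj) !hinge_small ?clip_norm ?a1//.
  by rewrite (clip_id (a1 j _ Aj)); ring.
have /choice[L1 HL1] j : exists L, 0 <= L /\ forall t t' : R, 0 <= t -> t <= t' -> t' <= 1 ->
  pre_norm2 (gam j) (S t' j) <= pre_norm2 (gam j) (S t j) + (t' - t) * L.
  by have [L L0 h] := pre_norm2_blend_lip (gam j) (a j) (b j); exists L.
pose M j := Num.sqrt (pre_norm2 (gam j) (pre_sub (b j) (a j))).
have M0 j : 0 <= M j by exact: sqrtr_ge0.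
have HM j x : `|pre_eval (gam j) (b j) x - pre_eval (gam j) (a j) x| <= M j.
  by rewrite -pre_eval_sub -sqrtr_sqr; apply: ler_wsqrtr; exact: pre_eval_le.
pose L := \sum_(j < m) lam j * L1 j + \sum_(j < m) M j.
have L0 : 0 <= L.
  apply: addr_ge0; apply: sumr_ge0 => j _ //.
  by apply: mulr_ge0; [exact: ltW|have [] := HL1 j].
pose phi t := NS lam gam (S t) + exc X P eta (pwk A gam (S t)).
have bh S' : bmeas (hdiff X eta (pwk A gam S')) by exact: (bmeas_hdiff mX etaP (mpw S')).
have exc_close S' (v : 'I_m -> (d.-tuple R) -> R) (cc : 'I_m -> R) (e : R) : (forall j, measurable_fun setT (v j)) ->
    (forall j x, A j x -> `|v j x - pre_eval (gam j) (S' j) x| <= cc j) -> 0 <= e ->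
    (forall j, cc j <= e) ->
    exc X P eta (patchwork A v) <= exc X P eta (pwk A gam S') + e.
  move=> mv hv e0 cce; rewrite /exc.
  have bv := bmeas_hdiff mX etaP (measurable_patchwork mA mv).
  rewrite -(Ex_cst P e) -ExD//; last exact: bmeas_cst.
  apply: Ex_le => //; first by apply: bmeasD => //; exact: bmeas_cst.
  move=> z; rewrite -lerBlDl; apply: le_trans (ler_norm _) _.
  have h : `|hdiff X eta (patchwork A v) z - hdiff X eta (pwk A gam S') z| =
     `|clip (patchwork A v z.1) - clip (pwk A gam S' z.1)|.
    by rewrite -!sqrtr_sqr sqr_hdiff_sub.
  rewrite h; apply: le_trans (patchwork_clip_close Adis (hv ^~ z.1)) _.
  apply: (patchwork_ind Adis (Q := fun y => y <= e)) => // j _.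
  by rewrite ge_min cce orbT.
have phi_lip t t' : 0 <= t -> t <= t' -> t' <= 1 -> phi t' <= phi t + (t' - t) * L.
  move=> t0 tt t1; have dt : 0 <= t' - t by rewrite subr_ge0.
  have h1 : NS lam gam (S t') <= NS lam gam (S t) + (t' - t) * \sum_(j < m) lam j * L1 j.
    rewrite mulr_sumr -big_split /=; apply: ler_sum => j _.
    by rewrite mulrCA -mulrDr; apply: ler_wpM2l; [exact: ltW|have [_] := HL1 j; apply].
  have h2 : exc X P eta (pwk A gam (S t')) <= exc X P eta (pwk A gam (S t)) + (t' - t) * \sum_(j < m) M j.
    apply: (exc_close _ _ (fun j => (t' - t) * M j)).
    - by move=> j; exact: measurable_pre_eval.
    - move=> j x _; rewrite !pre_eval_blend.
      have -> : (1 - t') * pre_eval (gam j) (a j) x + t' * pre_eval (gam j) (b j) x -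
        ((1 - t) * pre_eval (gam j) (a j) x + t * pre_eval (gam j) (b j) x) =
        (t' - t) * (pre_eval (gam j) (b j) x - pre_eval (gam j) (a j) x) by ring.
      by rewrite normrM ger0_norm//; apply: ler_wpM2l.
    - by rewrite mulr_ge0// sumr_ge0.
    - move=> j; apply: ler_wpM2l => //; rewrite (bigD1 j)//= lerDl; exact: sumr_ge0.
  rewrite /phi /L mulrDr addrACA; exact: lerD.
(* Along the segment, [phi] cannot jump from [s / 2] above [s] in one step, and below [s] the
   deviation bound and the optimality of the SVM solution bring it back under [s / 2]. *)
have phi_step t t' : 0 <= t -> t <= t' -> t' <= 1 -> (t' - t) * L <= s / 2 ->
    phi t <= s / 2 -> phi t' <= s / 2.
  move=> t0 tt t1 tL h.
  have hs : phi t' <= s by have := phi_lip t t' t0 tt t1; move: h tL; clear; lra.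
  have t01 : 0 <= t' <= 1 by rewrite t1 (le_trans t0).
  have e1 := E0 (S t').
  have e2 := NS0 (S t').
  have e3 := emp_opt t' t01.
  have hN : NS lam gam (S t') <= s by move: hs e1; rewrite /phi; clear; lra.
  have hE : exc X P eta (pwk A gam (S t')) <= s by move: hs e2; rewrite /phi; clear; lra.
  (* The budget: [s / 16] for the norm of the oracle, [s / 8] for its excess, [s / 8] for its
     deviation, [s / 16] for the finite approximation and [s / 8] for the deviation at [t'], in
     total [s / 2]. *)
  have := Hdev (S t') hN hE; rewrite /phi.
  move: e3 Ha Hex HN kLa; move: (NS lam gam (S t')) (NS lam gam a) (exc _ _ _ _) (exc _ _ _ _) (k * La) => x1 x2 x3 x4 x5.
  by move: (n%:R^-1 * _) (n%:R^-1 * _); clear=> x6 x7; lra.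
pose Nn := (Num.truncn (2 * L / s)).+1.
have Nn0 : 0 < Nn%:R :> R by rewrite ltr0n.
have NL : Nn%:R^-1 * L <= s / 2.
  have h : 2 * L / s < Nn%:R by exact: truncnS_gt.
  rewrite ler_pdivrMl//; move: h; rewrite ltr_pdivrMr// => h.
  by move: h; clear; lra.
have phiN i : (i <= Nn)%N -> phi (i%:R / Nn%:R) <= s / 2.
  elim: i => [_|i IH iN].
    rewrite mul0r /phi.
    have -> : NS lam gam (S 0) = NS lam gam a.
      apply: eq_bigr => j _; congr (_ * _); rewrite /S /blend !pre_norm2E.
      rewrite !kform_catl !kform_catr !kform_scalel !kform_scaler; ring.
    have -> : pwk A gam (S 0) = pwk A gam a.
      apply/funext => x; apply: eq_bigr => j _; rewrite pre_eval_blend.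
      by congr (_ * _); ring.
    by move: Hex HN s0; move: (NS lam gam a) (exc _ _ _ _); clear=> x1 x2; lra.
  have ii : i.+1%:R / Nn%:R - i%:R / Nn%:R = Nn%:R^-1 :> R.
    by rewrite -mulrBl -[i.+1%:R]natr1 [i%:R + 1]addrC addrK mul1r.
  apply: (phi_step (i%:R / Nn%:R)).
  - by rewrite divr_ge0.
  - by rewrite ler_pM2r ?invr_gt0// ler_nat.
  - by rewrite ler_pdivrMr// mul1r ler_nat.
  - by rewrite ii.
  - by apply: IH; exact: ltnW.
have phi1 : phi 1 <= s / 2 by have := phiN Nn (leqnn _); rewrite divff// gt_eqF.
have fE : (fun x => \sum_(j < m) f j x) = patchwork A f.
  apply/funext => x; apply: eq_bigr => j _; rewrite indicE.
  have [Ax|Ax] := pselect (A j x); first by rewrite mem_set// mul1r.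
  by rewrite memNset// mul0r; have [[_ ->]] := Hc j.
rewrite fE; apply: le_trans (exc_close (S 1) f (fun=> k) k mf _ (ltW k0) _) _.
- move=> j x Ax; rewrite pre_eval_blend subrr mul0r add0r mul1r.
  by have [_] := Hb j; apply.
- by [].
have := NS0 (S 1); move: phi1 ks; rewrite /phi; move: (NS lam gam _) (exc _ _ _ _) => x1 x2.
by clear; lra.
Qed.

(** Inverting [qexp1] and [qexp2] turns the last two terms of the theorem into the powers of [s]
    required by the deviation bound. At [q = +oo] all these exponents are 1. *)
Lemma noise_exponents (R : realType) (q : \bar R) (p : R) : (0 <= q)%E -> 0 < p < 1 ->
  [/\ 0 < qexp1 q, (qexp1 q)^-1 = 2 - noise_theta q, 0 < qexp2 q p &
    (qexp2 q p)^-1 = 2 - noise_theta q - p * (1 - noise_theta q)].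
Proof.
move=> q0 /andP[p0 p1]; case: q q0 => [q|_|//] /=; last first.
  by split=> //; rewrite invr1; ring.
rewrite lee_fin => q0; have q1 : 0 < q + 1 by rewrite ltr_wpDl.
have q2 : 0 < q + 2 by rewrite ltr_wpDl.
have q3 : 0 < q + 2 - p by rewrite subr_gt0 (lt_le_trans p1)// ler_wpDl// ler1n.
by split; rewrite ?divr_gt0//; field; rewrite ?gt_eqF.
Qed.

Lemma powR_root_le (R : realType) (x y e : R) : 0 <= x -> 0 < e -> x `^ e <= y -> x <= y `^ e^-1.
Proof.
move=> x0 e0 xy; rewrite -[leLHS](powRr1 x0) -[X in x `^ X](mulfV (lt0r_neq0 e0)) powRrM.
apply: ge0_ler_powR; rewrite ?nnegrE ?invr_ge0 ?powR_ge0 ?(ltW e0)//.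
by apply: le_trans xy; exact: powR_ge0.
Qed.

(** A power at least 1 of [a^-1 <= 1] is at most [a^-1]: enlarging the constant in [s] gains a full
    factor in each condition on [s]. *)
Lemma powR_div_le (R : realType) (s a w : R) : 0 <= s -> 1 <= a -> 1 <= w ->
  (s / a) `^ w <= a^-1 * s `^ w.
Proof.
move=> s0 a1 w1; have a0 : 0 < a by exact: lt_le_trans a1.
rewrite mulrC powRM ?invr_ge0 ?(ltW a0)//; apply: ler_wpM2r; first exact: powR_ge0.
have ai0 : 0 <= a^-1 by rewrite invr_ge0 ltW.
by rewrite -[leRHS](powRr1 ai0); apply: ger_powR => //; rewrite invr_gt0 a0 invf_le1.
Qed.

Lemma radius_ball2 (R : realType) (d : nat) (T : set (d.-tuple R)) (r : R) :
  (Defs.radius T < r%:E)%E -> exists s, T `<=` ball2 s r.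
Proof.
move=> /ereal_inf_lt[_ [e [e0 [s Ts Te]] <-]]; rewrite lte_fin => er.
by exists s => x /Te h; exact: lt_trans h er.
Qed.

Lemma inv_tower (R : realType) (d : nat) (g : R) : 0 < g -> g `^ (- d%:R) * g ^+ d = 1.
Proof. by move=> g0; rewrite powRN powR_mulrn ?ltW// mulVf// expf_neq0// gt_eqF. Qed.

Theorem theorem1 (R : realType) (d : nat) (beta p : R) (q : \bar R) (cMNE cNE : R) :
  (0 < d)%N -> 0 < beta -> (0 <= q)%E -> 0 < p < 1 -> 1 <= cMNE -> 1 <= cNE ->
  exists C : R, 0 < C /\
  forall (X : set (d.-tuple R)) (P : probability (d.-tuple R * bool)%type R)
         (eta : d.-tuple R -> R),
    measurable X -> X `<=` cube -> P (X `*` setT) = 1%E ->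
    is_eta P eta -> has_MNE X P eta beta cMNE -> has_NE P eta q cNE ->
  forall (m : nat) (A : 'I_m -> set (d.-tuple R)) (r : R),
    assumptionA X A r ->
  forall (n : nat) (tau : R) (lam gam : 'I_m -> R),
    (1 <= n)%N -> 1 <= tau <= n%:R ->
    (forall j, 0 < lam j) -> (forall j, 0 < gam j <= r) ->
  forall (dO : measure_display) (Om : measurableType dO) (Q : probability Om R)
         (Z : 'I_n -> Om -> d.-tuple R * bool),
    iid_sample Q P Z ->
  forall f : 'I_m -> Om -> d.-tuple R -> R,
    (forall j w, is_svm_sol (fun i => Z i w) (A j) (lam j) (gam j) (f j w)) ->
  exists E : set Om, [/\ measurable E,
    (Q E >= (1 - 3 * expR (- tau))%:E)%E &
    forall w, E w ->
      (risk P (fun x => clip (\sum_(j < m) f j w x)) - bayes_risk P <=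
       (C * (\sum_(j < m) lam j * gam j `^ (- d%:R)
             + (\big[Num.max/0]_(j < m) gam j) `^ beta
             + (tau / n%:R) `^ qexp1 q
             + (r `^ (2 * p)
                * (\sum_(j < m) (lam j)^-1 * gam j `^ (- ((d%:R + 2 * p) / p))
                                * fine (P (A j `*` setT))) `^ p
                / n%:R) `^ qexp2 q p))%:E)%E].
Proof.
move=> d0 b0 q0 p01 cM1 cN1; have /andP[p0 p1] := p01.
have [C1 C10 HO] := @oracle_pieces R d beta cMNE b0 cM1.
have [C2 [K [C20 K1 HD]]] := @local_deviation R d p q cNE p01 q0 cN1.
have [V V1 HV] := @noise_variance R d q cNE q0 cN1.
have [e10 e1E e20 e2E] := noise_exponents q0 p01.
have /andP[th0 th1] := noise_theta01 q0; set th := noise_theta q in HV e1E e2E th0 th1 *.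
have V0 : 0 < V by exact: lt_le_trans V1.
have K0 : 0 < K by exact: lt_le_trans K1.
(* [(16 * C2) ^+ 2] gives [C2 / sqrt a <= 1 / 16], so deviations on the class are at most [s / 8].
   [2 * 48 ^+ 2 * V] makes both terms of Bernstein's bound for the oracle at most [s / 48], and 3
   times their sum is [s / 8]. *)
pose a := 1 + (16 * C2) ^+ 2 + 2 * 48 ^+ 2 * V.
have a1 : 1 <= a by rewrite /a -addrA lerDl; pos.
have a0 : 0 < a by exact: lt_le_trans a1.
(* The first summand absorbs the entropy constant and leaves [a^-1]; [64 * C1] brings both the norm
   and the excess of the oracle below [s / 64]. *)
pose B := a * (K * 16 ^+ d) + 64 * C1.
have K16 : 1 <= K * 16 ^+ d by rewrite mulr_ege1// exprn_ege1// ler1n.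
have aB : a <= B.
  rewrite /B (le_trans (_ : _ <= a * (K * 16 ^+ d)))//; first by rewrite ler_peMr// ltW.
  by rewrite lerDl; pos.
have B1 : 1 <= B by exact: le_trans aB.
have B0 : 0 < B by exact: lt_le_trans B1.
have C1B : 64 * C1 <= B by rewrite lerDr; pos.
exists (2 * B); split; first by pos.
move=> X P eta mX Xc PX etaP MNE NE m A r [mA Adis AX Aint rm] n tau lam gam n1 /andP[tau1 taun].
move=> lam0 gr dO Om Q Z iid f sol.
have g0 j : 0 < gam j by case/andP: (gr j).
have AXj j : A j `<=` X by rewrite -AX; exact: bigcup_sup.
have m0 : (0 < m)%N.
  rewrite lt0n; apply/eqP => mz; have : X = set0.
    by rewrite -AX -subset0 => x [j _ _]; move: (leq_trans (ltn_ord j) (eq_leq mz)).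
  by move=> X0; move: PX; rewrite X0 set0X measure0 => /eqP; rewrite eqe eq_sym oner_eq0.
have r16 : r <= 16.
  apply: le_trans rm _; rewrite ler_piMr// powRN invf_le1 ?powR_gt0 ?ltr0n//.
  rewrite -[leLHS](powRr0 m%:R); apply: ler_powR; first by rewrite ler1n.
  by rewrite invr_ge0.
have g16 j : 0 < gam j <= 16 by rewrite g0 (le_trans _ r16)//; case/andP: (gr j).
have n0 : 0 < n%:R :> R by rewrite ltr0n.
have tn0 : 0 < tau / n%:R by rewrite divr_gt0// (lt_le_trans ltr01).
set S1 := \sum_(j < m) lam j * _; set G := _ `^ beta; set t1 := _ `^ qexp1 q.
set T0 := r `^ (2 * p) * _; set T1 := (T0 / _) `^ _.
have S10 : 0 <= S1 by apply: sumr_ge0 => j _; rewrite mulr_ge0 ?powR_ge0// ltW.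
have G0 : 0 <= G by exact: powR_ge0.
have t10 : 0 < t1 by exact: powR_gt0.
have T00 : 0 <= T0 by rewrite mulr_ge0 ?powR_ge0.
have T10 : 0 <= T1 by exact: powR_ge0.
set rho := S1 + G + t1 + T1.
have rho0 : 0 < rho by rewrite /rho; pos.
pose s := B * rho; have s0 : 0 < s by exact: mulr_gt0.
have rs : rho = s / B by rewrite /s [B * rho]mulrC mulfK// gt_eqF.
have S1r : S1 <= rho by rewrite /rho -!addrA lerDl; pos.
have Gr : G <= rho by rewrite /rho -!addrA [leRHS]addrCA lerDl; pos.
have t1r : t1 <= rho by rewrite /rho addrAC lerDr; pos.
have T1r : T1 <= rho by rewrite /rho lerDr; pos.
have rhos : rho <= s by rewrite /s ler_peMl// ltW.
have mf j w : measurable_fun setT (f j w).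
  by have [c [h _]] := sol j w; exact: measurable_hat_rkhs (mA j) h.
have mF w : measurable_fun setT (fun x => \sum_(j < m) f j w x) by exact: measurable_sum.
have concl w : exc X P eta (fun x => \sum_(j < m) f j w x) <= 2 * s ->
    (risk P (fun x => clip (\sum_(j < m) f j w x)) - bayes_risk P <= (2 * B * rho)%:E)%E.
  move=> h; apply: le_trans (risk_bayes_le mX PX etaP (mF w)) _.
  by rewrite lee_fin -mulrA.
(* For [s > 1] the bound is trivial, as the excess never exceeds 2; this is the origin of the 2 in
   [2 * B]. *)
have [s1|s1] := leP s 1; last first.
  exists setT; split => //.
    by rewrite probability_setT lee_fin gerBl mulr_ge0// expR_ge0.
  move=> w _; apply: concl; apply: le_trans (exc_le2 mX etaP (mF w)) _.
  by rewrite ler_peMr// ltW.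
have taus : tau / n%:R <= a^-1 * s `^ (2 - th).
  rewrite -e1E; apply: le_trans (powR_root_le (ltW tn0) e10 t1r) _; rewrite rs.
  apply: le_trans (powR_div_le (ltW s0) B1 _) _.
    by rewrite e1E lerBrDr -[leRHS]/(1 + 1) lerD2l.
  by apply: ler_wpM2r; [exact: powR_ge0|rewrite lef_pV2 ?posrE].
have Ts : T0 / n%:R <= B^-1 * s `^ (2 - th - p * (1 - th)).
  rewrite -e2E; apply: le_trans (powR_root_le (divr_ge0 T00 (ltW n0)) e20 T1r) _; rewrite rs.
  apply: powR_div_le => //; first exact: ltW.
  rewrite e2E.
  have -> : 2 - th - p * (1 - th) = 1 + (1 - p) * (1 - th) by ring.
  by rewrite lerDl mulr_ge0// subr_ge0// ltW.
have /choice[c Hc] j : exists c, A j `<=` ball2 c r by apply: radius_ball2; have [] := Aint j.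
have w0 j : 0 <= fine (P (A j `*` setT)) by exact: fine_ge0.
have Us := entropy_sum_le d0 m0 p01 rm lam0 gr w0.
(* From a single term of the first sum in [rho] and [gam j <= 16]; the last net of the chain relies
   on it. *)
have lams j : 0 < lam j <= 16 ^+ d * s.
  rewrite lam0 /=.
  have h : lam j * gam j `^ (- d%:R) <= s.
    apply: le_trans rhos; apply: le_trans S1r.
    rewrite /S1 (bigD1 j)//= lerDl; apply: sumr_ge0 => i _.
    by rewrite mulr_ge0 ?powR_ge0// ltW.
  apply: (@le_trans _ _ (gam j ^+ d * (lam j * gam j `^ (- d%:R)))).
    by rewrite mulrCA (mulrC (_ ^+ d)) inv_tower ?mulr1.
  apply: ler_pM => //; first by rewrite exprn_ge0// ltW.
    by rewrite mulr_ge0 ?powR_ge0// ltW.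
  by apply: lerXn2r; rewrite ?nnegrE ?(ltW (g0 j))//; case/andP: (g16 j).
have entropy : K * (\sum_(j < m) (r / gam j) ^+ d *
     (m%:R * fine (P (A j `*` setT)) / lam j) `^ p) / n%:R <= a^-1 * s `^ (2 - th - p * (1 - th)).
  apply: (@le_trans _ _ (K * 16 ^+ d * (T0 / n%:R))).
    rewrite mulrA; apply: ler_wpM2r; first by rewrite invr_ge0 ltW.
    by rewrite -mulrA; apply: ler_wpM2l Us; exact: ltW.
  apply: (@le_trans _ _ (K * 16 ^+ d * (B^-1 * s `^ (2 - th - p * (1 - th))))).
    by apply: ler_wpM2l => //; rewrite (le_trans ler01).
  rewrite mulrA; apply: ler_wpM2r; first exact: powR_ge0.
  rewrite ler_pdivrMr// ler_pdivlMl//.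
  by rewrite /B lerDl; pos.
have s01 : 0 < s <= 1 by rewrite s0 s1.
have [E1 mE1 [QE1 HE1]] := HD X P eta m A c r n tau s a lam gam dO Om Q Z mX etaP NE mA Adis AXj Hc
  n1 tau1 s01 a1 lams gr entropy taus iid.
have [u [u1 u2 u3]] := HO X P eta m A gam mX Xc etaP MNE m0 mA Adis AX g16.
set F0 := patchwork A (fun j => pre_eval (gam j) (u j)) in u3.
have mF0 : measurable_fun setT F0.
  by apply: measurable_patchwork => // j; exact: measurable_pre_eval.
have sF0 : supported X F0 by move=> x Xx; apply: patchwork_out => j /AXj.
have oex : exc X P eta F0 <= s / 8.
  apply: le_trans u3 _; rewrite -/G; apply: (@le_trans _ _ (C1 * rho)).
    by apply: ler_wpM2l => //; exact: ltW.
  rewrite rs mulrCA; apply: ler_wpM2l; first exact: ltW.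
  by rewrite ler_pdivrMr// ler_pdivlMl//; move: C1B C10; clear; lra.
have oN : 4 * (\sum_(j < m) lam j * pre_norm2 (gam j) (u j)) <= s / 16.
  apply: (@le_trans _ _ (4 * (C1 * rho))).
    apply: ler_wpM2l => //; apply: (@le_trans _ _ (C1 * S1)); last first.
      by apply: ler_wpM2l => //; exact: ltW.
    rewrite /S1 mulr_sumr; apply: ler_sum => j _; rewrite mulrCA.
    by apply: ler_wpM2l; [exact: ltW|exact: u1].
  rewrite rs mulrA mulrCA; apply: ler_wpM2l; first exact: ltW.
  by rewrite ler_pdivrMr// ler_pdivlMl//; move: C1B; clear; lra.
have [mZ ZP Zind] := iid.
have bh := bmeas_hdiff mX etaP mF0.
have two0 : 0 < 2 :> R by [].
have v0 : 0 <= 2 * V * s `^ th by rewrite mulr_ge0 ?powR_ge0// mulr_ge0// ltW.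
have tau0 : 0 <= tau by exact: le_trans tau1.
have nh z : `|- hdiff X eta F0 z| <= 2 by rewrite normrN; exact: hdiff_bound.
have vh : Ex P (fun z => (- hdiff X eta F0 z) ^+ 2) <= 2 * V * s `^ th.
  under eq_fun do rewrite sqrrN.
  apply: le_trans (Ex_sqr_hdiff_le mX etaP mF0) _; rewrite -mulrA ler_wpM2l//.
  apply: (HV X P eta mX etaP NE F0 s mF0 sF0 s01); apply: le_trans oex _.
  by move: s0; clear; lra.
(* For the oracle the empirical mean has to be bounded by the expectation, the opposite direction,
   hence the sign of [hdiff]. *)
have [E2 mE2 [QE2 HE2]] := bernstein mZ ZP Zind n1 two0 v0 tau0 (bmeasN bh) nh vh.
exists (E1 `&` E2); split; first exact: measurableI.
  have mE : measurable (E1 `&` E2) by exact: measurableI.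
  have hC : (Q (~` (E1 `&` E2)) <= (3 * expR (- tau))%:E)%E.
    rewrite setCI.
    have mC1 : measurable (~` E1) by exact: measurableC.
    have mC2 : measurable (~` E2) by exact: measurableC.
    apply: le_trans (measureU2 Q mC1 mC2) _.
    have -> : 3 * expR (- tau) = 2 * expR (- tau) + expR (- tau) by ring.
    by rewrite EFinD; apply: leeD.
  have QE : Q (E1 `&` E2) \is a fin_num by exact: fin_num_measure.
  move: hC; rewrite probability_setC// -(fineK QE) -EFinB !lee_fin.
  by move: (fine _) (expR _) => x y; clear; lra.
move=> w [E1w E2w]; apply: concl.
have Z0 := svm_localized (D := fun i => Z i w) mX etaP mA Adis AX lam0 s0 (sol ^~ w) u2.
have sa : Num.sqrt a^-1 * (16 * C2) <= 1.
  rewrite -[leRHS]sqrtr1 -[16 * C2]ger0_norm ?mulr_ge0 ?(ltW C20)// -sqrtr_sqr -sqrtrM ?invr_ge0 ?(ltW a0)//.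
  apply: ler_wsqrtr; rewrite ler_pdivrMl// mulr1.
  by rewrite /a addrAC lerDr; pos.
have [||_ h] := Z0 _ _ oex oN.
- move=> S NSs ESs; apply: le_trans (HE1 w E1w S NSs ESs) _.
  rewrite mulrC; apply: ler_wpM2l; first exact: ltW.
  by move: sa; clear; lra.
- have := HE2 w E2w; rewrite /emp sumrN mulrN opprK.
  have -> : Ex P (fun z => - hdiff X eta F0 z) = - exc X P eta F0.
    by rewrite /exc -mulN1r -ExZ//; congr (Ex P); apply/funext => z; rewrite mulN1r.
  rewrite addrC => /le_trans; apply.
  rewrite /dev.
  have h1 : Num.sqrt (2 * V * s `^ th * tau / n%:R) <= 1 / 48 * s.
    have s48 : 0 <= 1 / 48 * s by rewrite mul1r; pos.
    rewrite -[leRHS](ger0_norm s48) -sqrtr_sqr; apply: ler_wsqrtr.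
    rewrite -mulrA exprMn; apply: (@le_trans _ _ (2 * V * s `^ th * (a^-1 * s `^ (2 - th)))).
      exact: ler_wpM2l.
    have -> : 2 * V * s `^ th * (a^-1 * s `^ (2 - th)) = 2 * V * a^-1 * s ^+ 2.
      have sn : s != 0 by rewrite gt_eqF.
      have <- : s `^ th * s `^ (2 - th) = s ^+ 2.
        by rewrite -powRD ?sn ?implybT// addrC subrK powR_mulrn// ltW.
      by ring.
    apply: ler_wpM2r; first exact: sqr_ge0.
    rewrite ler_pdivrMr//.
    have -> : 2 * V = (1 / 48) ^+ 2 * (2 * 48 ^+ 2 * V) by field.
    by apply: ler_wpM2l; [exact: sqr_ge0|rewrite /a lerDr; pos].
  have h2 : 2 * tau / n%:R <= 1 / 48 * s.
    rewrite -mulrA; apply: (@le_trans _ _ (2 * (a^-1 * s))).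
      apply: ler_wpM2l => //; apply: le_trans taus _; apply: ler_wpM2l; first by rewrite invr_ge0 ltW.
      rewrite -[leRHS](powRr1 (ltW s0)); apply: ger_powR => //.
      by rewrite lerBrDr -[leRHS]/(1 + 1) lerD2l.
    rewrite mulrA; apply: ler_wpM2r; first exact: ltW.
    rewrite ler_pdivrMr//.
    have -> : 2 = 1 / 48 * (2 * 48) :> R by field.
    apply: ler_wpM2l; first by rewrite mul1r invr_ge0.
    apply: (@le_trans _ _ (2 * 48 ^+ 2 * V)); last by rewrite /a lerDr; pos.
    rewrite expr2 mulrA -[X in _ <= X]mulrA ler_peMr// mulr_ege1// ler1n//.
  by move: h1 h2; move: (Num.sqrt _) (2 * tau / _); clear=> x y; lra.
by apply: le_trans h _; rewrite ler_peMl ?(ltW s0)// ler1n.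
Qed.
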